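(* Define $$\mathcal{E_T}=\{2,3,4,5,7,9,11,13,19,25,29,31,37,41,43,49,61,81,97,121,169\},\qquad \mathcal{E_S}=\{2,3,4,5,7,13\}.$$ Then $\mathcal{E_T}$ is exactly the set of prime powers not in $\mathcal{T}$, and $\mathcal{E_S}$ is exactly the set of prime powers not in $\mathcal{S}$.
   Context: For a prime power $q$, $\mathbb{F}_q$ is the field of order $q$ and a primitive element is a generator of $\mathbb{F}_q^*$. For non-zero $u,v\in\mathbb{F}_q$: a pair $(a,b)$ of primitive elements is $(u,v)$-primitive if $ua+vb$ and $va^{-1}+ub^{-1}$ are also primitive; a single primitive element $a$ is $(u,v)$-primitive if $ua+va^{-1}$ is also primitive. $\mathcal{S}$ is the set of prime powers $q$ such that for every pair of non-zero $u,v\in\mathbb{F}_q$ there exists a $(u,v)$-primitive pair in $\mathbb{F}_q$; $\mathcal{T}$ is the set of prime powers $q$ such that for every pair of non-zero $u,v\in\mathbb{F}_q$ there exists a $(u,v)$-primitive element in $\mathbb{F}_q$. *)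

(* Defs.v *)
From HB Require Import structures.
From mathcomp Require Import all_boot all_order all_algebra all_field.
Set Implicit Arguments. Unset Strict Implicit. Unset Printing Implicit Defensive.
Import GRing.Theory.
Local Open Scope ring_scope.

Definition prime_power (q : nat) : Prop :=
  exists p k : nat, [/\ prime p, (0 < k)%N & q = (p ^ k)%N].

(* a primitive element of F = a generator of F^* = a primitive (|F|-1)-th
   root of unity. *)
Definition primitive_elt (F : finFieldType) (a : F) : bool :=
  (#|F|.-1).-primitive_root a.

Definition uv_primitive_pair (F : finFieldType) (u v a b : F) : Prop :=
  [/\ primitive_elt a, primitive_elt b,
      primitive_elt (u * a + v * b) & primitive_elt (v * a^-1 + u * b^-1)].

Definition uv_primitive_elt (F : finFieldType) (u v a : F) : Prop :=
  primitive_elt a /\ primitive_elt (u * a + v * a^-1).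

Definition S_prop (F : finFieldType) : Prop :=
  forall u v : F, u != 0 -> v != 0 -> exists a b : F, uv_primitive_pair u v a b.

Definition T_prop (F : finFieldType) : Prop :=
  forall u v : F, u != 0 -> v != 0 -> exists a : F, uv_primitive_elt u v a.

Definition in_S (q : nat) : Prop :=
  forall F : finFieldType, #|F| = q -> S_prop F.
Definition in_T (q : nat) : Prop :=
  forall F : finFieldType, #|F| = q -> T_prop F.

Definition E_T : seq nat :=
  [:: 2; 3; 4; 5; 7; 9; 11; 13; 19; 25; 29; 31; 37; 41; 43; 49; 61; 81; 97;
      121; 169]%N.
Definition E_S : seq nat := [:: 2; 3; 4; 5; 7; 13]%N.

(* Main.v *)
(* Fix a generator g of F^*, put n = |F| - 1, u = g^U and v = g^V. A primitive a with u a + v / a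
   primitive exists as soon as some i, j with g^i + g^j = 1 avoid, modulo each odd prime l dividing n,
   one value of i + j and one value of i - j, and satisfy conditions modulo 4. The number of such
   pairs is estimated with Jacobi sums, a sieve replacing the union over all l by exact conditions
   for the smallest primes and a union bound for the others. A search tree over the possible sets of
   prime divisors leaves a finite list of values of n. For each of them that comes from a prime power
   outside E_T, a certificate gives a table of discrete logarithms, built from multiplicative
   relations, and for each class modulo 4 a few solutions of g^i + g^j = 1 no two of which can be
   excluded by many congruences at once. The fields of E_T are examined directly; when T holds,
   b = 1/a gives S. *)
From Stdlib Require Import PArith NArith.
Require Import Defs.
From mathcomp Require Import all_boot all_order all_algebra all_field all_solvable.
From mathcomp Require Import zify ring lra.
Set Implicit Arguments. Unset Strict Implicit. Unset Printing Implicit Defensive.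
Import Order.TTheory GRing.Theory Num.Theory.
Local Open Scope ring_scope.

(** The pair [(i, j)] separates the two unknowns: [i + j] sees only the exponent of [u a + v / a],
    [i - j] only that of [a]. The asymmetry pays in the estimate: a nontrivial character of [i - j]
    alone gives a Jacobi sum of absolute value 1, while one involving [i + j] costs [sqrt q], so the
    frequencies of the two variables are weighed separately. The obstacle is that the bound still
    leaves thousands of orders, some above 10^6, where running over all [(u, v)] is out of reach.
    There only the residues of [U + V] and [U - V] modulo the primes of [n] matter, and each residue
    spoils few points, so a count on a short list of points serves all [(u, v)] of a class at once.
    Computations are made with coefficient lists and carried to an arbitrary field of the given
    order by evaluation at a root, so that no isomorphism between fields of equal order enters. *)

Definition odd_prime_divisor (n l : nat) : bool := [&& prime l, odd l & l %| n]%N.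

(** Put [a = g^A] and [u a + v / a = g^S]. Dividing by [g^S] gives [i = U + A - S] and
    [j = V - A - S], so [i + j = U + V - 2 S] and [i - j = U - V + 2 A]. The conditions express that
    [S] and [A] are prime to [n]. Oddness of [A] shows in [i - j] modulo 4 only when 4 divides
    [n]. *)
Definition good_point (n U V i j : nat) : Prop :=
  [/\ ~~ odd n -> odd i = odd U /\ odd j = odd V,
      (4 %| n)%N -> (i + V = j + U + 2 %[mod 4])%N &
      forall l, odd_prime_divisor n l ->
        (i + j != U + V %[mod l])%N /\ (i + V != j + U %[mod l])%N].

Lemma coprime_prime_divisors (m n : nat) : (0 < n)%N ->
  (forall l, prime l -> (l %| n)%N -> ~~ (l %| m)%N) -> coprime m n.
Proof.
move=> n0 H; rewrite /coprime; apply/eqP/eqP; rewrite eqn_leq gcdn_gt0 n0 orbT andbT leqNgt.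
apply/negP => /pdivP[l lp]; rewrite dvdn_gcd => /andP[lm ln].
by move: (H l lp ln); rewrite lm.
Qed.

Lemma eqn_modP (d m n : nat) :
  reflect (exists c : int, m%:Z - n%:Z = d%:Z * c) (m == n %[mod d])%N.
Proof.
have -> : (m == n %[mod d])%N = (d%:Z %| m%:Z - n%:Z)%Z.
  by rewrite -eqz_mod_dvd !modz_nat eqz_nat.
apply: (iffP idP) => [/dvdzP[c ->]|[c ->]]; last by rewrite dvdz_mulr.
by exists c; rewrite mulrC.
Qed.

(** * Logarithms to a generator; from exponent conditions to [T_prop] and [S_prop] *)

Section PrimitiveRoots.
Variable F : finFieldType.
Let n := #|F|.-1.

Lemma card_finField_gt0 : (0 < n)%N.
Proof. by rewrite /n -subn1 subn_gt0 finNzRing_gt1. Qed.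

Lemma finField_fermat (x : F) : x != 0 -> x ^+ n = 1.
Proof.
move=> x0; apply: (mulfI x0); rewrite -exprS mulr1 /n prednK ?expf_card //.
by apply: leq_trans (finNzRing_gt1 F).
Qed.

Variable g : F.
Hypothesis gP : n.-primitive_root g.

Lemma gen_log (x : F) : x != 0 -> exists k, x = g ^+ k.
Proof. by move=> x0; have [k ->] := prim_rootP gP (finField_fermat x0); exists k. Qed.

Lemma gen_neq0 : g != 0.
Proof.
apply: contra_eq_neq (prim_expr_order gP) => ->.
by rewrite expr0n; case: (n) card_finField_gt0 => //= m _; rewrite eq_sym oner_eq0.
Qed.

Lemma gen_eq (a b : nat) (c : int) : a%:Z - b%:Z = n%:Z * c -> g ^+ a = g ^+ b.
Proof.
by move=> e; apply/eqP; rewrite (eq_prim_root_expr gP); apply/eqn_modP; exists c.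
Qed.

Lemma half_mod (D : nat) : (~~ odd n -> ~~ odd D) ->
  exists A (c : int), (2 * A)%:Z = D%:Z + n%:Z * c.
Proof.
move=> nD; have [no|/nD De] := boolP (odd n); last first.
  by exists D./2, 0; rewrite mulr0 addr0; congr Posz; move: De; lia.
exists (D * n.+1./2)%N, D%:Z; have -> : (2 * (D * n.+1./2) = D * n.+1)%N.
  by rewrite mulnCA mul2n halfK /= no subn0.
lia.
Qed.

Lemma T_prop_good :
  (forall U V, exists i j, g ^+ i + g ^+ j = 1 /\ good_point n U V i j) ->
  T_prop F.
Proof.
move=> H u v /gen_log[U ->] /gen_log[V ->]; have n0 := card_finField_gt0.
have [i [j [gij [G2 G4 Go]]]] := H U V.
have n1 : n = n.-1.+1 by rewrite prednK.
have [A [c [eA Aodd]]] : exists A (c : int),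
    (2 * A)%:Z = i%:Z + V%:Z - j%:Z - U%:Z + n%:Z * c /\ (~~ odd n -> odd A).
  (* [n.-1] acts as -1 modulo [n], which keeps logarithms in [nat]. *)
  have [|A [c eA]] := half_mod (D := (i + V + n.-1 * (j + U))%N).
    move=> ne; have [eU eV] := G2 ne; rewrite oddD oddM !oddD eU eV.
    have -> : odd n.-1 by rewrite n1 /= negbK in ne.
    by case: (odd U); case: (odd V).
  have {}eA : (2 * A)%:Z = i%:Z + V%:Z - j%:Z - U%:Z + n%:Z * (c + j%:Z + U%:Z).
    rewrite eA !PoszD PoszM PoszD; have -> : n%:Z = n.-1%:Z + 1 by rewrite {1}n1 -addn1.
    ring.
  have [no|ne] := boolP (odd n); first by exists A, (c + j%:Z + U%:Z).
  have [Ao|Ae] := boolP (odd A); first by exists A, (c + j%:Z + U%:Z).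
  have eh : n = (2 * n./2)%N by rewrite mul2n even_halfK.
  (* [A] is fixed only modulo [n / 2]. An even [A] is moved by [n / 2], which changes its parity
     unless 4 divides [n]; in that case the congruence modulo 4 already makes [A] odd. *)
  exists (A + n./2)%N, (c + j%:Z + U%:Z + 1); split.
    by rewrite mulnDr -eh PoszD eA; ring.
  move=> _; rewrite oddD (negbTE Ae) /=; apply/negPn/negP => he.
  have n4 : (4 %| n)%N by rewrite eh (even_halfK he : _ = n./2) || rewrite eh -(even_halfK he) -mul2n mulnA dvdn_mulr.
  have [k nk] := dvdnP n4; have [a Aa] : exists a, A = (2 * a)%N.
    by exists A./2; rewrite mul2n even_halfK.
  have /eqP/eqn_modP[x ex] := G4 n4.
  move: eA; rewrite nk Aa => eA.
  suff : 4 * (a%:Z - x - k%:Z * (c + j%:Z + U%:Z)) = 2 by lia.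
  move: eA ex; rewrite !PoszM !PoszD => eA ex.
  have -> : 4 * (a%:Z - x - k%:Z * (c + j%:Z + U%:Z)) = 2 * (2 * a%:Z) - 4 * x - k%:Z * 4 * (c + j%:Z + U%:Z) by ring.
  by rewrite eA -ex; ring.
have eS : exists S (d : int), S%:Z = A%:Z + U%:Z - i%:Z + n%:Z * d.
  exists (A + U + n.-1 * i)%N, i%:Z; rewrite !PoszD PoszM.
  by have -> : n%:Z = n.-1%:Z + 1 by [rewrite {1}n1 -addn1]; ring.
have [S [d {}eS]] := eS.
have gA0 := expf_neq0 A gen_neq0; have gS0 := expf_neq0 S gen_neq0.
have cA : coprime A n.
  apply: coprime_prime_divisors => // l lp ln; apply/negP => /dvdnP[a Aa].
  have [m nm] := dvdnP ln.
  have [lo|le] := boolP (odd l); last first.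
    by have := Aodd; rewrite nm Aa !oddM (negbTE le) !andbF => /(_ isT).
  have [|_ /eqn_modP[]] := Go l; first by rewrite /odd_prime_divisor lp lo.
  exists (2 * a%:Z - m%:Z * c); have := eA; rewrite Aa nm !PoszM !PoszD => e.
  have -> : l%:Z * (2 * a%:Z - m%:Z * c) = 2 * (a%:Z * l%:Z) - m%:Z * l%:Z * c by ring.
  by rewrite e; ring.
have cS : coprime S n.
  apply: coprime_prime_divisors => // l lp ln; apply/negP => /dvdnP[a Sa].
  have [m nm] := dvdnP ln.
  have [lo|le] := boolP (odd l).
    have [|/eqn_modP nx _] := Go l; [by rewrite /odd_prime_divisor lp lo | case: nx].
    exists (- 2 * a%:Z + m%:Z * (c + 2 * d)).
    have := eA; have := eS; rewrite Sa nm !PoszM !PoszD => e e'.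
    have -> : l%:Z * (- 2 * a%:Z + m%:Z * (c + 2 * d)) =
      - 2 * (a%:Z * l%:Z) + m%:Z * l%:Z * c + 2 * (m%:Z * l%:Z * d) by ring.
    rewrite e; have -> : m%:Z * l%:Z * c = 2 * A%:Z - i%:Z - V%:Z + j%:Z + U%:Z by rewrite e'; ring.
    by ring.
  have ne : ~~ odd n by rewrite nm oddM (negbTE le) andbF.
  have [ei _] := G2 ne; have := Aodd ne.
  have -> : odd A = odd (S + i + U).
    have eh : n = (2 * n./2)%N by rewrite mul2n even_halfK.
    have : (S + i == A + U %[mod 2])%N.
      by apply/eqn_modP; exists (n./2%:Z * d); rewrite !PoszD eS {1}eh PoszM; ring.
    by rewrite !modn2 !oddD; case: (odd S); case: (odd i); case: (odd A); case: (odd U).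
  by rewrite !oddD ei Sa oddM (negbTE le) andbF; case: (odd U).
exists (g ^+ A); split; first by rewrite /primitive_elt prim_root_exp_coprime.
suff -> : g ^+ U * g ^+ A + g ^+ V / g ^+ A = g ^+ S.
  by rewrite /primitive_elt prim_root_exp_coprime.
rewrite -[RHS]mulr1 -gij mulrDr -!exprD; congr (_ + _).
  by apply: (gen_eq (c := - d)); rewrite !PoszD eS; ring.
apply: (mulIf gA0); rewrite divfK // -exprD.
apply: (gen_eq (c := - c - d)); rewrite !PoszD eS.
have -> : n%:Z * (- c - d) = i%:Z + V%:Z - j%:Z - U%:Z - 2 * A%:Z - n%:Z * d.
  by have := eA; rewrite PoszM => ->; ring.
by ring.
Qed.

(* With [i], [j] as logarithms, the element [v a^-1 + u b^-1] equals
   [(u a + v b) / (a b)], so its logarithm is [S - A - B]. *)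
Lemma S_prop_units :
  (forall U V, exists i j S A B C, [/\ g ^+ i + g ^+ j = 1,
     [/\ coprime S n, coprime A n, coprime B n & coprime C n] &
     exists a b c : int, [/\ A%:Z = S%:Z + i%:Z - U%:Z + n%:Z * a,
       B%:Z = S%:Z + j%:Z - V%:Z + n%:Z * b & C%:Z = S%:Z - A%:Z - B%:Z + n%:Z * c]]) ->
  S_prop F.
Proof.
move=> H u v /gen_log[U ->] /gen_log[V ->].
have [i [j [S [A [B [C [gij [cS cA cB cC] [a [b [c [eA eB eC]]]]]]]]]]] := H U V.
have gA0 := expf_neq0 A gen_neq0; have gB0 := expf_neq0 B gen_neq0.
have e : g ^+ U * g ^+ A + g ^+ V * g ^+ B = g ^+ S.
  rewrite -[RHS]mulr1 -gij mulrDr -!exprD; congr (_ + _).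
    by apply: (gen_eq (c := a)); rewrite !PoszD eA; ring.
  by apply: (gen_eq (c := b)); rewrite !PoszD eB; ring.
exists (g ^+ A), (g ^+ B); split; rewrite /primitive_elt ?prim_root_exp_coprime ?e ?prim_root_exp_coprime //.
have -> : g ^+ V / g ^+ A + g ^+ U / g ^+ B = g ^+ C.
  apply: (mulIf gA0); apply: (mulIf gB0); rewrite -!exprD.
  transitivity (g ^+ S).
    rewrite -e; move: gA0 gB0; move: (g ^+ U) (g ^+ V) (g ^+ A) (g ^+ B) => w x y z y0 z0.
    by field; rewrite ?y0 ?z0.
  by apply: (gen_eq (c := - c)); rewrite !PoszD eC; ring.
by rewrite prim_root_exp_coprime.
Qed.
End PrimitiveRoots.

(** * Multiplicative characters and Jacobi sums *)

Section JacobiSums.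
Variables (F : finFieldType) (g : F) (w : algC).
Let n := #|F|.-1.
Hypotheses (gP : n.-primitive_root g) (wP : n.-primitive_root w).
Let n0 : (0 < n)%N := card_finField_gt0 F.

(** At 0 the value is the filler 0, so that characters are 1 there; all sums below therefore run
    over nonzero elements only. *)
Definition dlog (x : F) : nat :=
  if [pick k : 'I_n | g ^+ k == x] is Some k then k else 0%N.

Lemma dlogK (x : F) : x != 0 -> g ^+ dlog x = x.
Proof.
move=> x0; rewrite /dlog; case: pickP => [k /eqP //|H].
have [k xk] := gen_log gP x0.
have := H (Ordinal (ltn_pmod k n0)).
by rewrite /= (prim_expr_mod gP) -xk eqxx.
Qed.

Definition mchar (a : nat) (x : F) : algC := w ^+ (a * dlog x).

Lemma w_neq0 : w != 0.
Proof.
apply: contra_eq_neq (prim_expr_order wP) => ->.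
by rewrite expr0n; case: (n) n0 => //= m _; rewrite eq_sym oner_eq0.
Qed.

Lemma w_eq (a b : nat) : (a = b %[mod n])%N -> w ^+ a = w ^+ b.
Proof. by move=> e; apply/eqP; rewrite (eq_prim_root_expr wP) e. Qed.

Lemma norm_w (k : nat) : `|w ^+ k| = 1.
Proof.
suff /eqP w1 : `|w| == 1 by rewrite normrX w1 expr1n.
by rewrite -(pexpr_eq1 n0) ?normr_ge0 // -normrX (prim_expr_order wP) normr1.
Qed.

Lemma dlogM (x y : F) : x != 0 -> y != 0 -> (dlog (x * y)%R = dlog x + dlog y %[mod n])%N.
Proof.
move=> x0 y0; apply/eqP; rewrite -(eq_prim_root_expr gP) exprD !dlogK //.
by rewrite mulf_neq0.
Qed.

Lemma mcharM a (x y : F) : x != 0 -> y != 0 -> mchar a (x * y) = mchar a x * mchar a y.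
Proof.
move=> x0 y0; rewrite /mchar -exprD -mulnDr; apply: w_eq.
by rewrite -modnMmr dlogM // modnMmr.
Qed.

Lemma mcharD a b x : mchar (a + b) x = mchar a x * mchar b x.
Proof. by rewrite /mchar mulnDl exprD. Qed.

Lemma mchar_neq0 a x : mchar a x != 0.
Proof. by rewrite expf_neq0 ?w_neq0. Qed.

Lemma mchar1 a : mchar a 1 = 1.
Proof.
by apply: (mulfI (mchar_neq0 a 1)); rewrite -mcharM ?oner_eq0 // !mulr1.
Qed.

Lemma mcharV a x : x != 0 -> mchar a x^-1 = (mchar a x)^*.
Proof.
move=> x0; apply: (mulfI (mchar_neq0 a x)).
by rewrite -mcharM ?invr_eq0 // mulfV // mchar1 -normCK norm_w expr1n.
Qed.

Lemma mchar_gen a : mchar a g = w ^+ a.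
Proof.
rewrite /mchar; have e : (dlog g = 1 %[mod n])%N.
  by apply/eqP; rewrite -(eq_prim_root_expr gP) dlogK ?(gen_neq0 gP) ?expr1.
by apply: w_eq; rewrite -modnMmr e modnMmr muln1.
Qed.

Lemma sum_mchar a : \sum_(x | x != 0) mchar a x = if (n %| a)%N then n%:R else 0.
Proof.
have nw : (w ^+ a == 1) = (n %| a)%N by rewrite (prim_order_dvd wP).
rewrite -nw; case: ifPn => wa.
  rewrite (eq_bigr (fun=> 1)); last by move=> x _; rewrite /mchar exprM (eqP wa) expr1n.
  by rewrite sumr_const (cardC1 (0 : F)).
set s := \sum_(_ | _) _; suff : (1 - w ^+ a) * s = 0.
  by move/eqP; rewrite mulf_eq0 subr_eq0 eq_sym (negbTE wa) => /eqP.
have gn := gen_neq0 gP.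
suff e : s = w ^+ a * s by rewrite mulrBl mul1r -e subrr.
rewrite {1}/s (reindex_onto (fun x => g * x) (fun x => g^-1 * x)); last first.
  by move=> x _; rewrite mulVKf.
rewrite mulr_sumr; apply: eq_big => x; first by rewrite mulf_eq0 (negbTE gn) mulKf // eqxx andbT.
by move=> /andP[]; rewrite mulf_eq0 (negbTE gn) => x0 _; rewrite mcharM // mchar_gen.
Qed.

Definition inner (x : F) := (x != 0) && (x != 1).

Lemma sum_mchar_inner a : \sum_(x | inner x) mchar a x = (if (n %| a)%N then n%:R else 0) - 1.
Proof.
rewrite -sum_mchar [in RHS](bigD1 (1 : F)) ?oner_eq0 //= mchar1 addrAC subrr add0r.
exact: eq_bigl.
Qed.

Definition jacobi a b := \sum_(x | inner x) mchar a x * mchar b (1 - x).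

Lemma inner_sub x : inner x -> 1 - x != 0.
Proof. by case/andP=> _; rewrite subr_eq0 eq_sym. Qed.

(* The map [(x, y) |-> (x / y, (1 - x) / (1 - y))] permutes the pairs of distinct
   elements other than 0 and 1, so [|J|^2] is a sum over pairs that factors. *)
Lemma jacobi_normsq a b : `|jacobi a b| ^+ 2 =
  n.-1%:R + (\sum_(x | inner x) mchar a x) * (\sum_(x | inner x) mchar b x)
  - \sum_(x | inner x) mchar (a + b) x.
Proof.
pose G t s := mchar a t * mchar b s.
pose D (p : F * F) := [&& inner p.1, inner p.2 & p.1 != p.2].
have split_diag (H : F -> F -> algC) : (\sum_(x | inner x) \sum_(y | inner y) H x y) =
    \sum_(x | inner x) H x x + \sum_(p | D p) H p.1 p.2.
  have -> : \sum_(p | D p) H p.1 p.2 = \sum_(x | inner x) \sum_(y | inner y && (y != x)) H x y.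
    by rewrite pair_big_dep; apply: eq_bigl => -[x y]; rewrite /D /= [y == x]eq_sym.
  by rewrite -big_split; apply: eq_bigr => x ix; rewrite (bigD1 x).
transitivity (\sum_(x | inner x) \sum_(y | inner y) G (x / y) ((1 - x) / (1 - y))).
  rewrite normCK rmorph_sum big_distrlr /=; apply: eq_bigr => x ix; apply: eq_bigr => y iy.
  have /andP[x0 _] := ix; have /andP[y0 _] := iy.
  have x1 := inner_sub ix; have y1 := inner_sub iy.
  by rewrite /G rmorphM /= -!mcharV // !mcharM ?invr_eq0 //; ring.
rewrite (split_diag (fun x y => G (x / y) ((1 - x) / (1 - y)))).
rewrite big_distrlr /= (split_diag (fun x y => mchar a x * mchar b y)).
rewrite -addrA; congr (_ + _).
  rewrite (eq_bigr (fun=> 1)) => [|x ix]; last first.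
    have /andP[x0 _] := ix; have x1 := inner_sub ix.
    by rewrite /G !divff // !mchar1 mulr1.
  rewrite sumr_const; congr _%:R.
  have /eq_card -> : inner =i [predD1 predC1 0 & 1] by move=> x; rewrite !inE andbC.
  by have := cardD1 1 (predC1 (0 : F)); rewrite cardC1 !inE oner_eq0 /= -/n => ->.
under [\sum_(x | inner x) mchar (a + b) x]eq_bigr do rewrite mcharD.
rewrite [X in _ = X - _]addrC addrK.
(* Solving [t = x / y], [s = (1 - x) / (1 - y)] gives [y = (1 - s) / (t - s)] and [x = t y]. *)
pose h (p : F * F) := let y := (1 - p.2) / (p.1 - p.2) in (p.1 * y, y).
pose h' (p : F * F) := (p.1 / p.2, (1 - p.1) / (1 - p.2)).
have inr x : inner x = [&& x != 0, 1 - x != 0 & true] by rewrite andbT [1 - x == 0]subr_eq0 [1 == x]eq_sym.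
rewrite (reindex_onto h h') => [|[x y] /and3P[/= ix iy xy]]; last first.
  have := ix; have := iy; rewrite !inr !andbT => /andP[y0 y1] /andP[x0 x1].
  have yx : y - x != 0 by rewrite subr_eq0 eq_sym.
  have e : x / y - (1 - x) / (1 - y) = (x - y) / (y * (1 - y)).
    by field; rewrite y0 y1.
  have e' : 1 - (1 - x) / (1 - y) = (x - y) / (1 - y) by field.
  have z : (1 - (1 - x) / (1 - y)) / (x / y - (1 - x) / (1 - y)) = y.
    have xy' : x - y != 0 by rewrite subr_eq0.
    by rewrite e e'; field; rewrite y0 y1.
  by rewrite /h /= z; congr (_, _); field.
apply: eq_big => [[t s]|[t s] /andP[_ /eqP e]]; last first.
  by rewrite /G -[in RHS]e.
apply/andP/and3P => /= [[/and3P[/= i1 i2 _] /eqP e]|[it is_ ts]].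
  have e1 : t = t * ((1 - s) / (t - s)) / ((1 - s) / (t - s)) by case: e.
  have e2 : s = (1 - t * ((1 - s) / (t - s))) / (1 - (1 - s) / (t - s)) by case: e.
  have /andP[x0 x1] := i1; have /andP[y0 y1] := i2.
  move: y0; rewrite mulf_eq0 invr_eq0 negb_or subr_eq0 => /andP[s1 ts].
  have t0 : t != 0 by apply: contraNneq x0 => ->; rewrite mul0r.
  split; last by rewrite -subr_eq0.
    rewrite /inner t0 /=; apply: contraNneq y1 => t1.
    by move: ts; rewrite t1 subr_eq0 => ts; rewrite divff // subr_eq0.
  rewrite /inner [s == 1]eq_sym s1 andbT.
  by apply: contraNneq x1 => s0; move: ts; rewrite s0 subr_eq0 => ts; rewrite !subr0 div1r divff.
have := it; have := is_; rewrite !inr !andbT => /andP[s0 s1] /andP[t0 t1].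
have ts' : t - s != 0 by rewrite subr_eq0.
have y1 : 1 - (1 - s) / (t - s) = (t - 1) / (t - s) by field.
have x1 : 1 - t * ((1 - s) / (t - s)) = s * (t - 1) / (t - s) by field.
have tm1 : t - 1 != 0 by rewrite -opprB oppr_eq0.
split.
  rewrite /D /= !inr !andbT y1 x1 !mulf_neq0 ?invr_eq0 //=.
  rewrite -subr_eq0; have -> : t * ((1 - s) / (t - s)) - (1 - s) / (t - s) = (t - 1) * (1 - s) / (t - s).
    by ring.
  by rewrite !mulf_neq0 ?invr_eq0.
apply/eqP; rewrite /h' /h /= y1 x1; congr (_, _); field; rewrite ?s1 ?ts' ?tm1 //.
Qed.

(** Writing [e c] for [n] or 0 according as the character of exponent [c] is trivial or not, the
    formula becomes [q - e a - e b - e (a + b) + e a * e b], and the last product vanishes. *)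
Lemma jacobi_norm a b : ~~ ((n %| a)%N && (n %| b)%N) -> `|jacobi a b| <= sqrtC (n.+1%:R).
Proof.
move=> nab; rewrite -(@ler_pXn2r _ 2) ?nnegrE ?normr_ge0 ?sqrtC_ge0 ?ler0n //.
rewrite sqrtCK jacobi_normsq !sum_mchar_inner.
have n1 : n.-1%:R = n%:R - 1 :> algC by rewrite -{2}(prednK n0) -natr1 addrK.
have n00 : 0 <= (n%:R : algC) by rewrite ler0n.
rewrite n1 -natr1 -subr_ge0.
set ea := if (n %| a)%N then _ else _; set eb := if (n %| b)%N then _ else _.
set ec := if _ then _ else _.
have e0 c : 0 <= (if (n %| c)%N then n%:R else 0 : algC) by case: ifP.
have -> : n%:R + 1 - (n%:R - 1 + (ea - 1) * (eb - 1) - (ec - 1)) = ea + eb + ec - ea * eb by ring.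
have -> : ea * eb = 0.
  by move: nab; rewrite /ea /eb; case: ifP => //=; case: ifP => // *; rewrite ?mulr0 ?mul0r.
by rewrite subr0 !addr_ge0 ?e0.
Qed.
End JacobiSums.

(** * Trigonometric polynomials in [i + j] and [i - j], and their sums over the field *)

Section TrigPolynomials.
Variables (F : finFieldType) (g : F) (w : algC).
Let n := #|F|.-1.
Hypotheses (gP : n.-primitive_root g) (wP : n.-primitive_root w).
Let n0 : (0 < n)%N := card_finField_gt0 F.

(** That is, [w ^+ a] is a nontrivial [m]-th root of unity. For coprime orders a product of two such
    roots is again nontrivial, which keeps constant terms apart when polynomials are multiplied. *)
Definition has_order (m a : nat) := (n %| m * a)%N && ~~ (n %| a)%N.

(* [tpoly M L z N0 N1 Q]: the trigonometric polynomial [Q] in [t] and [r] has constant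
   term [z], the terms not involving [t] have total weight at most [N0], the others [N1];
   the frequencies of [t] (of [r]) in nonconstant terms are killed by [M] (by [L]). *)
Definition tpoly (M L : nat) (z N0 N1 : algC) (Q : nat -> nat -> algC) : Prop :=
  exists (s0 : seq (algC * nat)) (s1 : seq (algC * (nat * nat))),
  [/\ all (fun p => has_order L p.2) s0,
      all (fun p => has_order M p.2.1) s1,
      `|z| + \sum_(p <- s0) `|p.1| <= N0,
      \sum_(p <- s1) `|p.1| <= N1 &
      forall t r, Q t r = z + \sum_(p <- s0) p.1 * w ^+ (p.2 * r)
                        + \sum_(p <- s1) p.1 * w ^+ (p.2.1 * t + p.2.2 * r)].

Lemma has_orderMr m m' a : has_order m a -> has_order (m * m') a.
Proof. by case/andP=> h1 h2; rewrite /has_order h2 mulnAC dvdn_mulr. Qed.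

Lemma has_orderMl m m' a : has_order m a -> has_order (m' * m) a.
Proof. by rewrite mulnC; apply: has_orderMr. Qed.

Lemma has_order_coprime m m' a : coprime m m' -> has_order m a -> ~~ (n %| m' * a)%N.
Proof.
move=> co /andP[ma na]; apply: contra na => m'a.
have [m0|m0] := posnP m; first by move: co m'a; rewrite m0 /coprime gcd0n => /eqP ->; rewrite mul1n.
have [u v e _] := egcdnP m' m0.
have : (n %| v * (m' * a) + a)%N.
  by rewrite -[X in (_ + X)%N]mul1n mulnA -mulnDl -(eqP co) -e -mulnA dvdn_mull.
by rewrite dvdn_addr // dvdn_mull.
Qed.

Lemma has_orderD m m' a a' : coprime m m' -> has_order m a -> has_order m' a' ->
  has_order (m * m') (a + a').
Proof.
move=> co ha ha'; rewrite /has_order mulnDr dvdn_add /=; first last.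
- by have /andP[h _] := ha'; rewrite -mulnA dvdn_mull.
- by have /andP[h _] := ha; rewrite mulnAC dvdn_mulr.
apply: contra (has_order_coprime co ha) => h.
have : (n %| m' * a + m' * a')%N by rewrite -mulnDr dvdn_mull.
by rewrite dvdn_addl //; have /andP[] := ha'.
Qed.

Lemma tpoly_const z : tpoly 1 1 z `|z| 0 (fun _ _ => z).
Proof. by exists [::], [::]; split=> //= *; rewrite !big_nil ?addr0. Qed.

Lemma tpoly_add M L z N0 N1 Q z' N0' N1' Q' :
  tpoly M L z N0 N1 Q -> tpoly M L z' N0' N1' Q' ->
  tpoly M L (z + z') (N0 + N0') (N1 + N1') (fun t r => Q t r + Q' t r).
Proof.
move=> [s0 [s1 [a0 a1 b0 b1 e]]] [s0' [s1' [a0' a1' b0' b1' e']]].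
exists (s0 ++ s0'), (s1 ++ s1'); split; rewrite ?all_cat ?a0 ?a1 ?big_cat //=.
- apply: le_trans (lerD b0 b0'); rewrite addrACA lerD2r; exact: ler_normD.
- exact: lerD.
by move=> t r; rewrite e e' !big_cat /=; ring.
Qed.

Lemma tpoly_weaken M L M' L' z N0 N1 Q : (M %| M')%N -> (L %| L')%N ->
  tpoly M L z N0 N1 Q -> tpoly M' L' z N0 N1 Q.
Proof.
move=> /dvdnP[a ->] /dvdnP[b ->] [s0 [s1 [a0 a1 b0 b1 e]]].
exists s0, s1; split=> //; first by apply: sub_all a0 => p; apply: has_orderMl.
by apply: sub_all a1 => p; apply: has_orderMl.
Qed.

Lemma tpoly_eq M L z N0 N1 Q Q' : (forall t r, Q t r = Q' t r) ->
  tpoly M L z N0 N1 Q -> tpoly M L z N0 N1 Q'.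
Proof. by move=> e [s0 [s1 [? ? ? ? h]]]; exists s0, s1; split=> // t r; rewrite -e. Qed.

Lemma tpoly_norm M L z N0 N1 z' N0' N1' Q : z = z' -> N0 = N0' -> N1 = N1' ->
  tpoly M L z N0 N1 Q -> tpoly M L z' N0' N1' Q.
Proof. by move=> -> -> ->. Qed.

Lemma sum_allpairs (I J : Type) (s : seq I) (s' : seq J) (T : Type) (h : I -> J -> T) (f : T -> algC) :
  \sum_(p <- [seq h x y | x <- s, y <- s']) f p = \sum_(x <- s) \sum_(y <- s') f (h x y).
Proof. by rewrite big_allpairs_dep. Qed.

(** Coprime orders prevent nonconstant terms from multiplying to a constant, and terms with [t] from
    losing it. So a product is free of [t] exactly when both factors are, and the weights multiply
    as the coefficients do. *)
Lemma tpoly_mul M L z N0 N1 Q M' L' z' N0' N1' Q' : coprime M M' -> coprime L L' ->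
  tpoly M L z N0 N1 Q -> tpoly M' L' z' N0' N1' Q' ->
  tpoly (M * M') (L * L') (z * z') (N0 * N0') (N0 * N1' + N1 * N0' + N1 * N1')
    (fun t r => Q t r * Q' t r).
Proof.
move=> cM cL [s0 [s1 [a0 a1 b0 b1 e]]] [s0' [s1' [a0' a1' b0' b1' e']]].
pose c0 := [seq (z * p.1, p.2) | p <- s0'] ++ [seq (z' * p.1, p.2) | p <- s0]
  ++ [seq (p.1 * p'.1, (p.2 + p'.2)%N) | p <- s0, p' <- s0'].
pose f0 := (z, 0%N) :: s0; pose f0' := (z', 0%N) :: s0'.
pose c1 := [seq (p.1 * p'.1, (p'.2.1, (p.2 + p'.2.2)%N)) | p <- f0, p' <- s1']
  ++ [seq (p.1 * p'.1, (p.2.1, (p.2.2 + p'.2)%N)) | p <- s1, p' <- f0']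
  ++ [seq (p.1 * p'.1, ((p.2.1 + p'.2.1)%N, (p.2.2 + p'.2.2)%N)) | p <- s1, p' <- s1'].
have sum_c0 (f : algC * nat -> algC) : \sum_(p <- c0) f p =
    \sum_(p <- s0') f (z * p.1, p.2) + (\sum_(p <- s0) f (z' * p.1, p.2) +
    \sum_(p <- s0) \sum_(p' <- s0') f (p.1 * p'.1, (p.2 + p'.2)%N)).
  by rewrite /c0 big_cat [X in _ + X = _]big_cat !big_map sum_allpairs.
have sum_c1 (f : algC * (nat * nat) -> algC) : \sum_(p <- c1) f p =
    \sum_(p <- f0) \sum_(p' <- s1') f (p.1 * p'.1, (p'.2.1, (p.2 + p'.2.2)%N)) +
    (\sum_(p <- s1) \sum_(p' <- f0') f (p.1 * p'.1, (p.2.1, (p.2.2 + p'.2)%N)) +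
    \sum_(p <- s1) \sum_(p' <- s1') f (p.1 * p'.1, ((p.2.1 + p'.2.1)%N, (p.2.2 + p'.2.2)%N))).
  by rewrite /c1 big_cat [X in _ + X = _]big_cat !sum_allpairs.
have B0 : \sum_(p <- f0) `|p.1| <= N0 by rewrite big_cons.
have B0' : \sum_(p <- f0') `|p.1| <= N0' by rewrite big_cons.
have pos (I : Type) (s : seq I) (f : I -> algC) : 0 <= \sum_(p <- s) `|f p| by rewrite sumr_ge0.
have normP (I J : Type) (s : seq (algC * I)) (s' : seq (algC * J)) (N N' : algC) :
    \sum_(p <- s) `|p.1| <= N -> \sum_(p <- s') `|p.1| <= N' ->
    \sum_(p <- s) \sum_(p' <- s') `|p.1 * p'.1| <= N * N'.
  move=> h h'; apply: le_trans (ler_pM (pos _ _ _) (pos _ _ _) h h').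
  by rewrite big_distrlr /=; apply: ler_sum => x _; apply: ler_sum => y _; rewrite normrM.
exists c0, c1; split.
- rewrite /c0 !all_cat !all_map; apply/and3P; split.
  + by apply: sub_all a0' => p /=; apply: has_orderMl.
  + by apply: sub_all a0 => p /=; apply: has_orderMr.
  apply/allP => _ /allpairsP[[p p'] [/= hp hp' ->]] /=.
  by apply: has_orderD => //; [apply: (allP a0)|apply: (allP a0')].
- apply/allP => x; rewrite /c1 mem_cat => /orP[|]; last rewrite mem_cat => /orP[|];
    move=> /allpairsP[[p p'] [/= hp hp' ->]] /=.
  + by apply: has_orderMl; apply: (allP a1').
  + by apply: has_orderMr; apply: (allP a1).
  by apply: has_orderD => //; [apply: (allP a1)|apply: (allP a1')].
- apply: le_trans (normP _ _ _ _ _ _ B0 B0').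
  have E : \sum_(p <- s0) \sum_(p' <- f0') `|p.1 * p'.1| =
      \sum_(p <- s0) `|z' * p.1| + \sum_(p <- s0) \sum_(p' <- s0') `|p.1 * p'.1|.
    by rewrite -big_split; apply: eq_bigr => p _; rewrite big_cons mulrC.
  by rewrite sum_c0 [leRHS]big_cons E big_cons -addrA.
- rewrite sum_c1 -[leRHS]addrA.
  by apply: lerD; [|apply: lerD]; apply: normP.
move=> t r; rewrite e e' sum_c0 sum_c1 /=.
have E0 : z + \sum_(p <- s0) p.1 * w ^+ (p.2 * r) = \sum_(p <- f0) p.1 * w ^+ (p.2 * r).
  by rewrite big_cons mul0n expr0 mulr1.
have E0' : z' + \sum_(p <- s0') p.1 * w ^+ (p.2 * r) = \sum_(p <- f0') p.1 * w ^+ (p.2 * r).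
  by rewrite big_cons mul0n expr0 mulr1.
set S0 := \sum_(p <- s0) p.1 * w ^+ (p.2 * r); set S0' := \sum_(p <- s0') p.1 * w ^+ (p.2 * r).
set S1 := \sum_(p <- s1) p.1 * _; set S1' := \sum_(p <- s1') p.1 * _.
have dist (I J : Type) (s : seq I) (s' : seq J) (f : I -> algC) (f' : J -> algC) (h : I -> J -> algC) :
    (forall x y, h x y = f x * f' y) ->
    \sum_(x <- s) \sum_(y <- s') h x y = (\sum_(x <- s) f x) * (\sum_(y <- s') f' y).
  by move=> hh; rewrite big_distrlr /=; apply: eq_bigr => x _; apply: eq_bigr => y _.
have -> : \sum_(i <- s0') z * i.1 * w ^+ (i.2 * r) = z * S0'.
  by rewrite mulr_sumr; apply: eq_bigr => p _; rewrite mulrA.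
have -> : \sum_(i <- s0) z' * i.1 * w ^+ (i.2 * r) = z' * S0.
  by rewrite mulr_sumr; apply: eq_bigr => p _; rewrite mulrA.
rewrite (dist _ _ s0 s0' (fun p => p.1 * w ^+ (p.2 * r)) (fun p => p.1 * w ^+ (p.2 * r))); last first.
  by move=> x y /=; rewrite mulnDl exprD; ring.
rewrite (dist _ _ f0 s1' (fun p => p.1 * w ^+ (p.2 * r)) (fun p => p.1 * w ^+ (p.2.1 * t + p.2.2 * r))); last first.
  by move=> x y /=; rewrite !mulnDl !exprD; ring.
rewrite (dist _ _ s1 f0' (fun p => p.1 * w ^+ (p.2.1 * t + p.2.2 * r)) (fun p => p.1 * w ^+ (p.2 * r))); last first.
  by move=> x y /=; rewrite !mulnDl !exprD; ring.
rewrite (dist _ _ s1 s1' (fun p => p.1 * w ^+ (p.2.1 * t + p.2.2 * r)) (fun p => p.1 * w ^+ (p.2.1 * t + p.2.2 * r))); last first.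
  by move=> x y /=; rewrite !mulnDl !exprD; ring.
rewrite -E0 -E0' -/S0 -/S0' -/S1 -/S1'; ring.
Qed.

(** Modulo [n], [tlog] and [rlog] are the logarithms of [x (1 - x)] and [x / (1 - x)]. *)
Definition tlog (x : F) := (dlog g x + dlog g (1 - x)%R)%N.
Definition rlog (x : F) := (dlog g x + n.-1 * dlog g (1 - x)%R)%N.

Lemma sum_monomial h a b :
  \sum_(x | inner x) w ^+ (h * dlog g x) * w ^+ (a * tlog x + b * rlog x) =
  jacobi g w (h + a + b) (a + n.-1 * b).
Proof.
apply: eq_bigr => x _; rewrite /mchar -!exprD; congr (_ ^+ _).
by rewrite /tlog /rlog; ring.
Qed.

(** For a nontrivial character and its inverse the formula for the squared norm is
    [(n - 1) + 1 - (n - 1)]. This saving over [sqrt q] is the reason why [tpoly] counts the terms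
    without [t] separately. *)
Lemma jacobi_ratio_norm b : ~~ (n %| b)%N -> `|jacobi g w b (n.-1 * b)| <= 1.
Proof.
move=> nb; rewrite -(@ler_pXn2r _ 2) ?nnegrE ?normr_ge0 // expr1n.
rewrite (jacobi_normsq gP wP) !(sum_mchar_inner gP wP) -/n.
have n1 : (n = n.-1.+1)%N by rewrite prednK.
have nb' : ~~ (n %| n.-1 * b)%N.
  apply: contra nb => h; have : (n %| n.-1 * b + b)%N by rewrite -mulSnr -n1 dvdn_mulr.
  by rewrite dvdn_addr.
have -> : (b + n.-1 * b = n * b)%N by rewrite -mulSn -n1.
rewrite (negbTE nb) (negbTE nb') dvdn_mulr // {2}n1 -natr1.
by rewrite (_ : _ - _ = 1) //; ring.
Qed.

(** Modulo [n], twice the sum of the two exponents is [2 h + 4 a], that is [4 a], and a nontrivial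
    root of odd order stays nontrivial after multiplication of its exponent by 4. *)
Lemma triv_frequency M h a b : odd M -> has_order M a -> (n %| 2 * h)%N ->
  ~~ ((n %| h + a + b) && (n %| a + n.-1 * b))%N.
Proof.
move=> oM ha h2; have co : coprime M 4 by rewrite -[4%N]/(2 ^ 2)%N coprimeXr ?coprimen2.
apply: contra (has_order_coprime co ha) => /andP[h1 h3].
have h4 : (n %| 2 * ((h + a + b) + (a + n.-1 * b)))%N by apply: dvdn_mull; apply: dvdn_add.
have e : (2 * ((h + a + b) + (a + n.-1 * b)) = 2 * h + (4 * a + n * (2 * b)))%N.
  by have n1 : (n = n.-1.+1)%N by [rewrite prednK]; rewrite [X in (X * (2 * b))%N]n1; ring.
by move: h4; rewrite e dvdn_addr // dvdn_addl // dvdn_mulr.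
Qed.

(** There are [n - 1] elements other than 0 and 1, so the constant term contributes [n z - z]; the
    stray [z] is paid for by the [|z|] included in [N0]. *)
Lemma sum_tpoly_plain M L z N0 N1 Q : odd M -> tpoly M L z N0 N1 Q ->
  `|\sum_(x | inner x) Q (tlog x) (rlog x) - n%:R * z| <= N0 + sqrtC n.+1%:R * N1.
Proof.
move=> oM [s0 [s1 [a0 a1 b0 b1 e]]].
have -> : \sum_(x | inner x) Q (tlog x) (rlog x) - n%:R * z = - z
    + \sum_(p <- s0) p.1 * jacobi g w p.2 (n.-1 * p.2)
    + \sum_(p <- s1) p.1 * jacobi g w (p.2.1 + p.2.2) (p.2.1 + n.-1 * p.2.2).
  under eq_bigr do rewrite e.
  rewrite !big_split /= sumr_const.
  have -> : #|[pred x | inner (x : F)]| = n.-1.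
    have /eq_card -> : [pred x : F | inner x] =i [predD1 predC1 (0 : F) & 1] by move=> x; rewrite !inE andbC.
    by have := cardD1 1 (predC1 (0 : F)); rewrite cardC1 !inE oner_eq0 /= -/n => ->.
  rewrite -mulr_natl; have -> : n%:R = n.-1%:R + 1 :> algC by rewrite natr1 prednK.
  have E0 : \sum_(x | inner x) \sum_(p <- s0) p.1 * w ^+ (p.2 * rlog x) =
      \sum_(p <- s0) p.1 * jacobi g w p.2 (n.-1 * p.2).
    rewrite exchange_big; apply: eq_bigr => p _; rewrite -mulr_sumr; congr (_ * _).
    by rewrite -[RHS](sum_monomial 0 0); apply: eq_bigr => x _; rewrite !mul0n expr0 mul1r.
  have E1 : \sum_(x | inner x) \sum_(p <- s1) p.1 * w ^+ (p.2.1 * tlog x + p.2.2 * rlog x) =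
      \sum_(p <- s1) p.1 * jacobi g w (p.2.1 + p.2.2) (p.2.1 + n.-1 * p.2.2).
    rewrite exchange_big; apply: eq_bigr => p _; rewrite -mulr_sumr; congr (_ * _).
    by rewrite -[RHS](sum_monomial 0); apply: eq_bigr => x _; rewrite !mul0n expr0 mul1r.
  by rewrite E0 E1; ring.
apply: le_trans (ler_normD _ _) _; apply: lerD.
  apply: le_trans (ler_normD _ _) _; rewrite normrN; apply: le_trans b0; rewrite lerD2l.
  apply: le_trans (ler_norm_sum _ _ _) _; rewrite !big_seq; apply: ler_sum => p hp.
  by rewrite normrM ler_piMr ?normr_ge0 // jacobi_ratio_norm //; have /andP[] := allP a0 _ hp.
apply: le_trans (ler_norm_sum _ _ _) _; rewrite mulrC.
apply: (@le_trans _ _ ((\sum_(p <- s1) `|p.1|) * sqrtC n.+1%:R)); last first.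
  by rewrite ler_wpM2r // sqrtC_ge0 ler0n.
rewrite mulr_suml !big_seq; apply: ler_sum => p hp; rewrite normrM ler_wpM2l //.
apply: (jacobi_norm gP wP); have := triv_frequency (h := 0) p.2.2 oM (allP a1 _ hp) (dvdn0 _).
by rewrite add0n.
Qed.

(** The quadratic character spoils the pairing of a character with its inverse, so here every term,
    the constant one included, costs [sqrt q]. *)
Lemma sum_tpoly_twist M L z N0 N1 Q c h : odd M -> tpoly M L z N0 N1 Q -> `|c| = 1 ->
  ~~ (n %| h)%N -> (n %| 2 * h)%N ->
  `|\sum_(x | inner x) c * w ^+ (h * dlog g x) * Q (tlog x) (rlog x)| <= sqrtC n.+1%:R * (N0 + N1).
Proof.
move=> oM [s0 [s1 [a0 a1 b0 b1 e]]] c1 nh h2.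
pose s := [seq (p.1, (0%N, p.2)) | p <- (z, 0%N) :: s0] ++ s1.
have -> : \sum_(x | inner x) c * w ^+ (h * dlog g x) * Q (tlog x) (rlog x) =
    c * \sum_(p <- s) p.1 * jacobi g w (h + p.2.1 + p.2.2) (p.2.1 + n.-1 * p.2.2).
  under [in RHS]eq_bigr do rewrite -sum_monomial mulr_sumr.
  rewrite exchange_big mulr_sumr; apply: eq_bigr => x _ /=.
  rewrite e -mulrA; congr (_ * _); rewrite /s big_cat big_map big_cons /=.
  rewrite !mulrDr !mulr_sumr !mul0n expr0 mulr1 [z * _]mulrC.
  by congr (_ + _ + _); apply: eq_bigr => p _; rewrite mulrCA ?mul0n.
rewrite normrM c1 mul1r; apply: le_trans (ler_norm_sum _ _ _) _.
apply: (@le_trans _ _ (\sum_(p <- s) `|p.1| * sqrtC n.+1%:R)).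
  rewrite !big_seq; apply: ler_sum => p hp; rewrite normrM ler_wpM2l //.
  apply: (jacobi_norm gP wP).
  have n1 : (n = n.-1.+1)%N by rewrite prednK.
  move: hp; rewrite mem_cat => /orP[/mapP[q _ ->] /=|hp]; last exact: triv_frequency (allP a1 _ hp) h2.
  rewrite addn0 add0n; apply: contra nh => /andP[q1 q2].
  have : (n %| n.-1 * (h + q.2) + h)%N.
    have -> : (n.-1 * (h + q.2) + h = n * h + n.-1 * q.2)%N by rewrite {2}n1; ring.
    by rewrite dvdn_add // dvdn_mulr.
  by rewrite dvdn_addr // dvdn_mull.
rewrite -mulr_suml mulrC ler_wpM2l ?sqrtC_ge0 ?ler0n //.
by rewrite big_cat big_map big_cons; apply: lerD.
Qed.
End TrigPolynomials.

(** * Fourier expansion of the congruence conditions *)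

Definition indic (l T t : nat) : algC := (t == T %[mod l])%N%:R.

(** This is [l / (l - 1)] times the indicator of [t] differing from [T] modulo [l], scaled to have
    mean 1. Its nonconstant part has total weight 1, so each prime treated exactly doubles the
    weight. *)
Definition cofactor l T t : algC := 1 + l%:R / l.-1%:R * (l%:R^-1 - indic l T t).

Lemma cofactor_ge0 l T t : (1 < l)%N -> 0 <= cofactor l T t.
Proof.
move=> l1; have l00 : (l%:R : algC) != 0 by rewrite pnatr_eq0; lia.
have l10 : (l.-1%:R : algC) != 0 by rewrite pnatr_eq0; lia.
have e : l%:R = l.-1%:R + 1 :> algC by rewrite natr1 prednK //; lia.
rewrite /cofactor /indic; case: (_ == _); last first.
  by rewrite subr0 -mulrA mulrC -mulrA mulVf // mulr1 addr_ge0 // invr_ge0 ler0n.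
suff -> : 1 + l%:R / l.-1%:R * (l%:R^-1 - 1%:R) = 0 :> algC by [].
rewrite mulrBr mulr1 -mulrA [_^-1 * _]mulrC mulrA divff // e.
by rewrite mulrDl divff // !mul1r; ring.
Qed.

Lemma cofactor_eq0 l T t : (1 < l)%N -> (t == T %[mod l])%N -> cofactor l T t = 0.
Proof.
move=> l1 h; have l00 : (l%:R : algC) != 0 by rewrite pnatr_eq0; lia.
have l10 : (l.-1%:R : algC) != 0 by rewrite pnatr_eq0; lia.
have e : l%:R = l.-1%:R + 1 :> algC by rewrite natr1 prednK //; lia.
rewrite /cofactor /indic h mulrBr mulr1 -mulrA [_^-1 * _]mulrC mulrA divff // e.
by rewrite mulrDl divff // !mul1r; ring.
Qed.

Lemma cofactor_weight l : (1 < l)%N -> l%:R / l.-1%:R * (1 - l%:R^-1) = 1 :> algC.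
Proof.
move=> l1; have l00 : (l%:R : algC) != 0 by rewrite pnatr_eq0; lia.
have l10 : (l.-1%:R : algC) != 0 by rewrite pnatr_eq0; lia.
have e : l%:R = l.-1%:R + 1 :> algC by rewrite natr1 prednK //; lia.
by rewrite mulrBr mulr1 -mulrA [_^-1 * _]mulrC mulrA divff // e mulrDl divff // !mul1r addrK.
Qed.

Lemma coprime_prod_primes l ls : prime l -> all prime ls -> l \notin ls ->
  coprime l (\prod_(k <- ls) k)%N.
Proof.
move=> lp; elim: ls => [|k ls IH] /=; first by rewrite big_nil coprimen1.
move=> /andP[kp kls]; rewrite inE negb_or big_cons coprimeMr => /andP[lk lls].
by rewrite IH // andbT prime_coprime // dvdn_prime2.
Qed.

Section Sieve.
Variables (F : finFieldType) (w : algC).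
Let n := #|F|.-1.
Hypothesis wP : n.-primitive_root w.
Let n0 : (0 < n)%N := card_finField_gt0 F.
Let tpoly := tpoly F w.

Lemma eqn_mod_pred l a b c : (l %| n)%N ->
  (a + n.-1 * b == c %[mod l])%N = (a == c + b %[mod l])%N.
Proof.
move=> ln; rewrite -(eqn_modDr b) -addnA -mulSnr (prednK n0).
by rewrite -modnDmr -modnMml (eqP ln) mul0n mod0n addn0.
Qed.

Lemma indic_fourier l T t : (0 < l)%N -> (l %| n)%N ->
  indic l T t = l%:R^-1 * \sum_(c <- iota 0 l) w ^+ (n %/ l * c * (t + n.-1 * T)).
Proof.
move=> l0 ln; have zP : l.-primitive_root (w ^+ (n %/ l)) by apply: dvdn_prim_root.
have ld : (t == T %[mod l])%N = (l %| t + n.-1 * T)%N.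
  by have := eqn_mod_pred t T 0 ln; rewrite add0n mod0n => <-.
rewrite /indic ld; set d := (t + _)%N.
have -> : \sum_(c <- iota 0 l) w ^+ (n %/ l * c * d) = \sum_(c < l) (w ^+ (n %/ l) ^+ d) ^+ c.
  rewrite -(big_mkord xpredT (fun c => (w ^+ (n %/ l) ^+ d) ^+ c)) /index_iota subn0.
  by apply: eq_bigr => c _; rewrite -!exprM -mulnA [(c * d)%N]mulnC mulnA.
have l00 : (l%:R : algC) != 0 by rewrite pnatr_eq0 -lt0n.
case: (boolP (l %| d)%N) => hd.
  have e : w ^+ (n %/ l) ^+ d = 1 by apply/eqP; rewrite -(prim_order_dvd zP).
  by rewrite e (eq_bigr (fun=> 1)) ?sumr_const ?card_ord ?mulVf // => i _; rewrite expr1n.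
have := subrX1 (w ^+ (n %/ l) ^+ d) l.
rewrite [(_ ^+ d) ^+ l]exprAC (prim_expr_order zP) expr1n subrr => /esym/eqP.
rewrite mulf_eq0 subr_eq0 -(prim_order_dvd zP) (negbTE hd) /= => /eqP ->.
by rewrite mulr0.
Qed.

Lemma indic_freqs l T : (0 < l)%N -> (l %| n)%N -> exists s : seq (algC * nat),
  [/\ all (fun p => has_order F l p.2) s, \sum_(p <- s) `|p.1| = 1 - l%:R^-1 &
      forall t, l%:R^-1 - indic l T t = \sum_(p <- s) p.1 * w ^+ (p.2 * t)].
Proof.
move=> l0 ln; have l00 : (l%:R : algC) != 0 by rewrite pnatr_eq0 -lt0n.
have d0 : (0 < n %/ l)%N by rewrite divn_gt0 // dvdn_leq.
exists [seq (- l%:R^-1 * w ^+ (n %/ l * c * (n.-1 * T)), (n %/ l * c)%N) | c <- iota 1 l.-1].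
split.
- apply/allP => _ /mapP[c + ->] /=; rewrite mem_iota add1n prednK // => /andP[c0 cl].
  rewrite /has_order -/n mulnA [(l * _)%N]mulnC divnK // dvdn_mulr //=.
  by rewrite -{1}(divnK ln) dvdn_pmul2l // gtnNdvd.
- rewrite big_map /= (eq_bigr (fun=> l%:R^-1)); last first.
    by move=> c _; rewrite normrM normrN (norm_w wP) mulr1 normfV normr_nat.
  rewrite big_const_seq count_predT size_iota iter_addr_0 -[_ *+ l.-1]mulr_natl.
  have -> : l.-1%:R = l%:R - 1 :> algC by rewrite -[in RHS](prednK l0) -natr1 addrK.
  by rewrite mulrBl mul1r divff.
move=> t; have il : iota 0 l = 0%N :: iota 1 l.-1 by rewrite -{1}(prednK l0).
rewrite indic_fourier // big_map il big_cons muln0 mul0n expr0.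
rewrite mulrDr mulr1 opprD addrA subrr sub0r mulr_sumr -sumrN.
apply: eq_bigr => c _; rewrite mulnDr exprD /=.
by move: (w ^+ _) (w ^+ _) => a b; rewrite !mulNr -mulrA [a * b]mulrC.
Qed.

Lemma tpoly_event_t l T : (0 < l)%N -> (l %| n)%N ->
  tpoly l 1 0 0 (1 - l%:R^-1) (fun t _ => l%:R^-1 - indic l T t).
Proof.
move=> l0 ln; have [s [sa sn e]] := indic_freqs T l0 ln.
exists [::], [seq (p.1, (p.2, 0%N)) | p <- s]; split=> //.
- by rewrite all_map.
- by rewrite big_nil normr0 addr0.
- by rewrite big_map sn.
move=> t r; rewrite e big_nil !add0r big_map.
by apply: eq_bigr => p _; rewrite mul0n addn0.
Qed.

Lemma tpoly_event_r l T : (0 < l)%N -> (l %| n)%N ->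
  tpoly 1 l 0 (1 - l%:R^-1) 0 (fun _ r => l%:R^-1 - indic l T r).
Proof.
move=> l0 ln; have [s [sa sn e]] := indic_freqs T l0 ln.
exists s, [::]; split=> //.
- by rewrite normr0 add0r sn.
- by rewrite big_nil.
by move=> t r; rewrite e big_nil add0r addr0.
Qed.

Lemma tpoly_scale M L z N0 N1 Q c : 0 <= c -> tpoly M L z N0 N1 Q ->
  tpoly M L (c * z) (c * N0) (c * N1) (fun t r => c * Q t r).
Proof.
move=> c0 h; have := tpoly_mul (coprime1n _) (coprime1n _) (tpoly_const F w c) h.
rewrite !mul1n ger0_norm //; apply: tpoly_norm => //; ring.
Qed.

Let divisors ls := all (fun l => prime l && (l %| n)%N) ls.

Lemma divisors_prime ls : divisors ls -> all prime ls.
Proof. by apply: sub_all => l /andP[]. Qed.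

Lemma tpoly_core_t ls T : uniq ls -> divisors ls ->
  tpoly (\prod_(l <- ls) l)%N 1 1 1 (2 ^+ size ls - 1)
    (fun t _ => \prod_(l <- ls) cofactor l T t).
Proof.
elim: ls => [|l ls IH] /=.
  move=> _ _; rewrite big_nil expr0 subrr -[X in tpoly _ _ _ X](@normr1 algC).
  by apply: tpoly_eq (tpoly_const F w 1) => t r; rewrite big_nil.
move=> /andP[lls uls] /andP[/andP[lp ln] dls].
have co := coprime_prod_primes lp (divisors_prime dls) lls.
have l0 := prime_gt0 lp; have l1 := prime_gt1 lp.
have c0 : 0 <= l%:R / l.-1%:R :> algC by rewrite divr_ge0 ?ler0n.
have h := tpoly_add (tpoly_weaken (dvd1n l) (dvd1n 1) (tpoly_const F w 1))
   (tpoly_scale c0 (tpoly_event_t T l0 ln)).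
have := tpoly_mul co (coprime1n _) h (IH uls dls).
rewrite big_cons muln1; rewrite cofactor_weight // !mulr0 normr1 !addr0 !add0r.
move=> h'; apply: tpoly_eq (tpoly_norm _ _ _ h') => [t r|||].
- by rewrite big_cons.
- by ring.
- by ring.
by rewrite exprS; ring.
Qed.

Lemma tpoly_core_r ls T : uniq ls -> divisors ls ->
  tpoly 1 (\prod_(l <- ls) l)%N 1 (2 ^+ size ls) 0
    (fun _ r => \prod_(l <- ls) cofactor l T r).
Proof.
elim: ls => [|l ls IH] /=.
  move=> _ _; rewrite big_nil expr0 -[X in tpoly _ _ _ X](@normr1 algC).
  by apply: tpoly_eq (tpoly_const F w 1) => t r; rewrite big_nil.
move=> /andP[lls uls] /andP[/andP[lp ln] dls].
have co := coprime_prod_primes lp (divisors_prime dls) lls.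
have l0 := prime_gt0 lp; have l1 := prime_gt1 lp.
have c0 : 0 <= l%:R / l.-1%:R :> algC by rewrite divr_ge0 ?ler0n.
have h := tpoly_add (tpoly_weaken (dvd1n 1) (dvd1n l) (tpoly_const F w 1))
   (tpoly_scale c0 (tpoly_event_r T l0 ln)).
have := tpoly_mul (coprime1n _) co h (IH uls dls).
rewrite big_cons muln1; rewrite cofactor_weight // !mulr0 normr1 !addr0 !add0r.
move=> h'; apply: tpoly_eq (tpoly_norm _ _ _ h') => [t r|||].
- by rewrite big_cons.
- by ring.
- by rewrite exprS; ring.
by ring.
Qed.

Definition excess (ls : seq nat) : algC := \sum_(l <- ls) (1 - l%:R^-1).

Lemma tpoly_rest_t ls T : divisors ls ->
  tpoly (\prod_(l <- ls) l)%N 1 0 0 (excess ls)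
    (fun t _ => \sum_(l <- ls) (l%:R^-1 - indic l T t)).
Proof.
rewrite /excess; elim: ls => [|l ls IH] /=.
  move=> _; rewrite !big_nil -{2}(@normr0 _ algC).
  by apply: tpoly_eq (tpoly_const F w 0) => t r; rewrite big_nil.
move=> /andP[/andP[lp ln] dls]; have l0 := prime_gt0 lp.
have := tpoly_add (tpoly_weaken (dvdn_mulr _ (dvdnn l)) (dvdnn 1) (tpoly_event_t T l0 ln))
   (tpoly_weaken (dvdn_mull l (dvdnn _)) (dvdnn 1) (IH dls)).
rewrite !big_cons !addr0 => h; apply: tpoly_eq h => t r.
by rewrite big_cons.
Qed.

Lemma tpoly_rest_r ls T : divisors ls ->
  tpoly 1 (\prod_(l <- ls) l)%N 0 (excess ls) 0
    (fun _ r => \sum_(l <- ls) (l%:R^-1 - indic l T r)).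
Proof.
rewrite /excess; elim: ls => [|l ls IH] /=.
  move=> _; rewrite !big_nil -{2}(@normr0 _ algC).
  by apply: tpoly_eq (tpoly_const F w 0) => t r; rewrite big_nil.
move=> /andP[/andP[lp ln] dls]; have l0 := prime_gt0 lp.
have := tpoly_add (tpoly_weaken (dvdnn 1) (dvdn_mulr _ (dvdnn l)) (tpoly_event_r T l0 ln))
   (tpoly_weaken (dvdnn 1) (dvdn_mull l (dvdnn _)) (IH dls)).
rewrite !big_cons !addr0 => h; apply: tpoly_eq h => t r.
by rewrite big_cons.
Qed.

(** The modulus to which [i - j] is prescribed: 4 if 4 divides [n], otherwise 2 or 1 from the
    parities of [i] and [j]. Scaled to mean 1, the indicator has coefficients of absolute value 1,
    hence this number as its weight. *)
Definition two_part : nat := (if odd n then 1 else if 4 %| n then 4 else 2)%N.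

Lemma two_part_dvd : (two_part %| n)%N.
Proof. by rewrite /two_part; case: ifP => // no; case: ifP => // _; rewrite dvdn2 no. Qed.

Lemma two_part_gt0 : (0 < two_part)%N.
Proof. by rewrite /two_part; do 2?case: ifP. Qed.

Lemma tpoly_two R : tpoly 1 two_part 1 two_part%:R 0 (fun _ r => two_part%:R * indic two_part R r).
Proof.
have m00 : (two_part%:R : algC) != 0 by rewrite pnatr_eq0 -lt0n two_part_gt0.
have [s [sa sn e]] := indic_freqs R two_part_gt0 two_part_dvd.
exists [seq (- two_part%:R * p.1, p.2) | p <- s], [::]; split=> //.
- by rewrite all_map.
- rewrite big_map (eq_bigr (fun p => two_part%:R * `|p.1|)); last first.
    by move=> p _; rewrite /= mulNr normrN normrM normr_nat.
  by rewrite -mulr_sumr sn normr1 mulrBr mulr1 divff // addrC subrK.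
- by rewrite big_nil.
move=> t r; rewrite big_map big_nil addr0.
have -> : \sum_(j <- s) (- two_part%:R * j.1, j.2).1 * w ^+ ((- two_part%:R * j.1, j.2).2 * r) =
    - two_part%:R * (two_part%:R^-1 - indic two_part R r).
  by rewrite e mulr_sumr; apply: eq_bigr => p _ /=; rewrite mulrA.
by rewrite mulrBr mulNr divff // mulNr opprK addrA subrr add0r.
Qed.
End Sieve.

(** * The weighted sieve *)

Section SieveBound.
Variables (F : finFieldType) (g : F) (w : algC).
Let n := #|F|.-1.
Hypotheses (gP : n.-primitive_root g) (wP : n.-primitive_root w).
Let n0 : (0 < n)%N := card_finField_gt0 F.

(** The letters [t] and [r] stand for the conditions on [i + j] and [i - j]. Those of the cores
    [ct], [cr] enter as exact factors, those of the rests [rt], [rr] through a union bound. *)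
Variables ct rt cr rr : seq nat.
Hypotheses (ut : uniq (ct ++ rt)) (ur : uniq (cr ++ rr)).
Hypothesis (dt : all (odd_prime_divisor n) (ct ++ rt)).
Hypothesis (dr : all (odd_prime_divisor n) (cr ++ rr)).
Hypothesis (allt : forall l, odd_prime_divisor n l -> l \in ct ++ rt).
Hypothesis (allr : forall l, odd_prime_divisor n l -> l \in cr ++ rr).

Let m := two_part F.
Definition sieve_density (s s' : seq nat) : algC :=
  1 - \sum_(l <- s) l%:R^-1 - \sum_(l <- s') l%:R^-1.
Let d := sieve_density rt rr.
Let A : algC := m%:R * 2 ^+ size cr.
Let N0 := A * (d + excess rr).
Let N1 := A * ((2 ^+ size ct - 1) * (d + excess rr) + 2 ^+ size ct * excess rt).
Hypothesis d_ge0 : 0 <= d.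
Hypothesis criterion : N0 + sqrtC n.+1%:R * (N0 + 2 * N1) < n%:R * d.

Variables U V : nat.
Let T := (U + V)%N.
Let R := (U + n.-1 * V)%N.
Let R2 := (U + n.-1 * V + (if 4 %| n then 2 else 0))%N.

(** At most the indicator that no congruence of the rests holds; its mean is [d]. *)
Let W t r : algC := 1 - \sum_(l <- rt) indic l T t - \sum_(l <- rr) indic l R r.
Let B t r : algC := (\prod_(l <- ct) cofactor l T t) *
  (m%:R * indic m R2 r * \prod_(l <- cr) cofactor l R r).

Let divs s : all (odd_prime_divisor n) s -> all (fun l => prime l && (l %| n)%N) s.
Proof. by apply: sub_all => l /and3P[-> _ ->]. Qed.

Let prod_odd s : all (odd_prime_divisor n) s -> odd (\prod_(l <- s) l)%N.
Proof.
elim: s => [|l s IH] /=; first by rewrite big_nil.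
by move=> /andP[/and3P[_ lo _] hs]; rewrite big_cons oddM lo IH.
Qed.

Let m_cases : [\/ m = 1%N, m = 2%N | m = 4%N].
Proof. by rewrite /m /two_part; do 2?case: ifP => _; [constructor 1|constructor 3|constructor 2]. Qed.

Let coprime_m a : odd a -> coprime a m.
Proof.
move=> ao; case: m_cases => ->; [exact: coprimen1 | by rewrite coprimen2 |].
by rewrite -[4%N]/(2 ^ 2)%N coprime_pexpr ?coprimen2.
Qed.

Let coprime_cat s s' : uniq (s ++ s') -> all (odd_prime_divisor n) (s ++ s') ->
  coprime (\prod_(l <- s) l)%N (\prod_(l <- s') l)%N.
Proof.
elim: s => [|l s IH] /=; first by rewrite big_nil coprime1n.
rewrite mem_cat negb_or => /andP[/andP[_ ls'] us] /andP[/and3P[lp _ _] hs].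
rewrite big_cons coprimeMl IH // andbT coprime_prod_primes //.
by move: hs; rewrite all_cat => /andP[_]; apply: sub_all => k /and3P[].
Qed.

Let tpoly_weight : exists M L, odd M /\ tpoly F w M L d N0 N1 (fun t r => B t r * W t r).
Proof.
move: (dt) (dr); rewrite !all_cat => /andP[dct drt] /andP[dcr drr].
have [uct _ urt] := and3P (etrans (esym (cat_uniq _ _)) ut).
have [ucr _ urr] := and3P (etrans (esym (cat_uniq _ _)) ur).
have h1 := tpoly_core_t wP T uct (divs dct).
have co2 : coprime m (\prod_(l <- cr) l)%N by rewrite coprime_sym coprime_m ?prod_odd.
have h2 := tpoly_mul (coprimen1 1) co2 (tpoly_two wP R2) (tpoly_core_r wP R ucr (divs dcr)).
have h3 := tpoly_mul (coprimen1 _) (coprime1n _) h1 h2.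
have h4 := tpoly_add
  (tpoly_weaken (dvd1n (\prod_(l <- rt) l)%N) (dvd1n (\prod_(l <- rr) l)%N) (tpoly_const F w d))
  (tpoly_add (tpoly_weaken (dvdnn _) (dvd1n _) (tpoly_rest_t wP T (divs drt)))
             (tpoly_weaken (dvd1n _) (dvdnn _) (tpoly_rest_r wP R (divs drr)))).
have co3 : coprime (\prod_(l <- ct) l * (1 * 1)) (\prod_(l <- rt) l)%N.
  by rewrite !muln1 coprime_cat.
have co4 : coprime (1 * (m * (\prod_(l <- cr) l))) (\prod_(l <- rr) l)%N.
  by rewrite mul1n coprimeMl coprime_cat // andbT coprime_sym coprime_m ?prod_odd.
exists (\prod_(l <- ct) l * (1 * 1) * (\prod_(l <- rt) l))%N, (1 * (m * (\prod_(l <- cr) l)) * (\prod_(l <- rr) l))%N.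
split; first by rewrite !oddM !prod_odd.
have h5 := tpoly_mul co3 co4 h3 h4.
apply: tpoly_eq (tpoly_norm _ _ _ h5) => [t r|||].
- rewrite /B /W /d /sieve_density; congr (_ * _); rewrite !sumrB; ring.
- by rewrite !mul1r !addr0.
- by rewrite /N0 /A (ger0_norm d_ge0); ring.
- by rewrite /N1 /A (ger0_norm d_ge0); ring.
Qed.

(** For even [n], the quadratic character of [g^U x]: since [w^(n/2) = -1], [1 + twist] is twice the
    indicator that [i] has the parity of [U]. *)
Definition twist (x : F) : algC :=
  if odd n then 0 else w ^+ (n./2 * U) * w ^+ (n./2 * dlog g x).

Lemma half_bounds : ~~ odd n -> (0 < n./2 < n)%N.
Proof.
move=> ne; have e : (n./2 * 2 = n)%N by rewrite muln2 even_halfK.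
have h0 : (0 < n./2)%N by rewrite -(ltn_pmul2r (isT : 0 < 2)%N) e mul0n.
by rewrite h0 -[X in (_ < X)%N]e muln2 -addnn -[X in (X < _)%N]addn0 ltn_add2l.
Qed.

Lemma w_half : ~~ odd n -> w ^+ n./2 = -1.
Proof.
move=> ne; have e : (n./2 * 2 = n)%N by rewrite muln2 even_halfK.
have : (w ^+ n./2) ^+ 2 == 1 by rewrite -exprM e (prim_expr_order wP).
rewrite sqrf_eq1 => /orP[|/eqP //].
have /andP[h0 h1] := half_bounds ne.
by rewrite -(prim_order_dvd wP) gtnNdvd.
Qed.

Lemma twist_ge0 x : 0 <= 1 + twist x.
Proof.
rewrite /twist; case: ifPn => [|ne]; first by rewrite addr0.
rewrite -exprD -mulnDr exprM w_half // -signr_odd.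
by case: (odd _); rewrite ?expr1 ?subrr // expr0 addr_ge0 ?ler01.
Qed.

Lemma twist_neq x : ~~ odd n -> odd (dlog g x) != odd U -> 1 + twist x = 0.
Proof.
move=> ne; rewrite /twist (negbTE ne) -exprD -mulnDr exprM w_half // -signr_odd oddD.
by case: (odd U); case: (odd (dlog g x)); rewrite //= expr1 subrr.
Qed.

Lemma sum_weight : `|\sum_(x | inner x) (1 + twist x) * (B (tlog g x) (rlog g x) * W (tlog g x) (rlog g x))
   - n%:R * d| <= N0 + sqrtC n.+1%:R * (N0 + 2 * N1).
Proof.
have [M [L [oM h]]] := tpoly_weight.
have N00 : 0 <= N0 by have [s0 [s1 [_ _ + _ _]]] := h; apply: le_trans; rewrite addr_ge0 ?normr_ge0 ?sumr_ge0.
have N10 : 0 <= N1 by have [s0 [s1 [_ _ _ + _]]] := h; apply: le_trans; rewrite sumr_ge0.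
have s0 : 0 <= sqrtC (n.+1%:R : algC) by rewrite sqrtC_ge0 ler0n.
have plain := sum_tpoly_plain gP wP oM h.
under eq_bigr do rewrite mulrDl mul1r.
rewrite big_split /= addrAC; apply: le_trans (ler_normD _ _) _.
(* The plain sum deviates by [N0 + sqrt q N1], the twisted one by [sqrt q (N0 + N1)]; for odd [n]
   the latter is zero. *)
have -> : N0 + sqrtC n.+1%:R * (N0 + 2 * N1) = (N0 + sqrtC n.+1%:R * N1) + sqrtC n.+1%:R * (N0 + N1) by ring.
apply: lerD => //; rewrite /twist; case: (boolP (odd n)) => [no|ne].
  by rewrite big1 ?normr0 ?mulr_ge0 ?addr_ge0 // => x _; rewrite mul0r.
have e : (2 * n./2 = n)%N by rewrite mul2n even_halfK.
apply: (sum_tpoly_twist gP wP oM h); rewrite ?(norm_w wP) ?e //.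
by have /andP[h0 h1] := half_bounds ne; rewrite gtnNdvd.
Qed.

Lemma indic_ge0 l a b : 0 <= indic l a b.
Proof. by rewrite /indic ler0n. Qed.

Lemma weight_ge0 t r : 0 <= B t r.
Proof.
move: (dt) (dr); rewrite !all_cat => /andP[dct _] /andP[dcr _].
have P c X k : all (odd_prime_divisor n) c -> 0 <= \prod_(l <- c) cofactor l X k.
  move=> hc; rewrite big_seq; apply: prodr_ge0 => l lc; apply: cofactor_ge0.
  by have /and3P[/prime_gt1] := allP hc _ lc.
by rewrite /B !mulr_ge0 ?P ?indic_ge0 ?ler0n.
Qed.

Lemma W_le0 t r l : (l \in rt) && (t == T %[mod l])%N || (l \in rr) && (r == R %[mod l])%N -> W t r <= 0.
Proof.
have S X k c : 0 <= \sum_(l <- c) indic l X k by rewrite sumr_ge0 // => *; rewrite indic_ge0.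
have S1 X k c : l \in c -> (k == X %[mod l])%N -> 1 <= \sum_(l <- c) indic l X k.
  move=> lc h; rewrite (perm_big _ (perm_to_rem lc)) big_cons /indic h lerDl.
  exact: S.
rewrite /W => /orP[] /andP[lc h].
  by rewrite -addrA -opprD subr_le0; apply: le_trans (S1 _ _ _ lc h) _; rewrite lerDl S.
by rewrite -addrA -opprD subr_le0; apply: le_trans (S1 _ _ _ lc h) _; rewrite lerDr S.
Qed.

Lemma weight_neq0_good x : inner x -> 1 + twist x != 0 ->
  B (tlog g x) (rlog g x) != 0 -> ~ W (tlog g x) (rlog g x) <= 0 ->
  good_point n U V (dlog g x) (dlog g (1 - x)).
Proof.
move=> ix tw b wn; set i := dlog g x; set j := dlog g (1 - x).
have par : ~~ odd n -> odd i = odd U.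
  by move=> ne; apply/eqP; apply: contraNT tw => h; rewrite (twist_neq ne h).
have rmod l c : (l %| n)%N -> (rlog g x == U + n.-1 * V + c %[mod l])%N = (i + V == j + U + c %[mod l])%N.
  move=> ln; rewrite /rlog -/i -/j (eqn_mod_pred _ _ _ ln).
  have -> : (U + n.-1 * V + c + j = (U + c + j) + n.-1 * V)%N by ring.
  rewrite eq_sym (eqn_mod_pred _ _ _ ln) eq_sym; congr (_ == _ %[mod _]); ring.
move: b; rewrite /B !mulf_eq0 !negb_or => /andP[bt /andP[/andP[_ b2] br]].
have {b2}two : (rlog g x == R2 %[mod m])%N by apply: contraNT b2 => /negbTE h; rewrite /indic h.
have core c X k l : all (odd_prime_divisor n) c -> \prod_(l <- c) cofactor l X k != 0 -> l \in c -> (k != X %[mod l])%N.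
  move=> hc + lc; apply: contraNN => h; rewrite (perm_big _ (perm_to_rem lc)) big_cons cofactor_eq0 //=; first by rewrite mul0r.
  by have /and3P[/prime_gt1 l1 _ _] := allP hc _ lc.
move: (dt) (dr); rewrite !all_cat => /andP[dct _] /andP[dcr _].
split.
- move=> ne; split; first exact: par.
  have m2 : (2 %| m)%N by rewrite /m /two_part (negbTE ne); case: ifP.
  have : (rlog g x == R2 %[mod 2])%N by rewrite -(modn_dvdm _ m2) (eqP two) modn_dvdm.
  rewrite /R2 rmod ?dvdn2 // !modn2 !oddD (par ne).
  by case: ifP => _ /=; rewrite addbF; case: (odd U); case: (odd V); case: (odd j).
- move=> n4; apply/eqP; rewrite -rmod //.
  have ne : ~~ odd n by rewrite -dvdn2 (dvdn_trans _ n4).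
  by move: two; rewrite /R2 /m /two_part (negbTE ne) n4.
move=> l hl; have /and3P[_ _ ln] := hl; split.
  have := allt hl; rewrite mem_cat => /orP[lc|lc]; first exact: core dct bt lc.
  by apply/negP => h; apply: wn; apply: (W_le0 (l := l)); rewrite lc h.
rewrite -[(j + U)%N]addn0 -rmod // addn0.
have := allr hl; rewrite mem_cat => /orP[lc|lc]; first exact: core dcr br lc.
by apply/negP => h; apply: wn; apply: (W_le0 (l := l)); rewrite lc h orbT.
Qed.

(** If no [x] gave a good point, every summand of the weighted sum would be at most 0, so the sum
    would differ from its main term [n d] by at least [n d], against the criterion. *)
Lemma exists_good_point : exists i j, g ^+ i + g ^+ j = 1 /\ good_point n U V i j.
Proof.
suff [x ix [tw b wn]] : exists2 x : F, inner x & [/\ 1 + twist x != 0,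
    B (tlog g x) (rlog g x) != 0 & ~ W (tlog g x) (rlog g x) <= 0].
  exists (dlog g x), (dlog g (1 - x)); split; last exact: weight_neq0_good.
  rewrite !(dlogK gP) ?(inner_sub ix) //; last by case/andP: ix.
  by rewrite addrC subrK.
pose P (x : F) := [&& inner x, 1 + twist x != 0, B (tlog g x) (rlog g x) != 0 &
   ~~ (W (tlog g x) (rlog g x) <= 0)].
case: (pickP P) => [x /and4P[ix tw b /negP wn]|H]; first by exists x.
exfalso; have := sum_weight; set S := \sum_(x | _) _ => hS.
have S0 : S <= 0.
  apply: sumr_le0 => x ix; have := H x; rewrite /P ix /=.
  case: eqP => [->|_] /=; first by rewrite mul0r.
  case: eqP => [->|_] /=; first by rewrite mul0r mulr0.
  move/negbFE => wl; rewrite mulrA; apply: mulr_ge0_le0 => //.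
  by rewrite mulr_ge0 ?twist_ge0 ?weight_ge0.
have nd : 0 <= n%:R * d by rewrite mulr_ge0 ?ler0n.
have : n%:R * d <= `|S - n%:R * d|.
  rewrite distrC ger0_norm ?lerDl ?oppr_ge0 // subr_ge0.
  exact: le_trans S0 nd.
by move=> h; have := lt_le_trans criterion (le_trans h hS); rewrite ltxx.
Qed.
End SieveBound.

(** * An integer form of the criterion, and its stability when primes are added *)

(** The excess of one rest equals [d + (size - 1)] plus the reciprocals of the other rest. Hence
    [(N0 + 2 N1) / d] increases with the reciprocals, and upper bounds [us] for [D / l] err on the
    safe side. The exponent [kt.+1] comes from the 2 in [N0 + 2 N1]. *)
Definition sieve_excess_bound (D kt kr : nat) (us : seq nat) : nat :=
  let ut := drop kt us in let ur := drop kr us in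
  let c2 := (2 ^ kt.+1)%N in
  let dh := (D - sumn ut - sumn ur)%N in
  (2 ^ kr * (c2.-1 * dh
     + (if ur is [::] then 0 else c2.-1 * (dh + ((size ur).-1 * D + sumn ut)))
     + (if ut is [::] then 0 else c2 * (dh + ((size ut).-1 * D + sumn ur)))))%N.

(** The cores are the first [kt] and [kr] primes of the list. For [K = N0 + 2 N1] the aim is
    [K < (sqrt q - 1) d]: one unit of the 2 rounds [K / d] up strictly, the other is this -1. *)
Definition sieve_test (D m kt kr : nat) (us : seq nat) (q : nat) : bool :=
  let dh := (D - sumn (drop kt us) - sumn (drop kr us))%N in
  [&& kt <= size us, kr <= size us, 0 < dh &
      ((m * sieve_excess_bound D kt kr us) %/ dh + 2) ^ 2 <= q]%N.

Definition reciprocal_bounds (D : nat) (us ls : seq nat) : bool :=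
  all2 (fun u l => D <= u * l)%N us ls.

Section Criterion.
Variables (D : nat).

Lemma reciprocal_bounds_drop k us ls : reciprocal_bounds D us ls ->
  reciprocal_bounds D (drop k us) (drop k ls).
Proof.
elim: k us ls => [|k IH] us ls; first by rewrite !drop0.
by case: us ls => [|u us] [|l ls] //= /andP[_]; apply: IH.
Qed.

Lemma reciprocal_bounds_size us ls : reciprocal_bounds D us ls -> size us = size ls.
Proof. by rewrite /reciprocal_bounds all2E => /andP[/eqP]. Qed.

Lemma sum_reciprocals us ls : reciprocal_bounds D us ls -> all (leq 1) ls ->
  D%:R * \sum_(l <- ls) l%:R^-1 <= (sumn us)%:R :> algC.
Proof.
elim: us ls => [|u us IH] [|l ls] //=; first by rewrite big_nil mulr0.
move=> /andP[h hs] /andP[l0 ls0]; rewrite big_cons natrD mulrDr lerD ?IH //.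
by rewrite ler_pdivrMr ?ltr0n // -natrM ler_nat.
Qed.

Lemma excess_size ls : excess ls = (size ls)%:R - \sum_(l <- ls) l%:R^-1.
Proof. by rewrite /excess sumrB big_const_seq count_predT iter_addr_0. Qed.

Lemma sieve_test_T (F : finFieldType) (ls us : seq nat) (kt kr : nat) :
  let n := #|F|.-1 in
  uniq ls -> (forall l, (l \in ls) = odd_prime_divisor n l) ->
  (0 < D)%N -> reciprocal_bounds D us ls ->
  sieve_test D (two_part F) kt kr us #|F| -> T_prop F.
Proof.
move=> n uls lsP D0 rb /and4P[ktu kru dh0 test].
have n0 : (0 < n)%N := card_finField_gt0 F.
have [g gP] : exists g : F, n.-primitive_root g.
  have : has n.-primitive_root (enum (predC1 (0 : F))).
    apply: has_prim_root; rewrite ?enum_uniq // -?cardE ?cardC1 //.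
    apply/allP => x; rewrite mem_enum => x0; apply/unity_rootP.
    exact: finField_fermat.
  by move=> /hasP[g _ gP]; exists g.
have [w wP] := C_prim_root_exists n0.
apply: (T_prop_good gP) => U V.
have sz := reciprocal_bounds_size rb.
set dh := (D - sumn (drop kt us) - sumn (drop kr us))%N in dh0 test.
pose rt := drop kt ls; pose rr := drop kr ls.
pose d := sieve_density rt rr.
pose st := \sum_(l <- rt) (l%:R^-1 : algC); pose sr := \sum_(l <- rr) (l%:R^-1 : algC).
have pos ks : 0 <= \sum_(l <- ks) (l%:R^-1 : algC) by rewrite sumr_ge0 // => l _; rewrite invr_ge0 ler0n.
have gt0 : all (leq 1) ls by apply/allP => l; rewrite lsP => /and3P[/prime_gt0].
have gtd k : all (leq 1) (drop k ls) by apply/allP => l /mem_drop; apply: (allP gt0).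
have ht : D%:R * st <= (sumn (drop kt us))%:R.
  by apply: sum_reciprocals; rewrite ?reciprocal_bounds_drop ?gtd.
have hr : D%:R * sr <= (sumn (drop kr us))%:R.
  by apply: sum_reciprocals; rewrite ?reciprocal_bounds_drop ?gtd.
have D0' : 0 < (D%:R : algC) by rewrite ltr0n.
have Ed : d = 1 - st - sr by [].
have hd : dh%:R <= D%:R * d.
  rewrite /dh -subnDA natrB; last by rewrite ltnW // -subn_gt0 subnDA.
  have -> : D%:R * d = D%:R - D%:R * st - D%:R * sr by rewrite Ed; ring.
  by rewrite natrD opprD addrA; apply: lerB hr; apply: lerB ht.
have dh0' : 0 < (dh%:R : algC) by rewrite ltr0n.
have d0 : 0 < d by rewrite -(pmulr_rgt0 _ D0'); apply: lt_le_trans hd.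
(* Cross-multiplied form of [1 + x / d <= 1 + D x / dh], valid because [dh <= D d]. *)
have piece (e e' : algC) (a b : nat) : e = a%:R -> D%:R * e' <= b%:R -> 0 <= e' ->
    (d + (a.-1)%:R + e') * dh%:R <= d * (dh + (a.-1 * D + b))%:R.
  move=> _ he' e'0; rewrite -addrA mulrDl natrD [leRHS]mulrDr lerD2l.
  apply: (@le_trans _ _ (((a.-1)%:R + e') * (D%:R * d))); first by rewrite ler_wpM2l ?addr_ge0 ?ler0n.
  rewrite mulrA mulrC ler_pM2l // natrD natrM mulrDl lerD2l mulrC //.
have bound (us1 us2 : seq nat) (l1 l2 : seq nat) : size us1 = size l1 ->
    d = 1 - \sum_(l <- l1) l%:R^-1 - \sum_(l <- l2) l%:R^-1 ->
    D%:R * (\sum_(l <- l2) l%:R^-1) <= (sumn us2)%:R :> algC ->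
    excess l1 * dh%:R <= d * (if us1 is [::] then 0 else (dh + ((size us1).-1 * D + sumn us2))%N)%:R.
  move=> s1 e1 h2; rewrite excess_size -s1; case: us1 s1 => [|u us1] s1.
    by move/esym/size0nil: s1 => ->; rewrite big_nil subr0 mul0r mulr0.
  apply: le_trans (piece _ _ (size (u :: us1)) (sumn us2) erefl h2 (pos _)).
  rewrite ler_pM2r //= -natr1 e1 le_eqVlt; apply/orP; left; apply/eqP; ring.
have br := bound (drop kr us) (drop kt us) rr rt _ _ ht.
have bt := bound (drop kt us) (drop kr us) rt rr _ _ hr.
have {}br := br _ _; have {}bt := bt _ Ed.
have szr : size (drop kr us) = size rr by rewrite !size_drop sz.
have szt : size (drop kt us) = size rt by rewrite !size_drop sz.
have {}br := br szr (etrans Ed (addrAC _ _ _)); have {}bt := bt szt.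
have pr := odd_prime_divisor n.
have sub k l : l \in take k ls ++ drop k ls -> odd_prime_divisor n l by rewrite cat_take_drop lsP.
have kts : size (take kt ls) = kt by rewrite size_take -sz; case: ltngtP ktu.
have krs : size (take kr ls) = kr by rewrite size_take -sz; case: ltngtP kru.
apply: (exists_good_point gP wP (ct := take kt ls) (rt := rt) (cr := take kr ls) (rr := rr));
  rewrite /rt /rr ?cat_take_drop //.
- by apply/allP => l; rewrite lsP.
- by apply/allP => l; rewrite lsP.
- by move=> l; rewrite lsP.
- by move=> l; rewrite lsP.
- exact: ltW.
rewrite -/rt -/rr -/d kts krs -/n.
set m := two_part F.
have Fq : #|F| = n.+1 by rewrite /n prednK // ltnW // finNzRing_gt1.
pose s : nat := ((m * sieve_excess_bound D kt kr us) %/ dh).+1.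
have hs : (s.+1%:R : algC) <= sqrtC n.+1%:R.
  rewrite -(@ler_pXn2r _ 2) ?nnegrE ?ler0n ?sqrtC_ge0 ?ler0n // sqrtCK -natrX ler_nat -Fq.
  by rewrite /s -addn2.
pose c2 : nat := (2 ^ kt.+1)%N; pose c1 := c2.-1.
have c20 : (0 < c2)%N by rewrite expn_gt0.
have c1R : (c1%:R : algC) = 2 * 2 ^+ kt - 1 by rewrite /c1 -subn1 natrB // /c2 expnS natrM natrX.
pose K : algC := m%:R * 2 ^+ kr * (c1%:R * (d + excess rr) + c2%:R * excess rt).
have Kdh : K * dh%:R <= d * (m * sieve_excess_bound D kt kr us)%:R.
  rewrite /sieve_excess_bound /K -/dh -/c2 -/c1 !natrM natrX -!mulrA [d * _]mulrCA ler_wpM2l ?ler0n //.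
  rewrite [d * _]mulrCA ler_wpM2l ?exprn_ge0 ?ler0n // !natrD natrM.
  have Z (c : nat) (us1 us2 : seq nat) : (if us1 is [::] then 0 else (c * (dh + ((size us1).-1 * D + sumn us2)))%N)
     = (c * (if us1 is [::] then 0 else (dh + ((size us1).-1 * D + sumn us2))))%N.
    by case: us1; rewrite ?muln0.
  rewrite !Z !natrM [leLHS]mulrDl [leRHS]mulrDr; apply: lerD; last first.
    by rewrite -mulrA [leRHS]mulrCA ler_wpM2l ?ler0n.
  rewrite mulrDr mulrDl [leRHS]mulrDr; apply: lerD; first by rewrite -mulrA [leRHS]mulrCA.
  by rewrite -mulrA [leRHS]mulrCA ler_wpM2l ?ler0n.
have Ks : K < s%:R * d.
  rewrite -(ltr_pM2r dh0'); apply: le_lt_trans Kdh _.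
  rewrite mulrC -mulrA [d * _]mulrC mulrA ltr_pM2r // -natrM ltr_nat.
  by rewrite /s; exact: ltn_ceil.
set q := sqrtC n.+1%:R in hs *.
have q2 : q ^+ 2 = n%:R + 1 by rewrite sqrtCK natr1.
have nq : n%:R = (q - 1) * (q + 1) by rewrite -subr_sqr expr1n q2 addrK.
have q0 : 0 <= q by rewrite sqrtC_ge0 ler0n.
set N0 := _ * (d + excess rr); set N1 := _ * (_ + 2 ^+ kt * excess rt).
have eK : K = N0 + 2 * N1.
  by rewrite /K /N0 /N1 c1R /c2 expnS natrM natrX; ring.
have ex0 ks : all (leq 1) ks -> 0 <= excess ks.
  move=> h; rewrite /excess big_seq sumr_ge0 // => l lk; rewrite subr_ge0 invf_le1 ?ltr0n ?ler1n;
  by have := allP h _ lk.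
have N10 : 0 <= N1.
  have p2 k : 0 <= 2 ^+ k :> algC by rewrite exprn_ge0 ?ler0n.
  have k1 : 0 <= 2 ^+ kt - 1 :> algC by rewrite subr_ge0 exprn_ege1 // ler1n.
  have dex : 0 <= d + excess rr by rewrite addr_ge0 ?ex0 ?gtd ?(ltW d0).
  apply: mulr_ge0; first by rewrite mulr_ge0 ?ler0n.
  by apply: addr_ge0; apply: mulr_ge0; rewrite ?ex0 ?gtd.
(* Here [q] is the square root of the order, so [n = (q - 1) (q + 1)]. As [N0 + q K <= (q + 1) K],
   it is enough that [K < (q - 1) d]. *)
rewrite nq; apply: (@le_lt_trans _ _ ((q + 1) * K)).
  rewrite eK (_ : (q + 1) * _ = N0 + q * (N0 + 2 * N1) + 2 * N1); last by ring.
  by rewrite lerDl mulr_ge0 ?ler0n.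
rewrite [(q - 1) * _]mulrC -mulrA ltr_pM2l ?ltr_wpDl ?ltr01 //.
apply: lt_le_trans Ks _; rewrite ler_pM2r // lerBrDr natr1 //.
Qed.
End Criterion.

Definition critical (D m q : nat) (ls : seq nat) : Prop :=
  exists us kt kr, reciprocal_bounds D us ls /\ sieve_test D m kt kr us q.

Lemma sieve_test_leq D m kt kr us q q' : (q <= q')%N ->
  sieve_test D m kt kr us q -> sieve_test D m kt kr us q'.
Proof.
by move=> qq /and4P[a b c d]; apply/and4P; split=> //; apply: leq_trans d qq.
Qed.

Lemma critical_leq D m q q' ls : (q <= q')%N -> critical D m q ls -> critical D m q' ls.
Proof.
by move=> qq [us [kt [kr [rb t]]]]; exists us, kt, kr; split=> //; apply: sieve_test_leq t.
Qed.

(* Adding [l] to both cores multiplies the bound on [sqrt q] by at most [a / b]. *)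
Lemma sieve_test_cons D m kt kr us n l a b :
  (2 * b * (2 * 2 ^ kt.+1).-1 <= a * (2 ^ kt.+1).-1)%N -> (4 * b <= a)%N ->
  (0 < b)%N ->
  (forall s, (a * s.+1 + 2 * b) ^ 2 <= b ^ 2 * (l * ((s + 2) ^ 2 - 1) + 1))%N ->
  sieve_test D m kt kr us n.+1 -> sieve_test D m kt.+1 kr.+1 (D :: us) (n * l).+1.
Proof.
move=> ab ab4 b0 hab /and4P[h1 h2 dh0 t].
rewrite /sieve_test /= !ltnS h1 h2 dh0 /=.
set dh := (D - _ - _)%N in dh0 t *.
have E6 : (b * sieve_excess_bound D kt.+1 kr.+1 (D :: us) <= a * sieve_excess_bound D kt kr us)%N.
  rewrite /sieve_excess_bound /=; set X := (dh + _)%N; set Y := (dh + _)%N.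
  rewrite -/dh [(2 ^ kr.+1)%N]expnS [(2 ^ kt.+2)%N]expnS.
  set c := (2 ^ kt.+1)%N in ab *.
  rewrite (mulnA b) (mulnA a) [(b * _)%N](_ : _ = 2 ^ kr * (2 * b))%N; last by ring.
  rewrite (mulnC a) -!(mulnA (2 ^ kr)%N) leq_mul2l; apply/orP; right.
  rewrite 2!(mulnDr (2 * b)%N) 2!(mulnDr a); apply: leq_add; first apply: leq_add.
  - by rewrite !mulnA leq_mul2r ab orbT.
  - by case: (drop kr us) => [|u1 v1]; rewrite ?muln0 // !mulnA leq_mul2r ab orbT.
  case: (drop kt us) => [|u1 v1]; rewrite ?muln0 // !mulnA !leq_mul2r.
  by rewrite (_ : 2 * b * 2 = 4 * b)%N ?ab4 ?orbT //; ring.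
set s := ((m * sieve_excess_bound D kt kr us) %/ dh)%N in t.
set s' := (_ %/ dh)%N.
have hs : (b * s' <= a * s.+1)%N.
  rewrite -(leq_pmul2r dh0) -mulnA; apply: (@leq_trans (b * (m * sieve_excess_bound D kt.+1 kr.+1 (D :: us)))).
    by rewrite leq_mul2l leq_divM orbT.
  apply: (@leq_trans (a * (m * sieve_excess_bound D kt kr us))).
    by rewrite mulnCA (mulnCA a) leq_mul2l E6 orbT.
  by rewrite -mulnA leq_mul2l ltnW ?orbT // ltn_ceil.
rewrite -(@leq_pmul2l (b ^ 2)) ?expn_gt0 ?b0 // -expnMn.
apply: (@leq_trans ((a * s.+1 + 2 * b) ^ 2)); first by rewrite leq_sqr mulnDr leq_add // mulnC.
apply: leq_trans (hab s) _; rewrite leq_mul2l; apply/orP; right.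
by rewrite addn1 ltnS (mulnC n) leq_mul2l leq_subLR add1n t orbT.
Qed.

(** With [c = 2 ^ kt.+1], the bound grows by at most [2 (2 c - 1) / (c - 1)], which is at most 6,
    while [sqrt q] grows by about [sqrt l]; and 37 exceeds 36. *)
Lemma sieve_test_cons37 D m kt kr us n l : (37 <= l)%N ->
  sieve_test D m kt kr us n.+1 -> sieve_test D m kt.+1 kr.+1 (D :: us) (n * l).+1.
Proof.
move=> l37 t; have c2 : (2 <= 2 ^ kt.+1)%N by rewrite expnS leq_pmulr // expn_gt0.
apply: (@sieve_test_leq _ _ _ _ _ (n * 37).+1); first by rewrite ltnS leq_mul2l l37 orbT.
apply: (sieve_test_cons (a := 6) (b := 1)) t => //; first by move: c2; lia.
move=> s; rewrite -!mulnn; move: (leqnn (s * s)); nia.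
Qed.

(** For [c >= 8] the same factor is at most [30 / 7], whose square lies between 18 and 19. *)
Lemma sieve_test_cons19 D m kt kr us n l : (2 <= kt)%N -> (19 <= l)%N ->
  sieve_test D m kt kr us n.+1 -> sieve_test D m kt.+1 kr.+1 (D :: us) (n * l).+1.
Proof.
move=> kt2 l19 t; have c8 : (8 <= 2 ^ kt.+1)%N by rewrite (@leq_exp2l 2 3).
apply: (@sieve_test_leq _ _ _ _ _ (n * 19).+1); first by rewrite ltnS leq_mul2l l19 orbT.
apply: (sieve_test_cons (a := 30) (b := 7)) t => //; first by move: c8; lia.
move=> s; rewrite -!mulnn; move: (leqnn (s * s)); nia.
Qed.

(* The least prime that can be added to both cores without checking the criterion again. *)
Definition free_prime (kt : nat) : nat := (if 2 <= kt then 19 else 37)%N.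

Lemma sieve_test_cat D m kt kr us ls es n : all (leq (free_prime kt)) es ->
  reciprocal_bounds D us ls -> sieve_test D m kt kr us n.+1 ->
  critical D m (n * \prod_(e <- es) e).+1 (es ++ ls).
Proof.
move=> hes rb t; suff [us' [kt' [kr' [_ rb' t']]]] : exists us' kt' kr',
    [/\ (kt <= kt')%N, reciprocal_bounds D us' (es ++ ls) &
     sieve_test D m kt' kr' us' (n * \prod_(e <- es) e).+1] by exists us', kt', kr'.
elim: es hes => [|e es IH] /=; first by exists us, kt, kr; rewrite big_nil muln1.
move=> /andP[he /IH[us' [kt' [kr' [ktle rb' t']]]]].
have e0 : (0 < e)%N by apply: leq_trans he; rewrite /free_prime; case: ifP.
(* The new prime goes to the front, into both cores, where no reciprocal is used; so the trivial
   bound [D] serves. *)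
exists (D :: us'), kt'.+1, kr'.+1; split; first exact: leq_trans ktle _.
  by apply/andP; split=> //; rewrite leq_pmulr.
rewrite big_cons mulnCA mulnC; move: he; rewrite /free_prime.
case: ifP => kt2 he; last exact: sieve_test_cons37.
by apply: sieve_test_cons19 => //; apply: leq_trans ktle.
Qed.

(** * The criterion in binary arithmetic, for increasing lists of unknown primes *)

Notation nat_of := N.to_nat.

Definition sumN (s : seq N) : N := foldr N.add 0%num s.

Definition pow2N (k : nat) : N := iter k N.double 1%num.

Definition sizeN {T : Type} (s : seq T) : N := foldr (fun _ => N.succ) 0%num s.

Definition scale : N := 65536%num.

Definition recipN (l : N) : N := N.succ (N.div scale l).

Definition sieve_numbersN (m : N) (kt kr : nat) (us : seq N) : N * N :=
  let ut := drop kt us in let ur := drop kr us in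
  let st := sumN ut in let sr := sumN ur in
  let dh := (scale - st - sr)%num in
  let c2 := pow2N kt.+1 in let c1 := N.pred c2 in
  let er := if ur is [::] then 0%num else (c1 * (dh + (N.pred (sizeN ur) * scale + st)))%num in
  let et := if ut is [::] then 0%num else (c2 * (dh + (N.pred (sizeN ut) * scale + sr)))%num in
  (dh, m * (pow2N kr * (c1 * dh + er + et)))%num.

(* Sizes of the two cores, and a number [s] with [s + 1 <= sqrt q] to be compared with the bound. *)
Definition config : Type := nat * nat * N.

(** A supplied [s] with [e < s * dh] replaces the quotient of [sieve_test], which avoids a division
    and a square root. *)
Definition sieve_testN (m : N) (c : config) (us : seq N) (q : N) : bool :=
  let: (kt, kr, s) := c in
  let: (dh, e) := sieve_numbersN m kt kr us in
  [&& kt <= size us, kr <= size us, N.ltb e (s * dh)%num & N.leb (N.succ s * N.succ s)%num q]%N.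

Lemma nat_of_sumN s : nat_of (sumN s) = sumn (map nat_of s).
Proof. by elim: s => //= x s IH; rewrite N2Nat.inj_add IH. Qed.

Lemma nat_of_pow2N k : nat_of (pow2N k) = (2 ^ k)%N.
Proof. by elim: k => //= k IH; rewrite N2Nat.inj_double IH expnS. Qed.

Lemma nat_of_sizeN (T : Type) (s : seq T) : nat_of (sizeN s) = size s.
Proof. by elim: s => //= x s IH; rewrite N2Nat.inj_succ IH. Qed.

Lemma nat_of_ltb x y : N.ltb x y = (nat_of x < nat_of y)%N.
Proof. by apply/idP/ssrnat.ltP => [/N.ltb_lt|] h; [lia|apply/N.ltb_lt; lia]. Qed.

Lemma nat_of_leb x y : N.leb x y = (nat_of x <= nat_of y)%N.
Proof. by apply/idP/ssrnat.leP => [/N.leb_le|] h; [lia|apply/N.leb_le; lia]. Qed.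

Lemma nat_of_eqb x y : N.eqb x y = (nat_of x == nat_of y).
Proof. by apply/idP/eqP => [/N.eqb_eq|] h; [rewrite h|apply/N.eqb_eq; lia]. Qed.

Lemma nat_of_divmod x y : y <> 0%num ->
  nat_of (N.div x y) = (nat_of x %/ nat_of y)%N /\ nat_of (N.modulo x y) = (nat_of x %% nat_of y)%N.
Proof.
move=> y0; have := N.div_mod' x y; have /(N.mod_lt x) : y <> 0%num := y0.
move: (N.div x y) (N.modulo x y) => a b ab -> .
have yp : (0 < nat_of y)%N by apply/ssrnat.ltP; lia.
rewrite N2Nat.inj_add N2Nat.inj_mul multE plusE mulnC divnMDl // modnMDl.
have h : (nat_of b < nat_of y)%N by apply/ssrnat.ltP; lia.
by rewrite divn_small // modn_small // addn0.
Qed.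

Lemma nat_of_div x y : y <> 0%num -> nat_of (N.div x y) = (nat_of x %/ nat_of y)%N.
Proof. by case/(nat_of_divmod x). Qed.

Lemma nat_of_mod x y : y <> 0%num -> nat_of (N.modulo x y) = (nat_of x %% nat_of y)%N.
Proof. by case/(nat_of_divmod x). Qed.

Lemma nat_of_neq0 x : (0 < nat_of x)%N -> x <> 0%num.
Proof. by case: x. Qed.

Definition nat_ofE := (N2Nat.inj_add, N2Nat.inj_mul, N2Nat.inj_sub, N2Nat.inj_pred,
  N2Nat.inj_succ, nat_of_sumN, nat_of_pow2N, nat_of_sizeN, plusE, multE, minusE).

Lemma recipN_bound l : (0 < nat_of l)%N -> (nat_of scale <= nat_of (recipN l) * nat_of l)%N.
Proof.
move=> l0; rewrite /recipN N2Nat.inj_succ nat_of_div; last exact: nat_of_neq0.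
by apply: ltnW; apply: ltn_ceil.
Qed.

Lemma sieve_testN_correct m kt kr s us q : sieve_testN m (kt, kr, s) us q ->
  sieve_test (nat_of scale) (nat_of m) kt kr (map nat_of us) (nat_of q).
Proof.
rewrite /sieve_testN /sieve_numbersN /sieve_test /sieve_excess_bound size_map -!map_drop.
set ut := drop kt us; set ur := drop kr us.
set dh := (scale - _ - _)%num; set c2 := pow2N kt.+1.
have Edh : nat_of dh = (nat_of scale - sumn (map nat_of ut) - sumn (map nat_of ur))%N.
  by rewrite /dh !nat_ofE.
have Ec : nat_of c2 = (2 ^ kt.+1)%N by rewrite nat_of_pow2N.
rewrite -Edh -Ec.
have E (c : N) (v v' : seq N) : nat_of
    (if v is [::] then 0%num else (c * (dh + (N.pred (sizeN v) * scale + sumN v')))%num) =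
    (if map nat_of v is [::] then 0 else nat_of c * (nat_of dh +
      ((size (map nat_of v)).-1 * nat_of scale + sumn (map nat_of v'))))%N.
  by case: v => // a v; rewrite !nat_ofE size_map.
have E' : (nat_of m * (2 ^ kr * ((nat_of c2).-1 * nat_of dh +
   (if map nat_of ur is [::] then 0 else (nat_of c2).-1 * (nat_of dh +
      ((size (map nat_of ur)).-1 * nat_of scale + sumn (map nat_of ut)))) +
   (if map nat_of ut is [::] then 0 else nat_of c2 * (nat_of dh +
      ((size (map nat_of ut)).-1 * nat_of scale + sumn (map nat_of ur)))))))%N =
  nat_of (m * (pow2N kr * (N.pred c2 * dh +
    (if ur is [::] then 0%num else N.pred c2 * (dh + (N.pred (sizeN ur) * scale + sumN ut))) +
    (if ut is [::] then 0%num else c2 * (dh + (N.pred (sizeN ut) * scale + sumN ur))))))%num.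
  by rewrite !N2Nat.inj_mul !N2Nat.inj_add !N2Nat.inj_mul !E nat_of_pow2N N2Nat.inj_pred.
rewrite E'; move: (m * _)%num => e.
move=> /and4P[-> ->]; rewrite nat_of_ltb nat_of_leb !N2Nat.inj_mul N2Nat.inj_succ !multE => es sq.
have dh0 : (0 < nat_of dh)%N by case: (nat_of dh) es => //; rewrite muln0.
rewrite dh0 -mulnn /=; apply: leq_trans sq.
have h : (nat_of e %/ nat_of dh + 2 <= (nat_of s).+1)%N by rewrite addn2 ltnS ltn_divLR.
exact: leq_mul.
Qed.

(* The numbers [u], [u + 2], and so on bound from below the primes that may still occur,
   in increasing order. From [free_prime kt] on, one more prime preserves the criterion. *)
Fixpoint cut_test (m : N) (us : seq N) (x p : N) (cfgs : seq config) : bool :=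
  if cfgs is c :: cfgs' then
    sieve_testN m c us (N.succ x) &&
    (if cfgs' is [::] then N.leb (if (2 <= c.1.1)%N then 19 else 37)%num p
     else cut_test m (rcons us (recipN p)) (x * p)%num (p + 2)%num cfgs')
  else false.

Definition critical_set m q (ls : seq nat) : Prop :=
  exists ls', perm_eq ls' ls /\ critical (nat_of scale) m q ls'.

(** Distinct odd primes differ by at least 2, which matches the bounds [p], [p + 2], and so on;
    starting the path at [p - 2] makes the first entry at least [p]. *)
Definition odd_increasing (p : nat) (es : seq nat) : bool :=
  path (fun a b => a + 2 <= b)%N (p - 2)%N es.

Lemma critical_set_perm m q ls ls' : perm_eq ls ls' -> critical_set m q ls -> critical_set m q ls'.
Proof. by move=> p [l [pl c]]; exists l; split=> //; apply: perm_trans p. Qed.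

Lemma reciprocal_bounds_rcons D us ls u l : reciprocal_bounds D us ls -> (D <= u * l)%N ->
  reciprocal_bounds D (rcons us u) (rcons ls l).
Proof.
rewrite /reciprocal_bounds; elim: us ls => [|v us IH] [|k ls] //=; first by move=> _ ->.
by move=> /andP[-> h] hu; apply: IH.
Qed.

Lemma odd_increasing_leq p es : (2 <= p)%N -> odd_increasing p es -> all (leq p) es.
Proof.
rewrite /odd_increasing => p2 /(order_path_min _) h; have {h} := h _.
have tr : transitive (fun a b : nat => (a + 2 <= b)%N) by move=> a b c; lia.
move=> /(_ tr); apply: sub_all => x; lia.
Qed.

(** Replacing the next prime by a lower bound [p] decreases the product [x] and increases the
    reciprocal, and both make the test harder. Each configuration settles one possible number of
    further primes; the last one settles all larger numbers through [free_prime]. *)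
Lemma cut_test_correct m us x p cfgs ls es n : (2 <= nat_of p)%N ->
  cut_test m us x p cfgs ->
  reciprocal_bounds (nat_of scale) (map nat_of us) ls ->
  odd_increasing (nat_of p) es -> (nat_of x * \prod_(e <- es) e <= n)%N ->
  critical_set (nat_of m) n.+1 (ls ++ es).
Proof.
elim: cfgs us x p ls es => [|[[kt kr] s] cfgs IH] us x p ls es p2 //=.
move=> /andP[/sieve_testN_correct t]; rewrite N2Nat.inj_succ in t.
have c0 : reciprocal_bounds (nat_of scale) (map nat_of us) ls ->
    critical (nat_of scale) (nat_of m) (nat_of x).+1 ls.
  by move=> rb; exists (map nat_of us), kt, kr.
case: cfgs IH => [|c cfgs] IH.
  rewrite nat_of_leb => p37 rb oi xn; exists (es ++ ls); split; first by rewrite perm_catC.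
  apply: critical_leq (sieve_test_cat _ rb t); first exact: xn.
  have := odd_increasing_leq p2 oi; apply: sub_all => e; apply: leq_trans.
  by move: p37; rewrite /free_prime; case: ifP.
case: es => [|e es] ct rb oi xn.
  rewrite cats0; exists ls; split=> //; apply: critical_leq (c0 rb).
  by move: xn; rewrite big_nil muln1.
move: oi; rewrite /odd_increasing /= => /andP[pe oi].
have pe' : (nat_of p <= e)%N by move: pe p2; lia.
rewrite -cat_rcons; apply: IH ct _ _ _.
- by rewrite !nat_ofE; lia.
- rewrite map_rcons; apply: reciprocal_bounds_rcons rb _.
  have p0 : (0 < nat_of p)%N by lia.
  by apply: leq_trans (recipN_bound p0) _; rewrite leq_mul2l pe' orbT.
- rewrite /odd_increasing !nat_ofE /=; have -> : (nat_of p + PosDef.Pos.to_nat 2 - 2 = nat_of p)%N by lia.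
  by case: es oi {xn} => //= e' es /andP[h ->]; rewrite andbT; move: h pe' ; lia.
apply: leq_trans xn; rewrite big_cons !nat_ofE mulnA leq_mul2r leq_mul2l pe' !orbT //.
Qed.

(** * The search over sets of prime divisors *)

Section PrimesLemmas.

Lemma prod_primes_leq c : (0 < c)%N -> (\prod_(l <- primes c) l <= c)%N.
Proof.
move=> c0; rewrite [leqRHS](prod_prime_decomp c0) /primes /unzip1 big_map.
rewrite big_seq [leqRHS]big_seq; apply: leq_prod => -[l e] /mem_prime_decomp[lp e0 _] /=.
by rewrite -{1}[l]expn1 leq_pexp2l // prime_gt0.
Qed.

Lemma odd_increasing_primes p c : (3 <= p)%N -> (forall l, l \in primes c -> p <= l)%N ->
  odd_increasing p (primes c).
Proof.
move=> p3 h; have := sorted_primes c.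
have : all (fun l => odd l && (p <= l)%N) (primes c).
  apply/allP => l lc; rewrite h // andbT; have := lc; rewrite mem_primes => /andP[lp _].
  by case: (even_prime lp) => // l2; have := h l lc; rewrite l2; lia.
rewrite /odd_increasing; case: (primes c) => //= l s /andP[/andP[lo pl] hs] ps.
apply/andP; split; first by lia.
elim: s l lo {pl} hs ps => //= k s IH l lo /andP[/andP[ko kp] hs] /andP[lk ps].
by rewrite IH // andbT; move: lo ko lk; lia.
Qed.

Lemma primes_split p e c : prime p -> (0 < e)%N -> (0 < c)%N -> ~~ (p %| c)%N ->
  perm_eq (primes (p ^ e * c)) (p :: primes c).
Proof.
move=> pp e0 c0 pc; apply: uniq_perm; first exact: primes_uniq.
  by rewrite /= primes_uniq andbT mem_primes pp c0.
have pe0 : (0 < p ^ e)%N by rewrite expn_gt0 prime_gt0.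
by move=> l; rewrite (primesM _ pe0 c0) primesX // primes_prime // !inE.
Qed.
End PrimesLemmas.

(* A certificate for the search over the smallest remaining prime divisor [p]: either all
   cofactors are settled at once, or [p] divides the cofactor (then its exponent is
   increased step by step, until again everything is settled at once) or it does not. *)
Inductive dtree : Type :=
  | Cut of seq config
  | Branch of dtree & dtree
  | Pow of option config & dtree & dtree
  | PowCut of seq config.

(** With [pow] false, the cofactor exceeds 1 and its primes are at least [p]. With [pow] true, [p]
    is already accounted for, its exponent may still grow, and the rest of the cofactor, perhaps 1,
    has larger primes only. *)
Fixpoint dvalid (t : dtree) (pow : bool) (m : N) (us : seq N) (x p : N) (ps : seq N) : bool :=
  if ps is p' :: ps' then
    match t with
    | Cut cfgs => ~~ pow && cut_test m (rcons us (recipN p)) (x * p)%num (p + 2)%num cfgs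
    | Branch a b => [&& ~~ pow, dvalid a true m (rcons us (recipN p)) (x * p)%num p ps
                      & dvalid b false m us x p' ps']
    | Pow leaf a b => [&& pow, if leaf is Some c then sieve_testN m c us (N.succ x) else true,
                        dvalid a false m us x p' ps' & dvalid b true m us (x * p)%num p ps]
    | PowCut cfgs => pow && cut_test m us x p' cfgs
    end
  else false.

Fixpoint dexceptions (t : dtree) (ls : seq N) (x p : N) (ps : seq N) : seq (N * seq N) :=
  if ps is p' :: ps' then
    match t with
    | Cut _ | PowCut _ => [::]
    | Branch a b => dexceptions a (rcons ls p) (x * p)%num p ps ++ dexceptions b ls x p' ps'
    | Pow leaf a b => (if leaf is Some _ then [::] else [:: (x, ls)])
        ++ dexceptions a ls x p' ps' ++ dexceptions b ls (x * p)%num p ps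
    end
  else [::].

Definition prime_gap (p q : N) : Prop := (nat_of p < nat_of q)%N /\
  forall l, prime l -> (nat_of p < l)%N -> (nat_of q <= l)%N.

Fixpoint prime_chain (p : N) (ps : seq N) : Prop :=
  if ps is q :: ps' then prime_gap p q /\ prime_chain q ps' else True.

Definition settled (m : nat) (ex : seq (N * seq N)) (n : nat) (ls : seq nat) : Prop :=
  critical_set m n.+1 ls \/
  exists2 e, e \in ex & nat_of e.1 = n /\ perm_eq (map nat_of e.2) ls.

Lemma settled_sub m ex ex' n ls : {subset ex <= ex'} -> settled m ex n ls -> settled m ex' n ls.
Proof. by move=> sub [c|[e ee h]]; [left|right; exists e => //; apply: sub]. Qed.

Lemma settled_perm m ex n ls ls' : perm_eq ls ls' -> settled m ex n ls -> settled m ex n ls'.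
Proof.
move=> pl [c|[e ee [en pe]]]; [left; exact: critical_set_perm c|right].
by exists e => //; split=> //; apply: perm_trans pl.
Qed.

(** The two modes share one induction because [Branch] passes from the first to the second and [Pow]
    back. In power mode [e] counts further factors [p], and [e = 0] leads on to the next prime. *)
Lemma dvalid_correct t m us ls x p ps : (2 <= nat_of p)%N -> prime_chain p ps ->
  reciprocal_bounds (nat_of scale) (map nat_of us) (map nat_of ls) ->
  (dvalid t false m us x p ps -> (3 <= nat_of p)%N -> forall c, (1 < c)%N ->
    (forall l, l \in primes c -> nat_of p <= l)%N ->
    settled (nat_of m) (dexceptions t ls x p ps) (nat_of x * c) (map nat_of ls ++ primes c)) /\
  (dvalid t true m us x p ps -> forall e c, (0 < c)%N ->
    (forall l, l \in primes c -> nat_of p < l)%N ->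
    settled (nat_of m) (dexceptions t ls x p ps) (nat_of x * (nat_of p ^ e * c)) (map nat_of ls ++ primes c)).
Proof.
elim: t m us ls x p ps => [cfgs|a IHa b IHb|leaf a IHa b IHb|cfgs] m us ls x p [|p' ps] p2 //= [[pp' gap] ch] rb;
  split=> //.
- move=> ct p3 c c1 hc; left; have c0 := ltnW c1.
  have : primes c != [::] by rewrite primes_eq0; lia.
  case E : (primes c) => [|e es] // _; rewrite -cat_rcons.
  have := odd_increasing_primes p3 hc; rewrite E /odd_increasing /= => /andP[pe oi].
  have pe' : (nat_of p <= e)%N by apply: hc; rewrite E inE eqxx.
  apply: (cut_test_correct _ ct).
  + by rewrite !nat_ofE; lia.
  + rewrite map_rcons; apply: reciprocal_bounds_rcons rb _.
    have p0 : (0 < nat_of p)%N by lia.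
    by apply: leq_trans (recipN_bound p0) _; rewrite leq_mul2l pe' orbT.
  + rewrite /odd_increasing !nat_ofE /=; have -> : (nat_of p + PosDef.Pos.to_nat 2 - 2 = nat_of p)%N by lia.
    by case: (es) oi => //= e' es' /andP[h ->]; rewrite andbT; move: h pe'; lia.
  rewrite !nat_ofE -mulnA leq_mul2l; apply/orP; right.
  apply: leq_trans (prod_primes_leq c0); rewrite E big_cons leq_mul2r pe' orbT //.
- move=> /andP[da db] p3 c c1 hc; have c0 := ltnW c1.
  case: (boolP (nat_of p %| c)%N) => pc; last first.
    apply: settled_sub (_ : settled _ (dexceptions b ls x p' ps) _ _) => [e he|].
      by rewrite mem_cat he orbT.
    have [h _] := IHb m us ls x p' ps (leq_trans p2 (ltnW pp')) ch rb.
    apply: h => //; first by apply: leq_trans p3 (ltnW pp').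
    move=> l lc; have := lc; rewrite mem_primes => /and3P[lp _ ld].
    apply: gap => //; rewrite ltn_neqAle hc // andbT.
    by apply: contraNneq pc => ->.
  (* The least prime factor of [p] divides [c], so by hypothesis it is at least [p]. *)
  have pr : prime (nat_of p).
    have := pdiv_prime (_ : 1 < nat_of p)%N => /(_ p2) lp.
    have : (nat_of p <= pdiv (nat_of p))%N.
      by apply: hc; rewrite mem_primes lp c0 (dvdn_trans (pdiv_dvd _)).
    move=> h; suff -> : nat_of p = pdiv (nat_of p) by [].
    by apply/eqP; rewrite eqn_leq h pdiv_leq // ltnW.
  pose e := logn (nat_of p) c; pose c' := (c %/ nat_of p ^ e)%N.
  have ed : (nat_of p ^ e %| c)%N by apply: pfactor_dvdnn.
  have ec : c = (nat_of p ^ e * c')%N by rewrite mulnC divnK.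
  have e0 : (0 < e)%N by rewrite logn_gt0 mem_primes pr c0.
  have c'0 : (0 < c')%N by rewrite divn_gt0 ?expn_gt0 ?prime_gt0 // dvdn_leq.
  have npc' : ~~ (nat_of p %| c')%N.
    apply/negP => h; have : (nat_of p ^ e.+1 %| c)%N by rewrite ec expnSr dvdn_mul.
    by rewrite pfactor_dvdn // ltnn.
  have pl := primes_split pr e0 c'0 npc'; rewrite -ec in pl.
  have rb' : reciprocal_bounds (nat_of scale) (map nat_of (rcons us (recipN p))) (map nat_of (rcons ls p)).
    by rewrite !map_rcons; apply: reciprocal_bounds_rcons rb _; apply: recipN_bound; lia.
  have [_ h] := IHa m (rcons us (recipN p)) (rcons ls p) (x * p)%num p (p' :: ps) p2 (conj (conj pp' gap) ch) rb'.
  have {}h := h da e.-1 c' c'0.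
  have hl l : l \in primes c' -> (nat_of p < l)%N.
    move=> lc'; have lc : l \in primes c by rewrite (perm_mem pl) inE lc' orbT.
    rewrite ltn_neqAle hc // andbT; apply: contraNneq npc' => ->.
    by move: lc'; rewrite mem_primes => /and3P[].
  have {}h := h hl.
  have -> : (nat_of x * c = nat_of (x * p) * (nat_of p ^ e.-1 * c'))%N.
    by rewrite !nat_ofE ec -{1}(prednK e0) expnS; ring.
  apply: (settled_sub (ex := dexceptions a (rcons ls p) (x * p)%num p (p' :: ps))).
    by move=> y hy; rewrite mem_cat hy.
  apply: settled_perm h; rewrite map_rcons cat_rcons perm_cat2l perm_sym.
  exact: pl.
- move=> /and3P[lf da db] e c c0 hc; case: e => [|e]; last first.
    have [_ h] := IHb m us ls (x * p)%num p (p' :: ps) p2 (conj (conj pp' gap) ch) rb.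
    have {}h := h db e c c0 hc.
    have -> : (nat_of x * (nat_of p ^ e.+1 * c) = nat_of (x * p) * (nat_of p ^ e * c))%N.
      by rewrite !nat_ofE expnS; ring.
    by apply: settled_sub h => y hy; rewrite !mem_cat hy !orbT.
  rewrite expn0 mul1n; have [c1|c1] := leqP c 1.
    have -> : c = 1%N by lia.
    rewrite muln1 cats0; case: leaf lf => [[[kt kr] s]|_]; last first.
      by right; exists (x, ls); rewrite ?mem_head.
    move=> /sieve_testN_correct t; left; exists (map nat_of ls); split=> //.
    by exists (map nat_of us), kt, kr; split=> //; move: t; rewrite N2Nat.inj_succ.
  have [h _] := IHa m us ls x p' ps (leq_trans p2 (ltnW pp')) ch rb.
  have {}h := h da (leq_ltn_trans p2 pp') c c1.
  apply: settled_sub (h _) => [y hy|l lc]; first by rewrite !mem_cat hy !orbT.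
  by apply: gap; [move: lc; rewrite mem_primes => /and3P[]|apply: hc].
move=> ct e c c0 hc; left; apply: (cut_test_correct _ ct) => //.
- exact: leq_trans p2 (ltnW pp').
- apply: odd_increasing_primes; first exact: leq_ltn_trans p2 pp'.
  by move=> l lc; apply: gap; [move: lc; rewrite mem_primes => /and3P[]|apply: hc].
rewrite leq_mul2l; apply/orP; right; apply: leq_trans (prod_primes_leq c0) _.
by rewrite leq_pmull // expn_gt0; lia.
Qed.

(** Untrusted search, rechecked by [dvalid]. Values [kt >= 2] are tried first because they lower the
    free prime from 37 to 19. *)
Definition find_config (m : N) (us : seq N) (q : N) : option config :=
  let k := size us in let s := N.pred (N.sqrt q) in
  ohead [seq c <- flatten [seq [seq (kt, kr, s) | kr <- iota kt (minn 3 (k.+1 - kt))]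
                          | kt <- iota 2 k.-1 ++ iota 0 (minn 2 k.+1)]
        | sieve_testN m c us q].

Fixpoint find_cut (fuel : nat) (m : N) (us : seq N) (x p : N) : option (seq config) :=
  if fuel is f.+1 then
    if find_config m us (N.succ x) is Some c then
      if N.leb (if (2 <= c.1.1)%N then 19 else 37)%num p then Some [:: c]
      else omap (cons c) (find_cut f m (rcons us (recipN p)) (x * p)%num (p + 2)%num)
    else None
  else None.

Fixpoint build_dtree (fuel : nat) (pow : bool) (m : N) (us : seq N) (x p : N) (ps : seq N) : dtree :=
  if fuel is f.+1 then
    if ps is p' :: ps' then
      if pow then
        if find_cut 40 m us x p' is Some cfgs then PowCut cfgs
        else Pow (find_config m us (N.succ x)) (build_dtree f false m us x p' ps')
                 (build_dtree f true m us (x * p)%num p ps)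
      else
        if find_cut 40 m (rcons us (recipN p)) (x * p)%num (p + 2)%num is Some cfgs then Cut cfgs
        else Branch (build_dtree f true m (rcons us (recipN p)) (x * p)%num p ps)
                    (build_dtree f false m us x p' ps')
    else Cut [::]
  else Cut [::].

Definition sieve_step (l : N) (s : seq N) : seq N :=
  if all (fun d => ~~ N.eqb (N.modulo l d) 0%num) (take 25 s) then rcons s l else s.

(** Candidates run up to 3401, so trial division by 25 odd primes, reaching 101, is ample. *)
Definition odd_primes : seq N := Eval vm_compute in
  iteri 1700 (fun i s => sieve_step (N.of_nat (2 * i + 3)) s) [::].

Definition gap_test (p q : N) : bool :=
  N.ltb p q && all (fun k => let l := (p + N.of_nat k)%num in
    has (fun r => N.ltb r l && N.eqb (N.modulo l r) 0%num) (2%num :: take 20 odd_primes))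
  (iota 1 (nat_of (q - p)%num).-1).

Lemma gap_test_correct p q : gap_test p q -> prime_gap p q.
Proof.
move=> /andP[pq /allP h]; rewrite nat_of_ltb in pq; split=> // l lp pl.
rewrite leqNgt; apply/negP => lq.
have kin : (l - nat_of p)%N \in iota 1 (nat_of (q - p)%num).-1.
  by rewrite mem_iota !nat_ofE; lia.
have /hasP[r rs] := h _ kin; rewrite nat_of_ltb nat_of_eqb.
have -> : nat_of (p + N.of_nat (l - nat_of p))%num = l.
  by rewrite !nat_ofE Nat2N.id subnKC // ltnW.
have r1 : (1 < nat_of r)%N.
  have : all (fun r => 1 < nat_of r)%N (2%num :: take 20 odd_primes) by vm_compute.
  by move/allP; apply.
have eql : nat_of (p + N.of_nat (l - nat_of p))%num = l.
  by rewrite !nat_ofE Nat2N.id subnKC // ltnW.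
rewrite nat_of_mod ?eql; last by apply: nat_of_neq0; apply: ltnW.
move=> /andP[rl rd]; have /primeP[_ /(_ _ rd)] := lp.
by rewrite gtn_eqF // ltn_eqF.
Qed.

Fixpoint chain_test (p : N) (ps : seq N) : bool :=
  if ps is q :: ps' then gap_test p q && chain_test q ps' else true.

Lemma chain_test_correct p ps : chain_test p ps -> prime_chain p ps.
Proof. by elim: ps p => //= q ps IH p /andP[/gap_test_correct g /IH c]. Qed.

Lemma odd_primes_chain : prime_chain 2%num odd_primes.
Proof. by apply: chain_test_correct; vm_cast_no_check (erefl true). Qed.

(** The three roots follow [two_part]: [n = 4 * 2^e * c] in power mode with 2 as current prime, then
    [n = 2 c] and [n = c], with [c] odd. The prime 2 stays out of [us]: its conditions sit in the
    factor [m] and in the quadratic twist. *)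
Definition dtree4 := Eval vm_compute in build_dtree 2000 true 4 [::] 4 2 odd_primes.
Definition dtree2 := Eval vm_compute in build_dtree 2000 false 2 [::] 2 3 (behead odd_primes).
Definition dtree1 := Eval vm_compute in build_dtree 2000 false 1 [::] 1 3 (behead odd_primes).

Lemma dtree4_valid : dvalid dtree4 true 4 [::] 4 2 odd_primes.
Proof. vm_cast_no_check (erefl true). Qed.

Lemma dtree2_valid : dvalid dtree2 false 2 [::] 2 3 (behead odd_primes).
Proof. vm_cast_no_check (erefl true). Qed.

Lemma dtree1_valid : dvalid dtree1 false 1 [::] 1 3 (behead odd_primes).
Proof. vm_cast_no_check (erefl true). Qed.

Definition exceptions : seq (N * seq N) := Eval vm_compute in
  dexceptions dtree4 [::] 4 2 odd_primes ++ dexceptions dtree2 [::] 2 3 (behead odd_primes)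
  ++ dexceptions dtree1 [::] 1 3 (behead odd_primes).

Lemma exceptionsE : exceptions =
  dexceptions dtree4 [::] 4 2 odd_primes ++ dexceptions dtree2 [::] 2 3 (behead odd_primes)
  ++ dexceptions dtree1 [::] 1 3 (behead odd_primes).
Proof. vm_cast_no_check (erefl exceptions). Qed.

Lemma sub_exceptions : [/\ {subset dexceptions dtree4 [::] 4 2 odd_primes <= exceptions},
  {subset dexceptions dtree2 [::] 2 3 (behead odd_primes) <= exceptions} &
  {subset dexceptions dtree1 [::] 1 3 (behead odd_primes) <= exceptions}].
Proof.
rewrite exceptionsE; move: (dexceptions dtree4 _ _ _ _) (dexceptions dtree2 _ _ _ _).
move: (dexceptions dtree1 _ _ _ _) => a b c.
by split=> x hx; rewrite !mem_cat hx ?orbT.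
Qed.

Definition odd_primes_of (n : nat) (ls : seq nat) : Prop :=
  uniq ls /\ forall l, (l \in ls) = odd_prime_divisor n l.

Lemma odd_primes_of_primes x c : (0 < c)%N -> odd c -> (forall l, prime l -> odd l -> ~~ (l %| x)%N) ->
  odd_primes_of (x * c) (primes c).
Proof.
move=> c0 co hx; split; first exact: primes_uniq.
move=> l; rewrite mem_primes c0 /= /odd_prime_divisor; case: (boolP (prime l)) => //= lp.
case: (boolP (odd l)) => /= lo; last first.
  by apply/negbTE; apply: contraNN lo => /dvdn_odd; apply.
by rewrite Euclid_dvdM // (negbTE (hx l lp lo)).
Qed.

Lemma sieve_complete (F : finFieldType) : (3 < #|F|)%N -> T_prop F \/
  exists2 e, e \in exceptions & nat_of e.1 = #|F|.-1 /\ odd_primes_of #|F|.-1 (map nat_of e.2).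
Proof.
move=> F3; set n := #|F|.-1; have Fn : #|F| = n.+1 by rewrite /n prednK // (ltn_trans _ F3).
suff [ls [lsP st]] : exists ls, odd_primes_of n ls /\ settled (two_part F) exceptions n ls.
  case: st => [[ls' [pl [us [kt [kr [rb t]]]]]]|[e ee [en pe]]]; [left|right].
    apply: (sieve_test_T (D := nat_of scale) (ls := ls') (us := us) (kt := kt) (kr := kr)) => //.
    - by rewrite (perm_uniq pl); case: lsP.
    - by move=> l; rewrite (perm_mem pl); case: lsP.
    - by rewrite Fn.
  exists e => //; split=> //; split; first by rewrite (perm_uniq pe); case: lsP.
  by move=> l; rewrite (perm_mem pe); case: lsP.
have n3 : (2 < n)%N by rewrite -ltnS -Fn.
have rb0 : reciprocal_bounds (nat_of scale) (map nat_of [::]) (map nat_of [::]) by [].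
have tl : prime_chain 3%num (behead odd_primes) by case: odd_primes_chain.
have [sub4 sub2 sub1] := sub_exceptions.
have odd3 c l : odd c -> l \in primes c -> (3 <= l)%N.
  move=> co; rewrite mem_primes => /and3P[lp _ ld].
  have := prime_gt1 lp; have := dvdn_odd ld co; lia.
rewrite /two_part -/n; case: (boolP (odd n)) => [no|ne].
  exists (primes n); split.
    have := @odd_primes_of_primes 1 n (ltnW (ltnW n3)) no; rewrite mul1n; apply.
    by move=> l lp _; rewrite dvdn1; have := prime_gt1 lp; lia.
  have [h _] := @dvalid_correct dtree1 1%num [::] [::] 1%num 3%num (behead odd_primes) isT tl rb0.
  have := h dtree1_valid isT n (ltnW n3) (odd3 n ^~ no); rewrite mul1n; exact: (settled_sub sub1).
have n0 : (0 < n)%N by rewrite ltnW // ltnW.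
pose c := (n %/ 2 ^ logn 2 n)%N; have nc : n = (2 ^ logn 2 n * c)%N by rewrite mulnC divnK // pfactor_dvdnn.
have c0 : (0 < c)%N by rewrite divn_gt0 ?expn_gt0 // dvdn_leq // pfactor_dvdnn.
have co : odd c.
  rewrite -dvdn2 || idtac; apply/negPn/negP => ce; have : (2 ^ (logn 2 n).+1 %| n)%N.
    by rewrite [X in (_ %| X)%N]nc expnSr dvdn_mul // dvdn2.
  by rewrite pfactor_dvdn // ltnn.
have e0 : (0 < logn 2 n)%N by rewrite logn_gt0 mem_primes n0 dvdn2.
have lsP : odd_primes_of n (primes c).
  rewrite nc; apply: odd_primes_of_primes => // l lp lo.
  by rewrite Euclid_dvdX // e0 andbT dvdn_prime2 //; apply: contraTN lo => /eqP ->.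
exists (primes c); split=> //; case: ifPn => n4.
  have e2 : (1 < logn 2 n)%N by rewrite -(pfactor_dvdn 2 _ n0).
  have [_ h] := @dvalid_correct dtree4 4%num [::] [::] 4%num 2%num odd_primes isT odd_primes_chain rb0.
  have {}h := h dtree4_valid (logn 2 n - 2)%N c c0 (odd3 c ^~ co).
  have e : (nat_of 4 * (nat_of 2 ^ (logn 2 n - 2) * c) = n)%N.
    by rewrite mulnA -[nat_of 4]/(2 ^ 2)%N -[nat_of 2]/2%N -expnD subnKC // -nc.
  by rewrite e in h; exact: (settled_sub sub4 h).
have e1 : logn 2 n = 1%N.
  by apply/eqP; rewrite eqn_leq e0 andbT leqNgt -(pfactor_dvdn 2 _ n0).
have n2 : n = (2 * c)%N by rewrite nc e1.
have c1 : (1 < c)%N by move: n3; rewrite n2; lia.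
have [h _] := @dvalid_correct dtree2 2%num [::] [::] 2%num 3%num (behead odd_primes) isT tl rb0.
have {}h := h dtree2_valid isT c c1 (odd3 c ^~ co).
by rewrite -[(nat_of 2 * c)%N]n2 in h; exact: (settled_sub sub2 h).
Qed.

(** * Field arithmetic on coefficient lists *)

(* Elements of [Z/p [X] / (X^k - f)], as coefficient lists. *)
Definition reduceP (p s : N) : N :=
  match s, p with
  | N.pos s', N.pos p' =>
      match Pos.sub_mask s' p' with
      | Pos.IsNul => 0%num
      | Pos.IsPos d => N.pos d
      | Pos.IsNeg => s
      end
  | _, _ => s
  end.

Definition addP (p a b : N) : N := reduceP p (a + b)%num.

(** The bits are read from the top: twice a remainder, plus a bit, is below [2 p], so one
    subtraction reduces it. *)
Fixpoint modP (p : N) (a : positive) : N :=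
  match a with
  | xH => 1%num
  | xO a' => reduceP p (N.double (modP p a'))
  | xI a' => reduceP p (N.succ_double (modP p a'))
  end.

Definition mulP (p a b : N) : N := if (a * b)%num is N.pos s then modP p s else 0%num.

Lemma reduceP_cases p s : reduceP p s = s /\ (N.pos 1 <= p -> s < p)%num \/
  (p <= s)%num /\ reduceP p s = (s - p)%num.
Proof.
case: s => [|s]; first by left; split=> //; lia.
case: p => [|p]; first by left; split=> //; lia.
rewrite /reduceP; case: (Pos.sub_mask_spec s p) => [e|r e|r e].
- by right; split; lia.
- by right; split; lia.
by left; split=> // _; lia.
Qed.

Fixpoint addL (p : N) (a b : seq N) : seq N :=
  match a, b with
  | x :: a', y :: b' => addP p x y :: addL p a' b'
  | [::], _ => b
  | _, [::] => a
  end.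

Definition shiftL (p : N) (f v : seq N) : seq N :=
  if v is [::] then [::]
  else if eqn (size v) (size f)
       then addL p (0%num :: take (size f).-1 v) (map (mulP p (last 0%num v)) f)
       else 0%num :: v.

Definition mulL (p : N) (f a b : seq N) : seq N :=
  foldr (fun x r => addL p (map (mulP p x) b) (shiftL p f r)) [::] a.

Fixpoint powL (p : N) (f a : seq N) (e : positive) : seq N :=
  match e with
  | xH => a
  | xO e' => let y := powL p f a e' in mulL p f y y
  | xI e' => let y := powL p f a e' in mulL p f a (mulL p f y y)
  end.

Fixpoint eqL (a b : seq N) : bool :=
  match a, b with
  | [::], [::] => true
  | x :: a', y :: b' => N.eqb x y && eqL a' b'
  | _, _ => false
  end.

Lemma eqLP a b : eqL a b -> a = b.
Proof. by elim: a b => [|x a IH] [|y b] //= /andP[/N.eqb_eq -> /IH ->]. Qed.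

Section Evaluation.
Variables (A : comNzRingType) (p : N) (f : seq N) (th : A).
Hypothesis charp : (nat_of p)%:R = 0 :> A.

(** Evaluation respects all list operations, so an identity checked on lists holds in every ring
    that has the right characteristic and a root [th] of [X^k - f]. *)
Definition evalL (l : seq N) : A := foldr (fun a r => (nat_of a)%:R + th * r) 0 l.

Hypothesis hf : th ^+ size f = evalL f.

Lemma natr_reduceP s : (nat_of (reduceP p s))%:R = (nat_of s)%:R :> A.
Proof.
case: (reduceP_cases p s) => [[-> _] //|[ps ->]].
have h : (nat_of p <= nat_of s)%N by rewrite -nat_of_leb; apply/N.leb_le.
by rewrite !nat_ofE natrB // charp subr0.
Qed.

Lemma natr_addP a b : (nat_of (addP p a b))%:R = (nat_of a)%:R + (nat_of b)%:R :> A.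
Proof. by rewrite /addP natr_reduceP !nat_ofE natrD. Qed.

Lemma natr_modP a : (nat_of (modP p a))%:R = (Pos.to_nat a)%:R :> A.
Proof.
elim: a => [a IH|a IH|] //=; rewrite natr_reduceP ?N2Nat.inj_succ_double ?N2Nat.inj_double.
  by rewrite Pos2Nat.inj_xI -!natr1 !multE !natrM IH.
by rewrite Pos2Nat.inj_xO !multE !natrM IH.
Qed.

Lemma natr_mulP a b : (nat_of (mulP p a b))%:R = (nat_of a)%:R * (nat_of b)%:R :> A.
Proof.
rewrite /mulP -natrM -multE -N2Nat.inj_mul; case: (a * b)%num => [|s] //.
by rewrite natr_modP.
Qed.

Lemma evalL_add a b : evalL (addL p a b) = evalL a + evalL b.
Proof.
elim: a b => [|x a IH] [|y b] /=; rewrite ?addr0 ?add0r //.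
by rewrite natr_addP IH; ring.
Qed.

Lemma evalL_scale x b : evalL (map (mulP p x) b) = (nat_of x)%:R * evalL b.
Proof. by elim: b => [|y b IH] /=; rewrite ?mulr0 // natr_mulP IH; ring. Qed.

Lemma evalL_rcons v x : evalL (rcons v x) = evalL v + th ^+ size v * (nat_of x)%:R.
Proof.
elim: v => [|y v IH] /=; first by rewrite mulr0 addr0 add0r expr0 mul1r.
by rewrite IH exprS; ring.
Qed.

Lemma evalL_shift v : evalL (shiftL p f v) = th * evalL v.
Proof.
case/lastP: v => [|v x]; first by rewrite mulr0.
rewrite /shiftL; have -> (T : Type) (a b : T) : (if rcons v x is [::] then a else b) = b by case: v.
rewrite size_rcons eqnE; case: eqP => [e|_]; last by rewrite /= add0r.
rewrite evalL_add evalL_scale last_rcons -e /= -cats1 take_size_cat // cats1 evalL_rcons.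
by rewrite add0r -hf -e exprS; ring.
Qed.

Lemma evalL_mul a b : evalL (mulL p f a b) = evalL a * evalL b.
Proof.
elim: a => [|x a IH] /=; first by rewrite mul0r.
by rewrite evalL_add evalL_scale evalL_shift -/(mulL p f a b) IH; ring.
Qed.

Lemma evalL_pow a e : evalL (powL p f a e) = evalL a ^+ Pos.to_nat e.
Proof.
elim: e => [e IH|e IH|] /=.
- by rewrite !evalL_mul IH Pos2Nat.inj_xI -exprD -exprS; congr (_ ^+ _); lia.
- by rewrite !evalL_mul IH Pos2Nat.inj_xO -exprD; congr (_ ^+ _); lia.
by rewrite Pos2Nat.inj_1 expr1.
Qed.
End Evaluation.

Definition one_list (k : nat) : seq N := 1%num :: nseq k.-1 0%num.

Definition X_list (k : nat) : seq N := 0%num :: 1%num :: nseq k.-2 0%num.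

Lemma evalL_nseq0 (A : comNzRingType) (th : A) k : evalL th (nseq k 0%num) = 0.
Proof. by elim: k => //= k ->; rewrite mulr0 addr0. Qed.

(* Over [F], the polynomial [X^k - f] divides [X^n - 1], hence splits. *)
Lemma exists_root (F : finFieldType) (p : N) (f : seq N) (e : positive) :
  (nat_of p)%:R = 0 :> F -> (1 < size f)%N -> Pos.to_nat e = #|F|.-1 ->
  eqL (powL p f (X_list (size f)) e) (one_list (size f)) ->
  exists th : F, th ^+ size f = evalL th f.
Proof.
move=> charp k1 en /eqLP h.
pose fp : {poly F} := 'X^(size f) - evalL 'X f.
have sf : (size (evalL 'X f : {poly F}) <= size f)%N.
  elim: {k1 h fp} f => [|a f IH] /=; first by rewrite size_poly0.
  apply: leq_trans (size_polyD _ _) _; rewrite geq_max -polyC_natr (leq_trans (size_polyC_leq1 _)) //=.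
  rewrite mulrC; apply: leq_trans (size_polyMleq _ _) _.
  by rewrite size_polyX addn2 /= ltnS.
have sfp : size fp = (size f).+1 by rewrite /fp size_polyDl ?size_polyXn // size_polyN ltnS.
have mfp : fp \is monic.
  by rewrite monicE lead_coefE sfp /= /fp coefB coefXn eqxx nth_default ?subr0.
(* In the quotient of [F[X]] by [X^k - f], with [th] the class of [X], the computed power says that
   [X^k - f] divides [X^n - 1]. *)
pose A : comNzRingType := {poly %/ fp}; pose th : A := in_qpoly fp 'X.
have evm l : in_qpoly fp (evalL 'X l) = evalL th l :> A.
  by elim: l => [|a l IH] /=; rewrite ?rmorph0 // rmorphD rmorphM rmorph_nat /= IH.
have charA : (nat_of p)%:R = 0 :> A.
  by rewrite -(rmorph_nat (in_qpoly fp)) -(rmorph_nat (polyC : {rmorphism F -> {poly F}})) charp !rmorph0.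
have mkE : mk_monic fp = fp by rewrite /mk_monic sfp mfp ltnS (ltnW k1).
have in0 x : in_qpoly fp x = 0 :> A <-> (fp %| x)%R.
  split=> [/(congr1 val) /=|]; rewrite ?mkE.
    by rewrite -Pdiv.IdomainMonic.modpE // => e0; apply/modp_eq0P.
  by move/modp_eq0P => e0; apply: val_inj; rewrite /= mkE -Pdiv.IdomainMonic.modpE.
have hfA : th ^+ size f = evalL th f.
  apply/eqP; rewrite -subr_eq0 -evm -rmorphXn -rmorphB; apply/eqP/in0.
  exact: dvdpp.
have := evalL_pow charA hfA (X_list (size f)) e; rewrite h en.
have -> : evalL th (X_list (size f)) = th by rewrite /= evalL_nseq0 mulr0 addr0 add0r mulr1.
rewrite /= evalL_nseq0 mulr0 addr0 => /esym/eqP; rewrite -rmorphXn -(rmorph1 (in_qpoly fp)) -subr_eq0 -rmorphB.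
move=> /eqP/in0 dv.
have q0 : (0 < #|F|)%N by rewrite (ltn_trans _ (finNzRing_gt1 F)).
(* [X (X^n - 1)] is the product of all [X - x] with [x] in [F], so a nonconstant divisor has a root
   in [F]. *)
have : fp %| \prod_(x : F) ('X - x%:P).
  rewrite -finField_genPoly -(prednK q0) exprS.
  rewrite (_ : _ - _ = 'X * ('X^(#|F|.-1) - 1)); last by rewrite mulrBr mulr1.
  exact: dvdp_mull.
move=> /dvdp_prod_XsubC[m]; case: (mask m _) => [|x s] feq.
  by move: (eqp_size feq); rewrite sfp big_nil size_poly1; move: k1; case: (size f).
exists x; apply/eqP; rewrite -subr_eq0.
have : root fp x.
  by rewrite -dvdp_XsubCl (eqp_dvdr _ feq) big_cons dvdp_mulr.
have -> : evalL x f = (evalL 'X f).[x].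
  by elim: (f) => [|a l IH] /=; rewrite ?horner0 // -polyC_natr hornerD hornerC hornerM hornerX IH.
by rewrite /root /fp hornerD hornerN hornerXn.
Qed.

(** * Certificates: tables of logarithms and trees of points *)

Inductive trie (T : Type) : Type :=
  | TLeaf
  | TNode of option T & trie T & trie T.
Arguments TLeaf {T}.

Fixpoint tget (T : Type) (k : positive) (t : trie T) {struct t} : option T :=
  if t is TNode o l r then
    match k with xH => o | xO k' => tget k' l | xI k' => tget k' r end
  else None.

Fixpoint tput (T : Type) (k : positive) (e : T) (t : trie T) : trie T :=
  match k with
  | xH => if t is TNode _ l r then TNode (Some e) l r else TNode (Some e) TLeaf TLeaf
  | xO k' => if t is TNode o l r then TNode o (tput k' e l) r else TNode None (tput k' e TLeaf) TLeaf
  | xI k' => if t is TNode o l r then TNode o l (tput k' e r) else TNode None TLeaf (tput k' e TLeaf)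
  end.

Lemma tget_put (T : Type) k (e : T) t k' x : tget k' (tput k e t) = Some x -> x = e \/ tget k' t = Some x.
Proof.
elim: k t k' => [k IH|k IH|] [|o l r] [k'|k'|] //=; try (by auto);
  try (by case=> ->; left); by move=> /IH[->|//]; auto.
Qed.

(* A value, its logarithm [k] modulo [b] (4, 2 or 1), and the residues of [k], [- k], [- 2 k]
   modulo the odd primes. *)
Record entry : Type := Entry {
  e_val : seq N; e_two : N; e_log : seq N; e_opp : seq N; e_opp2 : seq N }.

Definition table : Type := trie entry.

Fixpoint addV (ms a b : seq N) : seq N :=
  match ms, a, b with
  | m :: ms', x :: a', y :: b' => addP m x y :: addV ms' a' b'
  | _, _, _ => [::]
  end.

Definition oppP (m x : N) : N := if x is 0%num then 0%num else (m - x)%num.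

Fixpoint oppV (ms a : seq N) : seq N :=
  match ms, a with
  | m :: ms', x :: a' => oppP m x :: oppV ms' a'
  | _, _ => [::]
  end.

(* A step adds to the table an element [v] with its logarithms, justified by an integral relation
   [v * \prod den = c * p + \prod num] or [v * \prod den + \prod num = c * p], by a relation [v * \prod den = \prod num], or by an
   explicit power of the generator. *)
Inductive step : Type :=
  | IRel of positive & seq positive & seq positive & N
  | Rel of positive & seq N & seq positive & seq positive
  | Exp of positive & seq N & positive.

(* A solution of [a + b = c], of [a = b + c] or of [b = a + c] in the table; the Zech point
   is [(a/c, b/c)], [(a/c, -b/c)] or [(-a/c, b/c)]. *)
Inductive point : Type :=
  | PSum of positive & positive & positive
  | PNegJ of positive & positive & positive
  | PNegI of positive & positive & positive.

(* In a leaf, a value of [i + j] or [i - j] modulo one of the remaining primes excludes few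
   points, possibly after an enumeration of the values modulo the first primes; in a node, three sets of points lie in disjoint classes both for [i + j] and for
   [i - j], so that one of them is entirely suitable. *)
Inductive ptree : Type :=
  | PLeaf of nat & seq point
  | PNode of nat & ptree & ptree & ptree.

Record cert : Type := Cert {
  c_char : N; c_red : seq N; c_gen : seq N; c_inv : seq (seq N);
  c_steps : seq step; c_trees : seq ptree }.

Definition block (b : N * N) (v : N) : nat :=
  if N.ltb v b.1 then 0%N else if N.ltb v b.2 then 1%N else 2%N.

Fixpoint satisfies (bs : seq (N * N)) (cs : seq (nat * nat)) (tv rv : seq N) : option (seq N * seq N) :=
  if cs is (ct, cr) :: cs' then
    match bs, tv, rv with
    | b :: bs', t :: tv', r :: rv' =>
        if eqn (block b t) ct && eqn (block b r) cr then satisfies bs' cs' tv' rv' else None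
    | _, _, _ => None
    end
  else Some (tv, rv).

Fixpoint mult (x : N) (s : seq N) : nat :=
  if s is y :: s' then if N.eqb x y then (mult x s').+1 else mult x s' else 0%N.

Fixpoint maxmult (s : seq N) : nat := if s is x :: s' then maxn (mult x s').+1 (maxmult s') else 0%N.

(** A coordinate of a target meets at most as many vectors as the most frequent value there; the sum
    bounds how many vectors any target can meet. *)
Fixpoint loss (k : nat) (vs : seq (seq N)) : nat :=
  if k is k'.+1 then (maxmult (map (head 0%num) vs) + loss k' (map behead vs))%N else 0%N.

Fixpoint hit (v targets : seq N) : bool :=
  if targets is x :: targets' then N.eqb x (head 0%num v) || hit (behead v) targets' else false.

(** [vs] pairs the residues of [i + j] with those of [i - j]. If the two losses together stay below
    the number of points, every pair of targets spares a point. Otherwise the first coordinates of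
    the targets are enumerated and the points they spoil are discarded, up to depth [d]. *)
Fixpoint cover (d : nat) (rs : seq N) (vs : seq (seq N * seq N)) : bool :=
  (loss (size rs) (map fst vs) + loss (size rs) (map snd vs) < size vs)%N ||
  (if d is d'.+1 then
     if rs is l :: rs' then
       let values := [seq N.of_nat x | x <- iota 0 (nat_of l)] in
       all (fun x =>
         let vs' := [seq v <- vs | ~~ N.eqb x (head 0%num v.1)] in
         all (fun y => cover d' rs' [seq (behead v.1, behead v.2) | v <- vs' & ~~ N.eqb y (head 0%num v.2)])
           values) values
     else false
   else false).

Lemma count_maxmult x s : (count (N.eqb x) s <= maxmult s)%N.
Proof.
elim: s => //= y s IH; case: (N.eqb_spec x y) => [<-|_]; last exact: leq_trans IH (leq_maxr _ _).
apply: leq_trans (leq_maxl _ _); rewrite add1n ltnS.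
by elim: s {IH} => //= z s IH; case: N.eqb; rewrite ?add1n ?add0n ?ltnS.
Qed.

Lemma count_hit vs targets : (count (hit ^~ targets) vs <= loss (size targets) vs)%N.
Proof.
elim: targets vs => [|x ts IH] vs /=; first by rewrite (eq_count (a2 := pred0)) ?count_pred0.
apply: leq_trans (leq_add (count_maxmult x (map (head 0%num) vs)) (IH (map behead vs))).
rewrite !count_map -count_predUI leq_addr //.
Qed.

Section Check.
Variables (n : N) (b h : N) (ls : seq N) (c : cert).
Let p := c_char c.
Let f := c_red c.

Definition zeroV : seq N := [seq 0%num | _ <- ls].

Definition logs : Type := N * seq N.

Definition add_logs (x y : logs) : logs := (addP b x.1 y.1, addV ls x.2 y.2).
Definition opp_logs (x : logs) : logs := (oppP b x.1, oppV ls x.2).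

Definition tput_log (k : positive) (v : seq N) (r : logs) (tbl : table) : table :=
  let d := oppV ls r.2 in tput k (Entry v r.1 r.2 d (addV ls d d)) tbl.

Definition prodT (tbl : table) (ks : seq positive) : option (seq N * logs) :=
  foldr (fun k o => if o is Some (v, r) then
                      if tget k tbl is Some e then
                        Some (mulL p f (e_val e) v, add_logs (e_two e, e_log e) r) else None
                    else None) (Some (one_list (size f), (0%num, zeroV))) ks.

(** The product is an unreduced integer: a relation modulo [p] is then verified with an explicit
    multiple of [p] instead of modular products. *)
Definition prodN (tbl : table) (ks : seq positive) : option (N * logs) :=
  foldr (fun k o => if o is Some (v, r) then
                      if tget k tbl is Some (Entry [:: x] l2 l _ _) then Some ((x * v)%num, add_logs (l2, l) r)
                      else None
                    else None) (Some (1%num, (0%num, zeroV))) ks.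

Definition do_step (tbl : table) (s : step) : option table :=
  match s with
  | IRel k num den m =>
      if prodN tbl num is Some (v1, r1) then
        if nilp den && N.eqb m 0 then
          if N.eqb (N.pos k) v1 then Some (tput_log k [:: N.pos k] r1 tbl) else None
        else if prodN tbl den is Some (v2, r2) then
          if N.eqb (N.pos k * v2) (m * p + v1) then
            Some (tput_log k [:: N.pos k] (add_logs r1 (opp_logs r2)) tbl)
          else if N.eqb (N.pos k * v2 + v1) (m * p) then
            let r := add_logs r1 (opp_logs r2) in Some (tput_log k [:: N.pos k] (addP b h r.1, r.2) tbl)
          else None
        else None
      else None
  | Rel k v num den =>
      if prodT tbl num is Some (v1, r1) then
        if den is [::] then if eqL v v1 then Some (tput_log k v r1 tbl) else None
        else if prodT tbl den is Some (v2, r2) then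
          if eqL (mulL p f v v2) v1 then Some (tput_log k v (add_logs r1 (opp_logs r2)) tbl) else None
        else None
      else None
  | Exp k v e =>
      if eqL (powL p f (c_gen c) e) (v ++ nseq (size f - size v) 0%num) then
        Some (tput_log k v (N.modulo (N.pos e) b, [seq N.modulo (N.pos e) m | m <- ls]) tbl) else None
  end.

Definition run_steps : option table :=
  foldl (fun o s => if o is Some tbl then do_step tbl s else None) (Some TLeaf) (c_steps c).

(* The residues of [i] and [i - j] modulo [b], and of [i + j] and [i - j] modulo the odd primes. *)
Definition zech_of (tbl : table) (q : point) : option (N * N * seq N * seq N) :=
  let: (x, y, z) := match q with PSum x y z | PNegJ x y z | PNegI x y z => (x, y, z) end in
  if tget x tbl is Some ex then
    if tget y tbl is Some ey then
      if tget z tbl is Some ez then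
        let t := addV ls (addV ls (e_log ex) (e_log ey)) (e_opp2 ez) in
        let r := addV ls (e_log ex) (e_opp ey) in
        let i := addP b (e_two ex) (oppP b (e_two ez)) in
        let d := addP b (e_two ex) (oppP b (e_two ey)) in
        match q with
        | PSum _ _ _ => if eqL (addL p (e_val ex) (e_val ey)) (e_val ez) then Some (i, d, t, r) else None
        | PNegJ _ _ _ =>
            if eqL (addL p (e_val ey) (e_val ez)) (e_val ex) then Some (i, addP b h d, t, r) else None
        | PNegI _ _ _ =>
            if eqL (addL p (e_val ex) (e_val ez)) (e_val ey) then Some (addP b h i, addP b h d, t, r) else None
        end
      else None
    else None
  else None.

Definition parity (x : N) : N := if N.odd x then 1%num else 0%num.

Definition leaf_vectors (tbl : table) (bs : seq (N * N)) (cl : N * N) (cs : seq (nat * nat)) (q : point)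
    : option (seq N * seq N) :=
  if zech_of tbl q is Some (i, d, t, r) then
    if N.eqb (parity i) cl.1 && N.eqb d cl.2 then satisfies bs cs t r else None
  else None.

Fixpoint check_tree (tbl : table) (bs : seq (N * N)) (cl : N * N) (cs : seq (nat * nat)) (rs : seq N) (t : ptree) {struct t} : bool :=
  match t with
  | PLeaf d qs => cover d rs (pmap (leaf_vectors tbl bs cl cs) qs)
  | PNode s t0 t1 t2 =>
      if rs is _ :: rs' then
        [&& check_tree tbl bs cl (rcons cs (0, s %% 3)) rs' t0,
            check_tree tbl bs cl (rcons cs (1, s.+1 %% 3)) rs' t1 &
            check_tree tbl bs cl (rcons cs (2, s.+2 %% 3)) rs' t2]%N
      else false
  end.

Definition classes : seq (N * N) :=
  if N.eqb b 1 then [:: (0, 0)]%num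
  else [seq (0%num, N.of_nat r) | r <- iota 0 (nat_of b)] ++ [seq (1%num, N.of_nat r) | r <- iota 0 (nat_of b)].

(** Distinct lists might have equal values, so an element is shown to be nonzero by an inverse: [w]
    inverts [g^(n/l) - 1], written as [g^(n/l) w = 1 + w]. *)
Definition check_generator : bool :=
  if c_inv c is w0 :: ws then
    eqL (mulL p f (c_gen c) w0) (one_list (size f)) &&
    all2 (fun l w => if N.div n l is N.pos e then
            eqL (mulL p f (powL p f (c_gen c) e) w) (addL p [:: 1%num] w) else false)
      (if N.eqb b 1 then ls else 2%num :: ls) ws
  else false.

Definition check_field : bool :=
  N.eqb (N.succ n) (iter (size f) (N.mul p) 1%num) &&
  (if (size f <= 1)%N then eqL f [:: 0%num]
   else if n is N.pos e then eqL (powL p f (X_list (size f)) e) (one_list (size f)) else false).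

Definition check_trees : bool :=
  if run_steps is Some tbl then
    let bs := [seq (N.div l 3, N.div (2 * l) 3)%num | l <- ls] in
    all2 (fun cl t => check_tree tbl bs cl [::] ls t) classes (c_trees c)
  else false.

Definition check_cert : bool := [&& check_field, check_generator & check_trees].
End Check.

(** * Points that avoid prescribed residues *)

Section Cover.
Implicit Types (rs T R : seq N) (vs : seq (seq N * seq N)).

Definition below rs T : bool := all2 N.ltb T rs.

Lemma size_below rs T : below rs T -> size rs = size T.
Proof. by elim: rs T => [|l rs IH] [|x T] //= /andP[_ /IH ->]. Qed.

Lemma loss_exists vs T R : (loss (size T) (map fst vs) + loss (size R) (map snd vs) < size vs)%N ->
  exists2 v, v \in vs & ~~ hit v.1 T && ~~ hit v.2 R.
Proof.
move=> lt; have := count_hit (map fst vs) T; have := count_hit (map snd vs) R.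
rewrite !count_map => c2 c1.
have := leq_ltn_trans (leq_add c1 c2) lt; rewrite -count_predUI => /(leq_ltn_trans (leq_addr _ _)).
rewrite -(count_predC (predU (preim fst (hit ^~ T)) (preim snd (hit ^~ R))) vs).
rewrite -[X in (X < _)%N]addn0 ltn_add2l -has_count.
by move=> /hasP[v vin /=]; rewrite negb_or => h; exists v.
Qed.

Lemma cover_exists d rs vs T R : below rs T -> below rs R -> cover d rs vs ->
  exists2 v, v \in vs & ~~ hit v.1 T && ~~ hit v.2 R.
Proof.
elim: d rs vs T R => [|d IH] rs vs T R bT bR /=.
  by rewrite orbF {1}(size_below bT) (size_below bR); exact: loss_exists.
case/orP; first by rewrite {1}(size_below bT) (size_below bR); exact: loss_exists.
case: rs bT bR => [//|l rs] bT bR.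
case: T bT => [//|x T] /= /andP[xl bT]; case: R bR => [//|y R] /= /andP[yl bR].
have inv z : (z <? l)%num -> z \in [seq N.of_nat x | x <- iota 0 (nat_of l)].
  by move=> zl; apply/mapP; exists (nat_of z); rewrite ?N2Nat.id // mem_iota /= add0n -nat_of_ltb.
move=> /allP/(_ x (inv _ xl))/allP/(_ y (inv _ yl)) /IH -/(_ T R bT bR).
case=> w /mapP[v]; rewrite !mem_filter => /and3P[hy hx vin] -> {w} /= /andP[h1 h2].
by exists v => //; rewrite !negb_or hx hy h1 h2.
Qed.

(* The targets lie outside the blocks chosen at the nodes. *)
Fixpoint clear (bs : seq (N * N)) (cs : seq (nat * nat)) (T R : seq N) : bool :=
  match cs, bs, T, R with
  | [::], _, _, _ => true
  | (ct, cr) :: cs', b :: bs', x :: T', y :: R' =>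
      [&& block b x != ct, block b y != cr & clear bs' cs' T' R']
  | _, _, _, _ => false
  end.

(** On the first coordinates the vector lies in a block that the target avoids, so agreement is
    possible only on the remaining ones. *)
Lemma satisfies_hit bs cs T R t r t' r' : clear bs cs T R -> satisfies bs cs t r = Some (t', r') ->
  hit t T = hit t' (drop (size cs) T) /\ hit r R = hit r' (drop (size cs) R).
Proof.
elim: cs bs T R t r => [|[ct cr] cs IH] bs T R t r /=.
  by case: bs => [|b bs] _ [-> ->]; rewrite !drop0.
case: bs => // b bs; case: T => // x T; case: R => // y R.
move=> /= /and3P[bx by_ cl]; case: t => // t0 t; case: r => // r0 r /=.
case: ifP => // /andP[]; rewrite !eqnE => /eqP bt /eqP br st.
have [h1 h2] := IH _ _ _ _ _ cl st; rewrite /= -h1 -h2.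
have -> : N.eqb x t0 = false.
  by apply/negbTE; apply: contraNN bx => /N.eqb_eq ->; rewrite bt.
have -> : N.eqb y r0 = false.
  by apply/negbTE; apply: contraNN by_ => /N.eqb_eq ->; rewrite br.
by [].
Qed.

Lemma clear_rcons bs cs T R ct cr : clear bs cs T R ->
  (size cs < size bs)%N -> size T = size bs -> size R = size bs ->
  block (nth (0, 0)%num bs (size cs)) (nth 0%num T (size cs)) != ct ->
  block (nth (0, 0)%num bs (size cs)) (nth 0%num R (size cs)) != cr ->
  clear bs (rcons cs (ct, cr)) T R.
Proof.
elim: cs bs T R => [|[c1 c2] cs IH] [|b bs] [|x T] [|y R] //=.
  by move=> _ _ _ _ h1 h2; rewrite h1 h2; case: (bs).
by case/and3P => -> -> cl lt [eT] [eR] h1 h2; exact: IH.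
Qed.

Lemma block_lt3 b v : (block b v < 3)%N.
Proof. by rewrite /block; case: ifP => // _; case: ifP. Qed.
End Cover.

(** [a] and [c] are the blocks of the two targets. The children of a node use the block pairs
    [(k, s + k)] modulo 3, so each target rules out one child and a third is left. *)
Lemma avoid_two (s a c : nat) : (a < 3)%N -> (c < 3)%N ->
  [|| (a != 0) && (c != s %% 3), (a != 1) && (c != s.+1 %% 3) | (a != 2) && (c != s.+2 %% 3)]%N.
Proof.
move=> a3 c3; have -> : (s.+2 %% 3 = (s %% 3).+2 %% 3)%N by rewrite -[s.+2]addn2 -modnDml addn2.
have -> : (s.+1 %% 3 = (s %% 3).+1 %% 3)%N by rewrite -[s.+1]addn1 -modnDml addn1.
have : (s %% 3 < 3)%N by rewrite ltn_mod.
case: (s %% 3)%N => [|[|[|//]]] _; case: a a3 => [|[|[|//]]] _; by case: c c3 => [|[|[|//]]].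
Qed.

Section Residues.
Implicit Types (m x y : N) (z w : int) (ms : seq N).

Definition residue m z x : Prop := (nat_of x)%:Z = (z %% (nat_of m)%:Z)%Z.

Definition residues ms z (v : seq N) : Prop :=
  [seq (nat_of x)%:Z | x <- v] = [seq (z %% (nat_of m)%:Z)%Z | m <- ms].

Lemma residue_lt m z x : (0 < m)%num -> residue m z x -> (x < m)%num.
Proof.
move=> m0 e; have m0' : (0 < nat_of m)%N by lia.
have := ltz_pmod z (d := (nat_of m)%:Z); rewrite -e; lia.
Qed.

Lemma residue_add m z w x y : (0 < m)%num -> residue m z x -> residue m w y -> residue m (z + w) (addP m x y).
Proof.
move=> m0 ex ey; have xm := residue_lt m0 ex; have ym := residue_lt m0 ey.
rewrite /residue -modzDm -ex -ey /addP.
case: (reduceP_cases m (x + y)) => [[-> lt]|[le ->]].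
  by rewrite modz_small; lia.
have -> : (nat_of x)%:Z + (nat_of y)%:Z = (nat_of (x + y - m))%:Z + (nat_of m)%:Z by lia.
by rewrite modzDr modz_small; lia.
Qed.

Lemma residue_opp m z x : (0 < m)%num -> residue m z x -> residue m (- z) (oppP m x).
Proof.
move=> m0 ex; have xm := residue_lt m0 ex; rewrite /residue -modzNm -ex /oppP.
case: x xm {ex} => [|x] xm; first by rewrite oppr0 mod0z.
have -> : - (nat_of (N.pos x))%:Z = (nat_of (m - N.pos x))%:Z + (-1) * (nat_of m)%:Z by lia.
by rewrite addrC modzMDl modz_small; lia.
Qed.

Lemma residues_add ms z w a c : all (N.ltb 0) ms -> residues ms z a -> residues ms w c ->
  residues ms (z + w) (addV ms a c).
Proof.
elim: ms a c => [|m ms IH] [|x a] [|y c] //= /andP[/N.ltb_lt m0 ms0] [ex ea] [ey ec].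
by rewrite /residues /=; congr cons; [exact: residue_add | exact: IH].
Qed.

Lemma residues_opp ms z a : all (N.ltb 0) ms -> residues ms z a -> residues ms (- z) (oppV ms a).
Proof.
elim: ms a => [|m ms IH] [|x a] //= /andP[/N.ltb_lt m0 ms0] [ex ea].
by rewrite /residues /=; congr cons; [exact: residue_opp | exact: IH].
Qed.

Lemma residues_cong ms z w a : {in ms, forall m, z = w %[mod nat_of m]%Z} -> residues ms z a -> residues ms w a.
Proof. by rewrite /residues => h ->; apply/eq_in_map => m /h. Qed.

Lemma residues_hit ms z w v T m : residues ms z v -> residues ms w T -> ~~ hit v T -> m \in ms ->
  (z != w %[mod nat_of m])%Z.
Proof.
elim: ms v T => [|m' ms IH] [|x v] [|y T] //= [ex ev] [ey eT]; rewrite negb_or inE => /andP[nxy nh].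
case/orP => [/eqP ->|]; last exact: IH ev eT nh.
by apply: contraNN nxy => /eqP e; apply/N.eqb_eq; move: ex ey; rewrite e; lia.
Qed.
End Residues.

(** Translation by 1 permutes [F], so summing [x + 1] over [F] gives back the sum of [x]. *)
Lemma card_natr (F : finFieldType) : (#|F|)%:R = 0 :> F.
Proof.
apply: (addrI (\sum_(x : F) x)); rewrite addr0 -[#|F|]sum1_card natr_sum -big_split /=.
by rewrite [RHS](reindex_inj (addIr 1)).
Qed.

Lemma mem_pmap_some (A : Type) (B : eqType) (f : A -> option B) s v :
  v \in pmap f s -> exists a, f a = Some v.
Proof.
elim: s => //= a s IH; case E: (f a) => [w|] //=.
by rewrite inE => /orP[/eqP ->|]; [exists a | exact: IH].
Qed.

Lemma nat_of_odd m : N.odd m = odd (nat_of m).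
Proof.
case: m => [|[m|m|]] //.
  by rewrite [nat_of _]Pos2Nat.inj_xI multE mul2n oddS odd_double.
by rewrite [nat_of _]Pos2Nat.inj_xO multE mul2n odd_double.
Qed.

(** * Soundness of the certificates *)

Section Soundness.
Variables (F : finFieldType) (n : N) (ls : seq N) (c : cert).
Let nn := #|F|.-1.
Hypothesis nE : nat_of n = nn.
Hypothesis lsP : odd_primes_of nn (map nat_of ls).

Definition two_modulus (n : N) : N :=
  if N.odd n then 1%num else if N.eqb (N.modulo n 4) 0%num then 4%num else 2%num.

Let b := two_modulus n.
Let h := N.modulo (N.div2 n) b.
Let p := c_char c.
Let f := c_red c.
Hypotheses (ok_field : check_field n c) (ok_gen : check_generator n b ls c).

Let n0 : (0 < nn)%N := card_finField_gt0 F.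

Let b0 : (0 < b)%num.
Proof. by rewrite /b /two_modulus; case: ifP => // _; case: ifP. Qed.

Let ls0 : all (N.ltb 0) ls.
Proof.
apply/allP => l lin; apply/N.ltb_lt; case: lsP => _ /(_ (nat_of l)).
by rewrite map_f // => /esym/and3P[/prime_gt0]; lia.
Qed.

Let odd_ls l : l \in ls -> odd (nat_of l).
Proof. by move=> lin; case: lsP => _ /(_ (nat_of l)); rewrite map_f // => /esym/and3P[]. Qed.

Let dvd_ls l : l \in ls -> (nat_of l %| nn)%N.
Proof. by move=> lin; case: lsP => _ /(_ (nat_of l)); rewrite map_f // => /esym/and3P[]. Qed.

Let b_cases : [\/ nat_of b = 1%N /\ odd nn, nat_of b = 2%N /\ ~~ odd nn /\ ~~ (4 %| nn)%N |
  nat_of b = 4%N /\ (4 %| nn)%N].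
Proof.
rewrite /b /two_modulus nat_of_odd nE; case: ifPn => no; first by constructor 1.
have -> : N.eqb (N.modulo n 4) 0 = (4 %| nn)%N by rewrite nat_of_eqb (nat_of_mod n (y := 4%num)) // nE.
by case: ifPn => n4; [constructor 3|constructor 2].
Qed.

Let b_dvd : (nat_of b %| nn)%N.
Proof. by case: b_cases => [[-> _]|[-> [no _]]|[-> ]] //; rewrite ?dvd1n // dvdn2. Qed.

Lemma cert_char : (nat_of p)%:R = 0 :> F.
Proof.
case/andP: ok_field => /N.eqb_eq e _.
have {e} : (nat_of p ^ size f)%N = #|F|.
  have -> : #|F| = nn.+1 by rewrite prednK // ltnW // finNzRing_gt1.
  rewrite -nE -N2Nat.inj_succ e -/f; elim: (size f) => [//|k IH].
  by rewrite iterS N2Nat.inj_mul -IH expnS.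
move=> e; have := card_natr F; rewrite -e natrX => /eqP; rewrite expf_eq0.
by case/andP => _ /eqP.
Qed.

Lemma cert_root : exists th : F, th ^+ size f = evalL th f.
Proof.
case/andP: ok_field => _ hf; case: leqP hf => [_ /eqLP e|k1].
  by exists 0; rewrite /f e /= mul0r addr0 expr1.
case E: (n) => [//|e] hh; apply: (exists_root cert_char k1 _ hh).
by rewrite -/nn -nE E.
Qed.
Variables (th : F).
Hypothesis hf : th ^+ size f = evalL th f.
Let ev := evalL th.
Let g : F := ev (c_gen c).

Let ev_mul a a' : ev (mulL p f a a') = ev a * ev a'.
Proof. exact: (evalL_mul cert_char hf). Qed.

Let ev_one : ev (one_list (size f)) = 1.
Proof. by rewrite /ev /= evalL_nseq0 mulr0 addr0. Qed.

(** If the order of [g] were a proper divisor of [nn], some prime [l] would give [g^(nn/l) = 1], and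
    the certified equation would read [w = 1 + w]. *)
Lemma cert_gen : nn.-primitive_root g.
Proof.
move: ok_gen; rewrite /check_generator -/f -/p; case: (c_inv c) => // w0 ws /andP[/eqLP hg0 hw].
have g0 : g != 0.
  by apply/eqP => e; have := oner_neq0 F; rewrite -ev_one -hg0 ev_mul -/g e mul0r eqxx.
have gn : g ^+ nn = 1 by exact: finField_fermat.
have [m mP mn] := prim_order_exists n0 gn; have [em|nm] := eqVneq m nn; first by rewrite -em.
have m0 := prim_order_gt0 mP; have [k nk] := dvdnP mn.
have k1 : (1 < k)%N.
  by move: n0 nm; rewrite nk; case: k {nk} => [|[|k]] //; rewrite mul1n eqxx.
have [l lp lk] := pdivP k1; have gl : g ^+ (nn %/ l) = 1.
  have [k' ek] := dvdnP lk; rewrite nk ek mulnAC mulnK ?prime_gt0 // mulnC exprM.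
  by rewrite (prim_expr_order mP) expr1n.
have ln : (l %| nn)%N by rewrite nk dvdn_mulr.
suff [l' [l'l [w hw']]] : exists l', nat_of l' = l /\ exists w,
    is_true (if N.div n l' is N.pos e then eqL (mulL p f (powL p f (c_gen c) e) w) (addL p [:: 1%num] w) else false).
  move: hw'; case E: (N.div n l') => [//|e] /eqLP /(congr1 ev).
  rewrite ev_mul [ev (addL _ _ _)](evalL_add _ cert_char) /ev (evalL_pow cert_char hf) -/ev -/g.
  have -> : Pos.to_nat e = (nn %/ l)%N.
    by rewrite -nE -l'l -nat_of_div ?E // => l0; move: lp; rewrite -l'l l0.
  rewrite gl mul1r /= mulr0 addr0 => /eqP; rewrite -[X in X == _]add0r (inj_eq (addIr _)).
  by rewrite eq_sym oner_eq0.
have all2_ex (s : seq N) (ws' : seq (seq N)) P x : all2 P s ws' -> x \in s -> exists w, P x w.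
  elim: s ws' => [|y s IH] [|w ws'] //= /andP[Pyw h']; rewrite inE => /orP[/eqP ->|]; first by exists w.
  exact: IH h'.
suff [l' l'l l'in] : exists2 l', nat_of l' = l & l' \in (if N.eqb b 1 then ls else 2%num :: ls).
  have [w hw'] := all2_ex _ _ _ _ hw l'in.
  by exists l'; split; last exists w.
have [lo|le] := boolP (odd l).
  have : l \in map nat_of ls by case: lsP => _ ->; rewrite /odd_prime_divisor lp lo.
  by case/mapP => l' lin ->; exists l' => //; case: ifP; rewrite ?inE lin ?orbT.
have l2 : l = 2 by apply/eqP; move: le; case: (even_prime lp) => ->.
exists 2%num; rewrite ?l2 //; case: ifP; last by rewrite inE eqxx.
move/N.eqb_eq => b1; case: b_cases => [[_ no]|[e _]|[e _]]; try by rewrite b1 in e.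
by have := dvdn_odd ln no; rewrite (negbTE le).
Qed.

Let g_neq0 : g != 0 := gen_neq0 cert_gen.

(* The logarithm of [-1]; it vanishes modulo every odd prime divisor. *)
Let hz : int := if odd nn then 0 else (nn./2)%:Z.

Lemma cert_opp1 : - 1 = g ^ hz.
Proof.
have n2 : ~~ odd nn -> nn = (2 * nn./2)%N by move=> ne; rewrite mul2n even_halfK.
rewrite /hz; case: ifPn => [no|ne].
  rewrite expr0z; have e : (-1 : F) ^+ nn = 1 by apply: finField_fermat; rewrite oppr_eq0 oner_eq0.
  by rewrite -{2}e -signr_odd no expr1.
have : (g ^+ nn./2) ^+ 2 == 1 by rewrite -exprM mulnC -n2 // prim_expr_order ?cert_gen.
rewrite -exprnP sqrf_eq1 => /orP[|/eqP -> //]; rewrite -(prim_order_dvd cert_gen) => /dvdn_leq.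
have := n2 ne; have := n0; lia.
Qed.

Lemma residue_h : residue b hz h.
Proof.
have bn : b <> 0%num by move=> e; have := b0; rewrite e.
rewrite /residue /h nat_of_mod //.
have -> : nat_of (N.div2 n) = nn./2 by rewrite N.div2_div (nat_of_div n (y := 2%num)) // nE divn2.
rewrite -modz_nat /hz; case: ifPn => // no; case: b_cases => [[-> _]|[-> [ne _]]|[-> n4]].
- by rewrite !modz1.
- by rewrite no in ne.
by have := dvdn_odd n4 no.
Qed.
Definition has_log (x : F) (r : N * seq N) (z : int) : Prop :=
  [/\ x = g ^ z, residue b z r.1 & residues ls z r.2].

Definition entry_ok (e : entry) : Prop := exists z, [/\ has_log (ev (e_val e)) (e_two e, e_log e) z,
  residues ls (- z) (e_opp e) & residues ls (- z + - z) (e_opp2 e)].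

Definition table_ok (tbl : table) : Prop := forall k e, tget k tbl = Some e -> entry_ok e.

Lemma has_log_mul x y r s z w : has_log x r z -> has_log y s w -> has_log (x * y) (add_logs b ls r s) (z + w).
Proof.
move=> [-> r1 r2] [-> s1 s2]; split; first by rewrite expfzDr.
  exact: residue_add.
exact: residues_add.
Qed.

Lemma has_log_inv x r z : has_log x r z -> has_log x^-1 (opp_logs b ls r) (- z).
Proof.
by move=> [-> r1 r2]; split; [rewrite -invr_expz | exact: residue_opp | exact: residues_opp].
Qed.

Lemma has_log_div x y w r s z t : y * w = x -> has_log x r z -> has_log w s t ->
  has_log y (add_logs b ls r (opp_logs b ls s)) (z - t).
Proof.
move=> yw hx hw; have w0 : w != 0 by case: hw => -> _ _; rewrite expfz_neq0.
by rewrite -[y](mulfK w0) yw; apply: has_log_mul => //; exact: has_log_inv.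
Qed.

Lemma hz_odd l : l \in ls -> (hz %% (nat_of l)%:Z)%Z = 0.
Proof.
move=> lin; rewrite /hz; case: ifPn => [_|ne]; first exact: mod0z.
have := dvd_ls lin; rewrite -[nn in (_ %| nn)%N](even_halfK ne) -muln2 Gauss_dvdl; last first.
  by rewrite coprime_sym coprime2n odd_ls.
by rewrite /dvdn modz_nat => /eqP ->.
Qed.

Lemma residues_hz z v : residues ls z v -> residues ls (hz + z) v.
Proof. by apply: residues_cong => l lin; rewrite -modzDml hz_odd // add0r. Qed.

Lemma has_log_opp x r z : has_log x r z -> has_log (- x) (addP b h r.1, r.2) (hz + z).
Proof.
move=> [ex r1 r2]; split; first by rewrite expfzDr // -cert_opp1 -ex mulN1r.
  exact/residue_add/r1/residue_h.
exact: residues_hz.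
Qed.

Lemma has_log1 : has_log 1 (0%num, zeroV ls) 0.
Proof.
split; rewrite ?expr0z //; first by rewrite /residue mod0z.
by rewrite /residues /zeroV -map_comp; apply/eq_map => l; rewrite mod0z.
Qed.

Lemma table_put k v r z tbl : table_ok tbl -> has_log (ev v) r z -> table_ok (tput_log ls k v r tbl).
Proof.
move=> ok_tbl [hv h1 h2] k' e he; case: (tget_put he) => [->|]; last exact: ok_tbl.
have ho := residues_opp ls0 h2.
by exists z; split=> //=; exact: residues_add.
Qed.

Lemma prodT_log tbl ks v r : table_ok tbl -> prodT b ls c tbl ks = Some (v, r) -> exists z, has_log (ev v) r z.
Proof.
move=> ok_tbl; elim: ks v r => [|k ks IH] v r /=; first by case=> <- <-; exists 0; rewrite ev_one; exact: has_log1.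
rewrite -/(prodT b ls c tbl ks); case: (prodT b ls c tbl ks) IH => // [[v' r']] IH; case E: (tget k tbl) => [e|//] [<- <-].
have [z hz'] := IH _ _ erefl; have [w [he _ _]] := ok_tbl _ _ E.
by exists (w + z); rewrite ev_mul; exact: has_log_mul he hz'.
Qed.

Lemma prodN_log tbl ks v r : table_ok tbl -> prodN b ls tbl ks = Some (v, r) ->
  exists z, has_log (nat_of v)%:R r z.
Proof.
move=> ok_tbl; elim: ks v r => [|k ks IH] v r /=; first by case=> <- <-; exists 0; exact: has_log1.
rewrite -/(prodN b ls tbl ks); case: (prodN b ls tbl ks) IH => // [[v' r']] IH; case E: (tget k tbl) => [[[|x [|? ?]] l2 l lo lo2]|] // [<- <-].
have [z hz'] := IH _ _ erefl; have [w [he _ _]] := ok_tbl _ _ E.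
exists (w + z); rewrite nat_ofE natrM; apply: has_log_mul hz'.
by move: he; rewrite /ev /= mulr0 addr0.
Qed.

Lemma ev_const k : ev [:: N.pos k] = (Pos.to_nat k)%:R.
Proof. by rewrite /ev /= mulr0 addr0. Qed.

Lemma natr_multiple m : (nat_of (m * p))%:R = 0 :> F.
Proof. by rewrite nat_ofE natrM cert_char mulr0. Qed.

Lemma do_step_ok tbl s tbl' : table_ok tbl -> do_step b h ls c tbl s = Some tbl' -> table_ok tbl'.
Proof.
move=> ok_tbl; case: s => [k num den m|k v num den|k v e]; rewrite /do_step -/p -/f.
- case E1: (prodN _ _ _ _) => [[v1 r1]|//]; have [z1 h1] := prodN_log ok_tbl E1.
  case: ifP => _; first by case: N.eqb_spec => // e [<-]; apply: (table_put (z := z1)) => //; rewrite ev_const; move: h1; rewrite -e.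
  case E2: (prodN _ _ _ _) => [[v2 r2]|//]; have [z2 h2] := prodN_log ok_tbl E2.
  case: N.eqb_spec => [e|_].
    case=> <-; apply: (table_put (z := z1 - z2)) => //; apply: has_log_div h1 h2.
    by rewrite ev_const -[Pos.to_nat k]/(nat_of (N.pos k)) -natrM -multE -N2Nat.inj_mul e N2Nat.inj_add plusE natrD natr_multiple add0r.
  case: N.eqb_spec => [e|//] [<-].
  have hd : - ev [:: N.pos k] * (nat_of v2)%:R = (nat_of v1)%:R.
    rewrite mulNr; apply/eqP; rewrite eq_sym -addr_eq0 addrC ev_const -[Pos.to_nat k]/(nat_of (N.pos k)).
    by rewrite -natrM -natrD -multE -plusE -N2Nat.inj_mul -N2Nat.inj_add e natr_multiple.
  by have := has_log_opp (has_log_div hd h1 h2); rewrite opprK; exact: table_put.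
- case E1: (prodT _ _ _ _ _) => [[v1 r1]|//]; have [z1 h1] := prodT_log ok_tbl E1.
  case: den => [|d den]; first by case: ifP => // /eqLP -> [<-]; exact: table_put h1.
  case E2: (prodT _ _ _ _ _) => [[v2 r2]|//]; have [z2 h2] := prodT_log ok_tbl E2.
  case: ifP => // /eqLP e [<-]; apply: (table_put (z := z1 - z2)) => //; apply: has_log_div h1 h2.
  by rewrite -ev_mul e.
case: ifP => // /eqLP ve [<-].
have ep : ev v = g ^ (Pos.to_nat e)%:Z.
  rewrite -exprnP -(evalL_pow cert_char hf) ve; move: (size f - size v)%N => m; rewrite /ev.
  elim: (v) => [|x v' IH] /=; last by rewrite IH.
  by rewrite evalL_nseq0.
apply: (table_put (z := (Pos.to_nat e)%:Z)) => //; split; first exact: ep.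
  have bn : b <> 0%num by move=> e0; have := b0; rewrite e0.
  by rewrite /residue nat_of_mod // modz_nat.
rewrite /residues -map_comp; apply/eq_in_map => l lin /=; rewrite nat_of_mod ?modz_nat //.
by move=> l0; move/allP: ls0 => /(_ l lin); rewrite l0.
Qed.

Lemma run_steps_ok tbl : run_steps b h ls c = Some tbl -> table_ok tbl.
Proof.
rewrite /run_steps; have : table_ok TLeaf by [].
move: (TLeaf : table); elim: (c_steps c) => [|s ss IH] t0 /=; first by move=> t0ok [<-].
move=> t0ok; case E: (do_step _ _ _ _ _ _) => [t1|]; first exact: IH (do_step_ok t0ok E).
by elim: ss {IH} => //=.
Qed.
Definition zech_ok (i j : int) (d0 e0 : N) (t r : seq N) : Prop :=
  [/\ g ^ i + g ^ j = 1, residue b i d0, residue b (i - j) e0, residues ls (i + j) t & residues ls (i - j) r].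

(** Twice [hz] is 0 or [nn], a multiple of [b]. This serves [PNegJ], where [i - j] contains [- hz]
    while the check adds [h]. *)
Let b_hz : (hz = - hz %[mod nat_of b])%Z.
Proof.
apply/eqP; rewrite eqz_mod_dvd opprK /hz; case: ifPn => [_|ne]; first by rewrite addr0 dvdz0.
by rewrite -PoszD addnn even_halfK // dvdzE /= b_dvd.
Qed.

Lemma zech_of_ok tbl q d0 e0 t r : table_ok tbl -> zech_of b h ls c tbl q = Some (d0, e0, t, r) ->
  exists i j, zech_ok i j d0 e0 t r.
Proof.
move=> ok_tbl; rewrite /zech_of.
set xyz := match q with PSum _ _ _ => _ | _ => _ end; case: xyz => [[x y] z].
case Ex: (tget x tbl) => [ex|//]; case Ey: (tget y tbl) => [ey|//]; case Ez: (tget z tbl) => [ez|//].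
have [kx [[vx tx lx] _ _]] := ok_tbl _ _ Ex; have [ky [[vy ty ly] oy _]] := ok_tbl _ _ Ey.
have [kz [[vz tz _] _ oz]] := ok_tbl _ _ Ez.
have rt : residues ls (kx + ky + (- kz + - kz)) (addV ls (addV ls (e_log ex) (e_log ey)) (e_opp2 ez)).
  by do 2?apply: residues_add.
have rr : residues ls (kx + - ky) (addV ls (e_log ex) (e_opp ey)) by apply: residues_add.
have ri : residue b (kx + - kz) (addP b (e_two ex) (oppP b (e_two ez))).
  exact/residue_add/residue_opp.
have rd : residue b (kx + - ky) (addP b (e_two ex) (oppP b (e_two ey))).
  exact/residue_add/residue_opp.
have gdiv k k' : g ^ (k - k') = g ^ k / g ^ k' by rewrite expfzDr // invr_expz.
have hzl w v : residues ls w v -> residues ls (- hz + w) v.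
  by apply: residues_cong => l lin; rewrite -modzDml -modzNm hz_odd // oppr0 mod0z add0r.
case: q => _ _ _; case: ifP => // /eqLP/(congr1 ev); rewrite [ev (addL _ _ _)](evalL_add _ cert_char) -/(ev _) -/(ev _) => e [<- <- <- <-].
- exists (kx - kz), (ky - kz); split=> //.
  + by rewrite !gdiv -mulrDl -vx -vy -vz e divff // vz expfz_neq0.
  + by rewrite (_ : _ - _ = kx + - ky); [|ring].
  + by rewrite (_ : _ + _ = kx + ky + (- kz + - kz)); [|ring].
  by rewrite (_ : _ - _ = kx + - ky); [|ring].
- exists (kx - kz), (hz + (ky - kz)); split=> //.
  + rewrite [g ^ (hz + _)]expfzDr // -cert_opp1 !gdiv mulN1r -mulrBl -vx -vy -vz -e addrC addKr divff //.
    by rewrite vz expfz_neq0.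
  + rewrite /residue (_ : kx - kz - (hz + (ky - kz)) = - hz + (kx + - ky)); last by ring.
    by rewrite -modzDml -b_hz modzDml; exact/residue_add/rd/residue_h.
  + by rewrite (_ : _ + _ = hz + (kx + ky + (- kz + - kz))); [exact: residues_hz|ring].
  by rewrite (_ : _ - _ = - hz + (kx + - ky)); [exact: hzl|ring].
exists (hz + (kx - kz)), (ky - kz); split=> //.
+ rewrite [g ^ (hz + _)]expfzDr // -cert_opp1 !gdiv mulN1r addrC -mulrBl -vx -vy -vz -e addrC addKr divff //.
  by rewrite vz expfz_neq0.
+ exact/residue_add/ri/residue_h.
+ rewrite (_ : _ - _ = hz + (kx + - ky)); last by ring.
  exact/residue_add/rd/residue_h.
+ by rewrite (_ : _ + _ = hz + (kx + ky + (- kz + - kz))); [exact: residues_hz|ring].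
by rewrite (_ : _ - _ = hz + (kx + - ky)); [exact: residues_hz|ring].
Qed.

Let bs : seq (N * N) := [seq (N.div l 3, N.div (2 * l) 3)%num | l <- ls].

(** On the way down [clear] keeps both targets outside the blocks of the chosen child; at a leaf, a
    point not hit on the remaining primes is then hit nowhere. *)
Lemma check_tree_ok tbl cl cs rs t T R : rs = drop (size cs) ls -> (size cs <= size ls)%N ->
  below ls T -> below ls R -> clear bs cs T R -> check_tree b h ls c tbl bs cl cs rs t ->
  exists q i0 d0 tv rv, [/\ zech_of b h ls c tbl q = Some (i0, d0, tv, rv),
    parity i0 = cl.1, d0 = cl.2, ~~ hit tv T & ~~ hit rv R].
Proof.
move=> + + bT bR; elim: t cs rs => [d qs|s t0 IH0 t1 IH1 t2 IH2] cs rs rsE le cl_cs /=.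
  have below_drop T' : below ls T' -> below rs (drop (size cs) T').
    rewrite rsE; elim: (size cs) (ls) T' => [|k IH] [|l ls'] [|x T'] //=.
    by case/andP => _; exact: IH.
  move=> cv;
  case: (cover_exists (below_drop _ bT) (below_drop _ bR) cv) => v /mem_pmap_some[q].
  rewrite /leaf_vectors; case E: (zech_of _ _ _ _ _ _) => [[[[i0 d0] tv] rv]|//].
  case: ifP => // /andP[/N.eqb_eq e1 /N.eqb_eq e2] es; case: v es => t' r' es /andP[/= h1 h2].
  have [ht hr] := satisfies_hit cl_cs es.
  by exists q, i0, d0, tv, rv; rewrite E ht hr.
case: rs rsE => // l rs rsE.
have lt : (size cs < size ls)%N.
  by rewrite ltn_neqAle le andbT; apply: contra_eq_neq rsE => ->; rewrite drop_size.
have rsE' x : rs = drop (size (rcons cs x)) ls by rewrite size_rcons -add1n -drop_drop -rsE /= drop0.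
have sT : size T = size bs by rewrite size_map -(size_below bT).
have sR : size R = size bs by rewrite size_map -(size_below bR).
have ltb : (size cs < size bs)%N by rewrite size_map.
set bd := nth (0, 0)%num bs (size cs).
case/and3P => c0 c1 c2.
have := avoid_two s (block_lt3 bd (nth 0%num T (size cs))) (block_lt3 bd (nth 0%num R (size cs))).
case/or3P => /andP[h1 h2].
- by apply: (IH0 _ _ (rsE' _) _ _ c0); [rewrite size_rcons | exact: clear_rcons].
- by apply: (IH1 _ _ (rsE' _) _ _ c1); [rewrite size_rcons | exact: clear_rcons].
by apply: (IH2 _ _ (rsE' _) _ _ c2); [rewrite size_rcons | exact: clear_rcons].
Qed.
Let target (z : int) : seq N := [seq N.of_nat `|(z %% (nat_of l)%:Z)%Z|%N | l <- ls].

Let nat_of_pos l : l \in ls -> (0 < nat_of l)%N.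
Proof. by move=> lin; have := allP ls0 l lin; rewrite nat_of_ltb. Qed.

Let target_residues z : residues ls z (target z).
Proof.
rewrite /residues /target -map_comp; apply/eq_in_map => l lin /=; rewrite Nat2N.id gez0_abs //.
by rewrite modz_ge0 //; have := nat_of_pos lin; lia.
Qed.

Let target_below z : below ls (target z).
Proof.
have : {subset ls <= ls} by []. 
rewrite /target; elim: {1 3 4}ls => //= l ls' IH sub.
rewrite nat_of_ltb Nat2N.id IH ?andbT; last by move=> x xin; apply: sub; rewrite inE xin orbT.
have lp := nat_of_pos (sub l (mem_head _ _)).
have := ltz_pmod z (d := (nat_of l)%:Z); have := modz_ge0 z (d := (nat_of l)%:Z); lia.
Qed.

Let nat_log (i : int) : exists (k : nat) (a : int), g ^+ k = g ^ i /\ k%:Z = i + nn%:Z * a.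
Proof.
exists `|(i %% nn)%Z|%N, (- (i %/ nn)%Z).
have ge : (0 <= i %% nn)%Z by rewrite modz_ge0 //; have := n0; lia.
split; last by rewrite gez0_abs //; have := divz_eq i nn; lia.
rewrite exprnP gez0_abs //; have := divz_eq i nn; move: (i %/ nn)%Z (i %% nn)%Z => x y ->.
rewrite expfzDr // [x * _]mulrC -exprz_exp -exprnP prim_expr_order ?cert_gen // exp1rz mul1r //.
Qed.

(** A class fixes the parity of [i] and the value of [i - j] modulo [b], from which the parity of
    [j] follows. The 2 in [s] is the condition modulo 4 of [good_point]. *)
Lemma class_exists (U V : nat) : exists2 cl, cl \in classes b & forall (i j : int) (i0 d0 : N),
  residue b i i0 -> residue b (i - j) d0 -> parity i0 = cl.1 -> d0 = cl.2 ->
  (~~ odd nn -> (i = U%:Z %[mod 2])%Z /\ (j = V%:Z %[mod 2])%Z) /\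
  ((4 %| nn)%N -> (i - j = U%:Z - V%:Z + 2 %[mod 4])%Z).
Proof.
pose s : int := U%:Z - V%:Z + (if nat_of b == 4 then 2 else 0).
pose cl : N * N := if nat_of b == 1%N then (0, 0)%num else (parity (N.of_nat U), N.of_nat `|(s %% (nat_of b)%:Z)%Z|%N).
exists cl.
  rewrite /classes /cl nat_of_eqb; case: eqP => // b1.
  have bp : (0 < nat_of b)%N by case: b_cases => [[-> _]|[-> _]|[-> _]].
  have rng : `|(s %% (nat_of b)%:Z)%Z|%N \in iota 0 (nat_of b).
    rewrite mem_iota; have := ltz_pmod s (d := (nat_of b)%:Z); have := modz_ge0 s (d := (nat_of b)%:Z); lia.
  by rewrite mem_cat /parity; case: N.odd; rewrite ?(map_f (fun r => (0%num, N.of_nat r)) rng)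
    ?(map_f (fun r => (1%num, N.of_nat r)) rng) ?orbT.
move=> i j i0 d0 ri rd pe de.
have podd (x y : N) : parity x = parity y -> odd (nat_of x) = odd (nat_of y).
  by rewrite /parity !nat_of_odd; case: odd; case: odd.
move: ri rd pe de; rewrite /residue /cl /s; case: b_cases => [[-> no]|[-> [ne n4]]|[-> n4]] /=.
- by move=> _ _ _ _; split; [rewrite no | move/dvdn_odd => /(_ no)].
- move=> ri rd /podd pe de; rewrite (negbTE n4); split=> // _.
  by move: ri rd pe; rewrite de !Nat2N.id addr0; clear; lia.
move=> ri rd /podd pe de; move: ri rd pe; rewrite de !Nat2N.id; clear; split; lia.
Qed.

Hypothesis ok_trees : check_trees b h ls c.

Lemma cert_good U V : exists i j, g ^+ i + g ^+ j = 1 /\ good_point nn U V i j.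
Proof.
have [cl clin clP] := class_exists U V.
have [tbl [ok_tbl [t ct]]] : exists tbl, table_ok tbl /\ exists t, check_tree b h ls c tbl bs cl [::] ls t.
  move: ok_trees; rewrite /check_trees; case E: (run_steps _ _ _ _) => [tbl|//] ct.
  exists tbl; split; first exact: run_steps_ok E.
  elim: (classes b) (c_trees c) clin ct => [|x xs IH] [|t ts] //=; rewrite inE.
  by case/orP => [/eqP ->|xin] /andP[ct cts]; [exists t | exact: IH cts].
have [] := check_tree_ok (T := target (U%:Z + V%:Z)) (R := target (U%:Z - V%:Z)) _ _ _ _ _ ct.
- by rewrite drop0.
- by [].
- exact: target_below.
- exact: target_below.
- by case: (bs).
move=> q [i0 [d0 [tv [rv [/(zech_of_ok ok_tbl)[i [j [gij ri rd rt rr]]] pe de ht hr]]]]].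
have [h2 h4] := clP _ _ _ _ ri rd pe de.
have [i' [a [gi ei]]] := nat_log i; have [j' [a' [gj ej]]] := nat_log j.
exists i', j'; rewrite gi gj; split=> //; split.
- move=> ne; have [hU hV] := h2 ne.
  have [m em] : exists m, nn = (2 * m)%N by exists nn./2; rewrite mul2n even_halfK.
  move: ei ej hU hV; rewrite em PoszM -!mulrA; move: (m%:Z * a) (m%:Z * a') => x y; clear; lia.
- move=> n4; have := h4 n4; have [m em] := dvdnP n4.
  move: ei ej; rewrite em mulnC PoszM -!mulrA; move: (m%:Z * a) (m%:Z * a') => x y; clear; lia.
move=> l lo; have : l \in map nat_of ls by case: lsP => _ ->.
case/mapP => l' lin el; have [m em] := dvdnP (dvd_ls lin).
have tm (z z' w : int) : z = z' + nn%:Z * w -> (z = z' %[mod nat_of l'])%Z.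
  by move=> ->; rewrite em PoszM mulrAC addrC modzMDl.
have nm (x y : nat) : (x != y %[mod l])%N = (x%:Z != y%:Z %[mod nat_of l'])%Z by rewrite !modz_nat eqz_nat el.
have ht' := residues_hit rt (target_residues _) ht lin.
have hr' := residues_hit rr (target_residues _) hr lin.
rewrite !nm; split; rewrite !PoszD ei ej.
  by rewrite (tm _ (i + j) (a + a')) //; ring.
move: hr'; rewrite !eqz_mod_dvd; congr (~~ _).
rewrite (_ : i + nn%:Z * a + V - (j + nn%:Z * a' + U) = (i - j - (U%:Z - V%:Z)) + nn%:Z * (a - a')); last by ring.
by rewrite [RHS]rpredDr // em PoszM -mulrA mulrCA dvdz_mulr.
Qed.

Lemma cert_T : T_prop F.
Proof. exact: T_prop_good cert_gen cert_good. Qed.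
End Soundness.

Lemma check_cert_correct (F : finFieldType) n ls c : nat_of n = #|F|.-1 ->
  odd_primes_of #|F|.-1 (map nat_of ls) ->
  check_cert n (two_modulus n) (N.modulo (N.div2 n) (two_modulus n)) ls c -> T_prop F.
Proof.
move=> nE lsP /and3P[ok_f ok_g ok_t]; have [th hf] := cert_root nE ok_f.
exact: (cert_T nE lsP ok_f ok_g (th := th) hf ok_t).
Qed.

(** * Search for certificates; [check_cert] verifies whatever it returns *)

(* Pohlig-Hellman: the prime factors of [n], with multiplicity, determine successive digits of the
   logarithm in a mixed radix. *)
Section DiscreteLog.
Variables (E : Type) (one : E) (mul : E -> E -> E) (key : E -> positive) (n : N) (g : E).

Fixpoint powG (a : E) (e : positive) : E :=
  match e with
  | xH => a
  | xO e' => let y := powG a e' in mul y y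
  | xI e' => let y := powG a e' in mul a (mul y y)
  end.

Definition powGN (a : E) (e : N) : E := if e is N.pos e' then powG a e' else one.

Definition digit_table (l : N) : trie N :=
  let z := powGN g (N.div n l) in
  (N.iter l (fun s => let: (t, y, j) := s in (tput (key y) j t, mul y z, N.succ j)) (TLeaf, one, 0%num)).1.1.

Definition dlog_level : Type := N * trie N * E * N.

Fixpoint dlog_levels (P : N) (fs : seq N) : seq dlog_level :=
  if fs is l :: fs' then
    (N.div n (P * l), digit_table l, powGN g (n - P)%num, P) :: dlog_levels (P * l)%num fs'
  else [::].

Fixpoint mixed_dlog (levels : seq dlog_level) (x : E) (acc : N) : N :=
  if levels is (m, t, u, P) :: levels' then
    let d := if tget (key (powGN x m)) t is Some d then d else 0%num in
    mixed_dlog levels' (mul x (powGN u d)) (acc + P * d)%num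
  else acc.
End DiscreteLog.

Fixpoint with_mult (fuel : nat) (l n : N) : seq N :=
  if fuel is f.+1 then
    let: (d, m) := N.div_eucl n l in if N.eqb m 0%num then l :: with_mult f l d else [::]
  else [::].

Definition prime_factors (n : N) (ls : seq N) : seq N := flatten [seq with_mult 40 l n | l <- rev (2%num :: ls)].

Definition subV (ms a b : seq N) : seq N := addV ms a (oppV ms b).

Definition posN (x : N) : positive := N.succ_pos (N.pred x).

Fixpoint raise_cap (target : N) (rs : seq N) (caps : seq nat) : seq nat :=
  match rs, caps with
  | r :: rs', c :: caps' =>
      if N.eqb (N.of_nat c * r) target then c.+1 :: caps' else c :: raise_cap target rs' caps'
  | _, _ => caps
  end.

(* With [s] the sum of the capacities, [2 s + 1] points suffice. *)
Fixpoint capacities (fuel : nat) (rs : seq N) (caps : seq nat) : seq (nat * seq nat) :=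
  if fuel is f.+1 then
    let m := (2 * sumn caps).+1 in
    let products := [seq (N.of_nat rc.2 * rc.1)%num | rc <- zip rs caps] in
    let least := foldr N.min (head 0%num products) products in
    let rest := capacities f rs (raise_cap least rs caps) in
    if rs is [::] then [:: (m, caps)] else if N.leb (N.of_nat m) least then (m, caps) :: rest else rest
  else [::].

Definition leaf_options (rs : seq N) : seq (nat * seq nat) :=
  take 6 (capacities (12 - size rs) rs [seq 1%N | _ <- rs]).

Section Search.
(* [q] is the characteristic, [n] the order of the multiplicative group and [logc] the logarithm of
   constants. *)
Variables (q n b : N) (ls : seq N) (logc : N -> N).
Variables (exact : bool) (opts : seq (seq (nat * seq nat))) (depth : nat) (W h : N).
Let ms := W :: drop depth ls.

(* [ps] are the primes below [bound]. *)
Fixpoint smooth_factors (bound : N) (fuel : nat) (ps : seq N) (x : N) : option (seq positive) :=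
  if fuel is f.+1 then
    if ps is r :: ps' then
      if N.ltb x (r * r) then
        if N.eqb x 1%num then Some [::] else if N.ltb x bound then Some [:: posN x] else None
      else let: (d, m) := N.div_eucl x r in
      if N.eqb m 0%num then omap (cons (posN r)) (smooth_factors bound f ps d) else smooth_factors bound f ps' x
    else if N.eqb x 1%num then Some [::] else if N.ltb x bound then Some [:: posN x] else None
  else None.

(* The half-extended Euclidean algorithm, looking for [a * t = y] modulo [q] with smooth [t], [y];
   the sign alternates. *)
Fixpoint smooth_quotient (lim bound : N) (fuel : nat) (ps : seq N) (even : bool) (r0 r1 t0 t1 : N) :
    option (seq positive * seq positive * N * N * bool) :=
  if fuel is f.+1 then
    if N.eqb r1 0%num then None else
    let next _ := let: (d, m) := N.div_eucl r0 r1 in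
      smooth_quotient lim bound f ps (~~ even) r1 m t1 (t0 + d * t1)%num in
    if N.ltb lim r1 then next tt else
    if N.ltb lim t1 then None else
    if smooth_factors bound 100 ps r1 is Some num then
      if smooth_factors bound 100 ps t1 is Some den then Some (num, den, r1, t1, even) else next tt
    else next tt
  else None.

(** The logarithm of [r] is expressed through smaller primes: [s] varies over smooth numbers until
    [r s] is, up to sign, a quotient of smooth numbers modulo [q]. Halfway through the Euclidean
    algorithm both terms have the size of [sqrt q], hence the limit. *)
Fixpoint find_relation (fuel : nat) (ps : seq N) (r s : N) : option step :=
  if fuel is f.+1 then
    if smooth_factors r 100 ps s is Some fs then
      if smooth_quotient (4 * N.sqrt q)%num r 100 ps false q (N.modulo (r * s) q) 0%num 1%num is Some (num, den, y, t, neg) then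
        Some (IRel (posN r) num (fs ++ den) (N.div (if neg then r * s * t + y else r * s * t - y)%num q))
      else find_relation f ps r (N.succ s)
    else find_relation f ps r (N.succ s)
  else None.

(** The primes 2 and 3, and those without a relation, get an explicit power of the generator. An
    exponent 0 is replaced by [n] because [Exp] takes a positive one. *)
Definition prime_step (ps : seq N) (r : N) : step :=
  if find_relation (if N.leb r 3%num then 0 else 80)%N ps r 1%num is Some st then st
  else Exp (posN r) [:: r] (let e := logc r in if N.eqb e 0%num then posN n else posN e).

Definition get_vec (vecs : trie (seq N)) (k : positive) : seq N :=
  if tget k vecs is Some v then v else [::].

Definition step_vec (vecs : trie (seq N)) (s : step) : seq N :=
  match s with
  | IRel k num den c =>
      let sum := foldr (fun k r => addV ms (get_vec vecs k) r) [seq 0%num | _ <- ms] in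
      let v := subV ms (sum num) (sum den) in
      let prod := foldr Pos.mul 1%positive in
      if (N.eqb (N.pos (k * prod den)%positive) (c * q + N.pos (prod num))%num) then v
      else if v is x :: v' then addP W h x :: v' else v
  | Rel _ _ _ _ => [::]
  | Exp _ _ e => [seq N.modulo (N.pos e) m | m <- ms]
  end.

Fixpoint int_vecs (fuel : nat) (a : N) (ps : seq N) (vecs : trie (seq N)) (steps : seq step)
    : seq step * seq N * trie (seq N) :=
  if fuel is f.+1 then
    let st := if smooth_factors a 100 ps a is Some fs then IRel (posN a) fs [::] 0%num
              else prime_step ps a in
    let new := if smooth_factors a 100 ps a is Some _ then false else true in
    int_vecs f (N.succ a) (if new then rcons ps a else ps)
      (tput (posN a) (step_vec vecs st) vecs) (if new then rcons steps st else steps)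
  else (steps, ps, vecs).

(* A point, with the logarithms of its three elements modulo the remaining primes. *)
Definition cand : Type := point * (seq N * seq N * seq N * seq N).

(* The number, its logarithm modulo [W], its other logarithms with their opposites and opposite
   doubles, and whether it is divisible by 2 and by 3. *)
Definition elt : Type := positive * N * (seq N * seq N * seq N) * bool * bool.

Definition digits (f : N -> N -> N) (t : N) : N :=
  foldr (fun l r => (3 * r + f l t)%num) 0%num (take depth ls).

Definition blockN (l t : N) : N :=
  let v := N.modulo t l in if N.ltb v (N.div l 3) then 0%num else if N.ltb v (N.div (2 * l) 3) then 1%num else 2%num.

(* The cells of [i + j], and for [i - j] the matching cells. *)
Definition cell_table (f : N -> N -> N) : trie N :=
  foldr (fun k => let t := N.of_nat k in tput (N.succ_pos t) (digits f t)) TLeaf (iota 0 (nat_of W)).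

Variables (cells_t cells_r : trie N).

Definition cell_key (code i d : N) : positive :=
  N.succ_pos (8 * code + 2 * (N.modulo d b) + (if N.odd i then if N.eqb b 1 then 0%num else 1%num else 0%num))%num.

Definition add_cand (ct : option N) (i d : N) (c : cand) (cs : trie (seq cand)) : trie (seq cand) :=
  if ct is Some code then
    if tget (N.succ_pos d) cells_r is Some code' then
      if N.eqb code code' then
        let key := cell_key code i d in
        tput key (c :: if tget key cs is Some l then l else [::]) cs
      else cs
    else cs
  else cs.

(** One relation [a + c = z] yields six points, the orbit of [a / z] under [1 - x] and [1 / x]. A
    common factor 2 or 3 would only repeat the ratios of a smaller triple. *)
Definition triple_cands (ea ec ez : elt) (cs : trie (seq cand)) : trie (seq cand) :=
  let: (a, la, (va, na, da), a2, a3) := ea in let: (c, lc, (vc, nc, dc), c2, c3) := ec in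
  let: (z, lz, (vz, nz, dz), _, _) := ez in
  if (a2 && c2) || (a3 && c3) then cs else
  let oz := oppP W lz in let o := oppP W in let ad := addP W in
  let ac := ad la (o lc) in let az := ad la oz in let cz := ad lc oz in
  let ca := o ac in let za := o az in let zc := o cz in
  let cell t := tget (N.succ_pos t) cells_t in
  let tz := cell (ad az cz) in let tc := cell (ad zc ac) in let ta := cell (ad za ca) in
  add_cand tz az ac (PSum a c z, (va, vc, nc, dz))
  (add_cand tz cz ca (PSum c a z, (vc, va, na, dz))
  (add_cand tc zc (ad h za) (PNegJ z a c, (vz, va, na, dc))
  (add_cand ta za (ad h zc) (PNegJ z c a, (vz, vc, nc, da))
  (add_cand tc (ad h ac) (ad h az) (PNegI a z c, (va, vz, nz, dc))
  (add_cand ta (ad h ca) (ad h cz) (PNegI c z a, (vc, vz, nz, da)) cs))))).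

(* The pairs of an initial and a final element of [1, ..., z - 1]. *)
Fixpoint pair_cands (ez : elt) (up down : seq elt) (cs : trie (seq cand)) : trie (seq cand) :=
  match up, down with
  | ea :: up', ec :: down' =>
      if Pos.ltb ec.1.1.1.1 ea.1.1.1.1 then cs else triple_cands ea ec ez (pair_cands ez up' down' cs)
  | _, _ => cs
  end.

Fixpoint sum_cands (up down rest : seq elt) : trie (seq cand) :=
  if rest is ez :: rest' then pair_cands ez up down (sum_cands up (ez :: down) rest') else TLeaf.

Definition to_elt (key : positive) (v : seq N) (even three : bool) : elt :=
  let v' := behead v in let d := oppV (behead ms) v' in
  (key, head 0%num v, (v', d, addV (behead ms) d d), even, three).

Definition const_elt (vecs : trie (seq N)) (a : N) : elt :=
  to_elt (posN a) (get_vec vecs (posN a)) (N.eqb (N.modulo a 2) 0) (N.eqb (N.modulo a 3) 0).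

Definition int_cands (vecs : trie (seq N)) (M : nat) : trie (seq cand) :=
  let elts := [seq const_elt vecs (N.of_nat k) | k <- iota 1 M] in sum_cands elts [::] elts.

(* Conditionals rather than boolean connectives: the latter are strict under call by value. *)
Fixpoint below_cap (x : N) (chosen : seq (seq N)) (c : nat) : bool :=
  if chosen is w :: chosen' then
    if N.eqb x (head 0%num w) then if c is c'.+1 then below_cap x chosen' c' else false
    else below_cap x chosen' c
  else if c is 0%N then false else true.

Fixpoint fits (v : seq N) (chosen : seq (seq N)) (caps : seq nat) : bool :=
  match caps, v with
  | c :: caps', x :: v' => if below_cap x chosen c then fits v' (map behead chosen) caps' else false
  | _, _ => true
  end.

Definition cand_t (rs : seq N) (c : cand) : seq N :=
  let: (_, (x, y, _, z)) := c in addV rs (addV rs x y) z.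

Definition cand_r (rs : seq N) (c : cand) : seq N := let: (_, (x, _, y, _)) := c in addV rs x y.

Fixpoint greedy (rs : seq N) (m : nat) (caps : seq nat) (pool : seq cand)
   (ct cr : seq (seq N)) (acc : seq point) : option (seq point) :=
  if m is m'.+1 then
    if pool is c :: pool' then
      let r := cand_r rs c in
      if fits r cr caps then
        let t := cand_t rs c in
        if fits t ct caps then greedy rs m' caps pool' (t :: ct) (r :: cr) (c.1 :: acc)
        else greedy rs m caps pool' ct cr acc
      else greedy rs m caps pool' ct cr acc
    else None
  else Some acc.

Fixpoint try_leaf (rs : seq N) (opts : seq (nat * seq nat)) (pool : seq cand) : option (seq point) :=
  if opts is (m, caps) :: opts' then
    if greedy rs m caps pool [::] [::] [::] is Some qs then Some qs else try_leaf rs opts' pool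
  else None.

Definition behead_cand (c : cand) : cand :=
  let: (p, (x, y, y', z)) := c in (p, (behead x, behead y, behead y', behead z)).

Fixpoint distinct (rs : seq N) (pool : seq cand) (acc : seq (seq N * seq N * point)) :
    seq (seq N * seq N * point) :=
  if pool is c :: pool' then
    let t := cand_t rs c in let r := cand_r rs c in
    distinct rs pool' (if has (fun w => eqL t w.1.1 && eqL r w.1.2) acc then acc else (t, r, c.1) :: acc)
  else rev acc.

Fixpoint balanced (m : nat) (caps : seq nat) (pool acc : seq (seq N * seq N * point)) :
    seq (seq N * seq N * point) :=
  if m is m'.+1 then
    if pool is w :: pool' then
      if (if fits w.1.1 (map (fun w => w.1.1) acc) caps then fits w.1.2 (map (fun w => w.1.2) acc) caps else false)
      then balanced m' caps pool' (w :: acc) else balanced m caps pool' acc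
    else acc
  else acc.

Fixpoint try_exact (rs : seq N) (specs : seq (nat * nat * nat)) (pool : seq (seq N * seq N * point)) : option ptree :=
  if specs is (d, m, e) :: specs' then
    let ws := balanced m [seq (m %/ nat_of l + e)%N | l <- rs] pool [::] in
    if cover d rs (map fst ws) then Some (PLeaf d (map snd ws)) else try_exact rs specs' pool
  else None.

Definition exact_specs : seq (nat * nat * nat) :=
  [seq (de.1, m, de.2) | de <- [:: (1, 1); (1, 2); (2, 2); (2, 5)], m <- [:: 6; 9; 12; 16; 20; 25; 30; 40; 60]]%N.

Fixpoint build_tree (rs : seq N) (opts : seq (seq (nat * seq nat))) (pool : seq cand) : option ptree :=
  if try_leaf rs (head [::] opts) pool is Some qs then Some (PLeaf 0 qs)
  else if rs is l :: rs' then
    let bd := (N.div l 3, N.div (2 * l) 3)%num in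
    let coord (c : cand) := let: (p, (x, y, y', z)) := c in
      let hd := head 0%num in
      (block bd (addP l (addP l (hd x) (hd y)) (hd z)), block bd (addP l (hd x) (hd y')), behead_cand c) in
    let keyed := [seq coord c | c <- pool] in
    let cell i j := pmap (fun k : nat * nat * cand => let: (t, r, c) := k in
        if eqn t i && eqn r j then Some c else None) keyed in
    let try_shift s :=
      if build_tree rs' (behead opts) (cell 0 (s %% 3))%N is Some t0 then
        if build_tree rs' (behead opts) (cell 1 (s.+1 %% 3))%N is Some t1 then
          if build_tree rs' (behead opts) (cell 2 (s.+2 %% 3))%N is Some t2 then Some (PNode s t0 t1 t2) else None
        else None
      else None in
    if try_shift 1%N is Some t then Some t else if try_shift 2%N is Some t then Some t else try_shift 0%N
  else None.

Fixpoint cell_tree (k : nat) (scale code : N) (cl : N * N) (cands : trie (seq cand)) : option ptree :=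
  if k is k'.+1 then
    if cell_tree k' (3 * scale)%num code cl cands is Some t0 then
      if cell_tree k' (3 * scale)%num (code + scale)%num cl cands is Some t1 then
        if cell_tree k' (3 * scale)%num (code + 2 * scale)%num cl cands is Some t2 then Some (PNode 1 t0 t1 t2)
        else None
      else None
    else None
  else if tget (cell_key code cl.1 cl.2) cands is Some pool then
    let rs := drop depth ls in
    if exact then try_exact rs exact_specs (distinct rs (take 150 pool) [::])
    else build_tree rs (drop depth opts) pool
  else None.

Definition class_trees (cands : trie (seq cand)) : option (seq ptree) :=
  foldr (fun cl o => if o is Some ts then
     if cell_tree depth 1%num 0%num cl cands is Some t then Some (t :: ts) else None
     else None) (Some [::]) (classes b).

Fixpoint tree_points (t : ptree) : seq point :=
  match t with
  | PLeaf _ qs => qs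
  | PNode _ a c d => tree_points a ++ tree_points c ++ tree_points d
  end.

Definition mark (t : trie unit) (k : positive) : trie unit := tput k tt t.

Definition point_keys (pt : point) : seq positive :=
  match pt with PSum x y z | PNegJ x y z | PNegI x y z => [:: x; y; z] end.

Definition step_key (s : step) : positive := match s with IRel k _ _ _ | Rel k _ _ _ | Exp k _ _ => k end.

Definition step_deps (s : step) : seq positive :=
  match s with IRel _ num den _ | Rel _ _ num den => num ++ den | Exp _ _ _ => [::] end.

Definition composite_steps (ps : seq N) (M : nat) : seq step :=
  let primes_t := foldl (fun s r => mark s (posN r)) TLeaf ps in
  pmap (fun a => let k := posN (N.of_nat a) in
    if tget k primes_t is Some _ then None
    else Some (IRel k (if smooth_factors (N.pos k) 100 ps (N.pos k) is Some fs then fs else [::]) [::] 0%num))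
    (iota 1 M).

Definition needed_steps (steps : seq step) (ts : seq ptree) : seq step :=
  let used := foldl mark TLeaf (flatten [seq flatten [seq point_keys pt | pt <- tree_points t] | t <- ts]) in
  (foldr (fun s st => let: (t, acc) := st in
     if tget (step_key s) t is Some _ then (foldl mark t (step_deps s), s :: acc) else st)
     (used, [::]) steps).2.

Definition one_vec : trie (seq N) := tput 1%positive [seq 0%num | _ <- ms] TLeaf.

Definition int_search (M : nat) : option (seq step * seq ptree) :=
  let: (steps, ps, vecs) := int_vecs M.-1 2%num [::] one_vec [::] in
  if class_trees (int_cands vecs M) is Some ts then Some (needed_steps (steps ++ composite_steps ps M) ts, ts)
  else None.

(* In an extension, the powers of the generator ['X], divided by their leading coefficients, and
   the constants; two such elements may differ by a constant. *)
Variable f : seq N.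

Definition encode (v : seq N) : positive := posN (foldr (fun x r => x + q * r)%num 0%num v).

Definition lead (v : seq N) : N := foldl (fun r x => if N.eqb x 0 then r else x) 0%num v.

Definition invmod (x : N) : N := if (q - 2)%num is N.pos e then powG (mulP q) x e else 1%num.

Fixpoint walk (fuel : nat) (vecs : trie (seq N)) (v vec : seq N) (acc : seq (seq N * elt)) (steps : seq step) :
    seq (seq N * elt) * seq step :=
  if fuel is f'.+1 then
    let xv := shiftL q f v in let s := lead xv in
    let v' := if N.eqb s 1 then xv else map (mulP q (invmod s)) xv in
    let xkey := encode (X_list (size f)) in
    let vec' := subV ms (addV ms vec (map (N.modulo 1) ms)) (get_vec vecs (posN s)) in
    if eqL v' (one_list (size f)) then (acc, rev steps) else
    let st := Rel (encode v') v' [:: encode v; xkey] (if N.eqb s 1 then [::] else [:: posN s]) in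
    walk f' vecs v' vec' ((v', to_elt (encode v') vec' false false) :: acc) (st :: steps)
  else (acc, rev steps).

Definition ext_cands (vecs : trie (seq N)) (D : nat) (elts : seq (seq N * elt)) : trie (seq cand) :=
  let t := foldr (fun x => tput (encode x.1) x.2) TLeaf elts in
  let consts := [seq (N.of_nat d, const_elt vecs (N.of_nat d)) | d <- iota 1 D] in
  foldr (fun z cs => foldr (fun d cs =>
      if tget (encode (addL q z.1 [:: (q - d.1)%num])) t is Some x then triple_cands x d.2 z.2 cs else cs) cs consts)
    (int_cands vecs D) elts.

Definition ext_search (D m : nat) : option (seq step * seq ptree) :=
  let P := (nat_of q).-1 in
  let: (steps, ps, vecs) := int_vecs P.-1 2%num [::] one_vec [::] in
  let x := X_list (size f) in
  let vec := [seq N.modulo 1 l | l <- ms] in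
  let: (elts, wsteps) := walk m vecs x vec [:: (x, to_elt (encode x) vec false false)] [::] in
  if class_trees (ext_cands vecs (minn D P) elts) is Some ts then
    Some (needed_steps (steps ++ composite_steps ps P ++ Exp (encode x) x 1%positive :: wsteps) ts, ts)
  else None.
End Search.

Section Certificates.
Variables (n : N) (ls : seq N).
Let b := two_modulus n.
Let all_primes := if N.odd n then ls else 2%num :: ls.
Let opts := [seq leaf_options (drop k ls) | k <- iota 0 (size ls).+1].
Let depth (exact : option nat) := if exact is Some k then k else find (fun o => if o is [::] then false else true) opts.

(** By default [depth] is the least number of primes after whose removal some leaf option exists.
    The second table lowers blocks by 1 modulo 3, so that equal codes mean the block pairs
    [(k, k + 1)] of a node with shift 1. *)
Definition with_tables (T : Type) (exact : option nat)
    (search : seq (seq (nat * seq nat)) -> nat -> N -> N -> trie N -> trie N -> T) : T :=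
  let d := depth exact in let W := foldr N.mul b (take d ls) in
  search opts d W (if N.odd n then 0%num else N.modulo (N.div2 n) W) (cell_table ls d W blockN)
    (cell_table ls d W (fun l t => N.modulo (2 + blockN l t) 3)).

(** The fold builds a function, so that under call by value the powers after a failure are not
    computed. *)
Definition is_gen (E : Type) (one : E) (mul : E -> E -> E) (eqb : E -> E -> bool) (g : E) : bool :=
  foldr (fun l rest x => if eqb (powGN one mul g (N.div n l)) one then false else rest x) xpredT all_primes tt.

Fixpoint find_gen (q : N) (fuel : nat) (g : N) : N :=
  if fuel is f.+1 then
    if is_gen 1%num (mulP q) N.eqb g then g else find_gen q f (N.succ g)
  else g.

Definition prime_cert (exact : option nat) (M : nat) : option cert :=
  let q := N.succ n in let mul x y := N.modulo (x * y) q in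
  let g := find_gen q 200 2%num in
  let tb := dlog_levels 1%num mul N.succ_pos n g 1%num (prime_factors n ls) in
  let inv x := powGN 1%num mul x (n - 1)%num in
  if with_tables exact (fun opts d W h ct cr =>
      int_search q n b ls (fun r => mixed_dlog 1%num mul N.succ_pos tb r 0%num) (isSome exact) opts d W h ct cr M)
    is Some (steps, ts) then
    Some (Cert q [:: 0%num] [:: g] ([:: inv g] :: [seq [:: inv (powGN 1%num mul g (N.div n l) + n)%num] | l <- all_primes])
      steps ts)
  else None.

Fixpoint digits_of (p : N) (k : nat) (t : N) : seq N :=
  if k is k'.+1 then N.modulo t p :: digits_of p k' (N.div t p) else [::].

Fixpoint find_poly (p : N) (k : nat) (fuel : nat) (t : N) : seq N :=
  let f := digits_of p k t in
  if fuel is fuel'.+1 then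
    let one := one_list k in let x := X_list k in
    if eqL (powGN one (mulL p f) x n) one && is_gen one (mulL p f) eqL x then f else find_poly p k fuel' (N.succ t)
  else f.

Definition ext_cert (exact : option nat) (p : N) (k D m : nat) : option cert :=
  let f := find_poly p k 5000 1%num in
  let one := one_list k in let mul := mulL p f in let x := X_list k in
  let c0 := head 0%num (powGN one mul x (N.div n (N.pred p))) in
  let logs := (N.iter (N.pred p) (fun s => let: (t, y, j) := s in (tput (posN y) j t, mulP p y c0, N.succ j))
    (TLeaf, 1%num, 0%num)).1.1 in
  let logc r := if tget (posN r) logs is Some j then (j * N.div n (N.pred p))%num else 0%num in
  let inv y := powGN one mul y (n - 1)%num in
  if with_tables exact (fun opts d W h ct cr =>
      ext_search p n b ls logc (isSome exact) opts d W h ct cr f D m) is Some (steps, ts) then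
    Some (Cert p f x (inv x :: [seq inv (addL p (powGN one mul x (N.div n l)) [:: N.pred p]) | l <- all_primes]) steps ts)
  else None.
End Certificates.

(** * Resolution of the exceptional values *)

(* Why the exceptional value [n] needs no further attention: [n + 1] is a product of coprime
   numbers, or is listed in [E_T], or has a certificate. *)
Inductive resolution : Type := Coprime of N & N | Listed | Certified of cert.

Definition E_T_N : seq N := [seq N.of_nat q | q <- E_T].

Definition resolve (e : N * seq N) (r : resolution) : bool :=
  let: (n, ls) := e in
  match r with
  | Coprime a c => [&& N.ltb 1 a, N.ltb 1 c, N.eqb (a * c) (N.succ n) & N.eqb (N.gcd a c) 1]
  | Listed => has (N.eqb (N.succ n)) E_T_N
  | Certified c => let b := two_modulus n in check_cert n b (N.modulo (N.div2 n) b) ls c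
  end.

Lemma card_pnat (F : finFieldType) : exists2 p, prime p & p.-nat #|F|.
Proof.
exists (pdiv #|F|); first by rewrite pdiv_prime // finNzRing_gt1.
by have := abelem_pgroup (finField_is_abelem F); rewrite /pgroup cardsT.
Qed.

(** In the coprime case the order of [F] is a power of one prime, which then divides both factors,
    as each exceeds 1. *)
Lemma resolve_correct (F : finFieldType) (e : N * seq N) (r : resolution) :
  nat_of e.1 = #|F|.-1 -> odd_primes_of #|F|.-1 (map nat_of e.2) -> resolve e r ->
  T_prop F \/ #|F| \in E_T.
Proof.
case: e => n ls /= nE lsP; have qE : nat_of (N.succ n) = #|F|.
  by rewrite N2Nat.inj_succ nE prednK // ltnW // finNzRing_gt1.
case: r => [a c||c] /=; last by move=> ok; left; exact: check_cert_correct ok.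
  case/and4P => a1 c1 /N.eqb_eq e g; have [p pp] := card_pnat F.
  have {}e : #|F| = (nat_of a * nat_of c)%N by rewrite -qE -e nat_ofE.
  rewrite e pnatM => /andP[pa pc]; move: a1 c1; rewrite !nat_of_ltb => a1 c1.
  have dv x : (1 < x)%N -> p.-nat x -> (p %| x)%N.
    move=> x1 px; have px' : pdiv x \in \pi(x) by rewrite pi_pdiv.
    by have := pnatPpi px px'; rewrite inE => /eqP <-; exact: pdiv_dvd.
  have da := dv _ a1 pa; have dc := dv _ c1 pc.
  have : (p %| nat_of (N.gcd a c))%N.
    have [x xa] := dvdnP da; have [y yc] := dvdnP dc.
    have : (N.of_nat p | N.gcd a c)%num.
      apply: N.gcd_greatest; [exists (N.of_nat x) | exists (N.of_nat y)].
        by rewrite -Nat2N.inj_mul multE -xa N2Nat.id.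
      by rewrite -Nat2N.inj_mul multE -yc N2Nat.id.
    by case=> z ->; rewrite N2Nat.inj_mul Nat2N.id dvdn_mull.
  by move/N.eqb_eq: g => ->; rewrite dvdn1 => /eqP p1; rewrite p1 in pp.
move=> listed; have /hasP[x /mapP[q qin ->] /N.eqb_eq eq] : has (N.eqb (N.succ n)) E_T_N := listed; right.
by rewrite -qE eq Nat2N.id.
Qed.

Definition block_size : nat := 100.

Definition exception_block (k : nat) : seq (N * seq N) := take block_size (drop (block_size * k) exceptions).

Lemma exceptions_resolved (rs : nat -> seq resolution) m : (size exceptions <= block_size * m)%N ->
  (forall k, (k < m)%N -> all2 resolve (exception_block k) (rs k)) ->
  forall e, e \in exceptions -> exists r, resolve e r.
Proof.
move=> sz H e /(nthP (0%num, [::]))[i lt <-].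
have b0 : (0 < block_size)%N by [].
have km : (i %/ block_size < m)%N by rewrite ltn_divLR // mulnC (leq_trans lt).
have ein : nth (0%num, [::]) exceptions i \in exception_block (i %/ block_size).
  rewrite /exception_block {1}(divn_eq i block_size) mulnC -nth_drop.
  rewrite -(nth_take _ (ltn_pmod i b0)) mem_nth // size_take size_drop.
  case: ifP => [_|/negbT]; first exact: ltn_pmod.
  by rewrite -leqNgt => _; rewrite ltn_subRL mulnC -divn_eq.
elim: (exception_block _) (rs _) ein (H _ km) => [|x s IH] [|r rs'] //=.
by rewrite inE => /orP[/eqP ->|xin] /andP[h1 h2]; [exists r | exact: IH h2].
Qed.

Fixpoint small_factor (fuel : nat) (q l : N) : N :=
  if fuel is f.+1 then if N.eqb (N.modulo q l) 0 then l else small_factor f q (N.succ l) else q.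

Fixpoint remove_factor (fuel : nat) (q l : N) : N :=
  if fuel is f.+1 then
    let: (d, m) := N.div_eucl q l in if N.eqb m 0 then remove_factor f d l else q
  else q.

(* The hint 0 stands for a number that is not a prime power, 1 for a member of [E_T]; the others
   are parameters of the search. *)
Definition find_resolution (ext : N -> seq N -> option cert) (e : N * seq N) (hint : N) : resolution :=
  let: (n, ls) := e in let q := N.succ n in
  let by_cert o := if o is Some c then Certified c else Listed in
  if N.eqb hint 0 then
    let l := small_factor 8000 q 2%num in let c := remove_factor 100 q l in Coprime (N.div q c) c
  else if N.eqb hint 1 then Listed
  else let: (mode, M) := N.div_eucl hint 1000 in
    if N.eqb mode 9 then by_cert (ext n ls)
    else by_cert (prime_cert n ls (if N.eqb mode 0 then None else Some (nat_of mode).-1) (nat_of M)).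

(** * Direct examination of the small fields *)

Section SmallFields.
Variables (q : nat) (c : cert).
Let n := q.-1.
Let ls := [seq l <- primes n | odd l].
Let nN := N.of_nat n.
Let lsN := map N.of_nat ls.
Let p := c_char c.
Let f := c_red c.

Definition field_ok : bool := check_field nN c && check_generator nN (two_modulus nN) lsN c.

Definition powers : seq (seq N) := traject (mulL p f (c_gen c)) (one_list (size f)) n.

(* Zero, or a power of the generator whose exponent is not coprime to [n]. *)
Definition not_primitive (pws : seq (seq N)) (x : seq N) : bool :=
  eqL x (nseq (size f) 0%num) ||
  has (fun S => eqL x (nth [::] pws S) && ~~ coprime S n) (iota 0 n).

Definition combination (pws : seq (seq N)) (U A V B : nat) : seq N :=
  addL p (nth [::] pws ((U + A) %% n)) (nth [::] pws ((V + B) %% n)).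

Definition units : seq nat := [seq A <- iota 0 n | coprime A n].

Definition no_T (pws : seq (seq N)) (us : seq nat) (U V : nat) : bool :=
  all (fun A => not_primitive pws (combination pws U A V (n - A))) us.

Definition no_S (pws : seq (seq N)) (us : seq nat) (U V : nat) : bool :=
  all (fun A => all (fun B => not_primitive pws (combination pws U A V B) ||
    not_primitive pws (combination pws V (n - A) U (n - B))) us) us.

Definition zech_pairs : seq (nat * nat) :=
  let pws := powers in
  [seq (i, j) | i <- iota 0 n, j <- [seq j <- iota 0 n |
     eqL (addL p (nth [::] pws i) (nth [::] pws j)) (one_list (size f))]].

(** [R] divides [n] and has the same primes, so units may be tested modulo [R]. With [x = i - U] and
    [y = j - V], one has [A = S + x], [B = S + y] and [- C = S + x + y], and [S], [A], [B], [C] must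
    be units. For even [R] an odd [x] or [y] rules this out at once. *)
Definition has_S (R : nat) : bool :=
  let us := [seq S <- iota 0 R | coprime S R] in
  let RN := N.of_nat R in
  let unit_table := foldr (fun S => let x := N.of_nat S in tput (N.succ_pos x) x) TLeaf us in
  let is_unit x := if tget (N.succ_pos x) unit_table is Some y then N.eqb x y else false in
  let unitsN := map N.of_nat us in
  let residues := [seq N.of_nat x | x <- iota 0 R] in
  let zs := [seq (N.of_nat (z.1 %% R), N.of_nat (z.2 %% R)) | z <- zech_pairs] in
  [&& (0 < R)%N, (R %| n)%N, all (fun l => l %| R)%N (primes n) & all (fun U => all (fun V =>
    has (fun z => let x := addP RN z.1 (oppP RN U) in let y := addP RN z.2 (oppP RN V) in
      if ~~ N.even (N.lor x y) then false else has (fun S => let A := addP RN S x in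
        [&& is_unit A, is_unit (addP RN S y) & is_unit (addP RN A y)]) unitsN) zs) residues) residues].

Variable F : finFieldType.
Hypotheses (Fq : #|F| = q) (ok : field_ok).

Let nE : nat_of nN = #|F|.-1.
Proof. by rewrite Nat2N.id Fq. Qed.

Let n0 : (0 < n)%N.
Proof. by have := card_finField_gt0 F; rewrite Fq. Qed.

Let lsP : odd_primes_of #|F|.-1 (map nat_of lsN).
Proof.
rewrite Fq -/n -map_comp (eq_map (g := id)) ?map_id; last by move=> l /=; rewrite Nat2N.id.
split=> [|l]; first by rewrite filter_uniq ?primes_uniq.
by rewrite mem_filter mem_primes n0 /odd_prime_divisor /=; case: odd; rewrite ?andbF.
Qed.

Lemma field_okP : exists (th g : F), [/\ (nat_of p)%:R = 0 :> F, th ^+ size f = evalL th f,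
  g = evalL th (c_gen c) & n.-primitive_root g].
Proof.
case/andP: ok => ok_f ok_g; have [th hf] := cert_root nE ok_f.
exists th, (evalL th (c_gen c)); split=> //; first exact: cert_char nE ok_f.
by have := cert_gen nE lsP ok_f ok_g hf; rewrite Fq.
Qed.

Section Generator.
Variables (th g : F).
Hypotheses (charp : (nat_of p)%:R = 0 :> F) (hf : th ^+ size f = evalL th f).
Hypotheses (gE : g = evalL th (c_gen c)) (gP : n.-primitive_root g).
Let ev := evalL th.

Let gP' : #|F|.-1.-primitive_root g.
Proof. by rewrite Fq. Qed.

Lemma ev_power i : (i < n)%N -> ev (nth [::] powers i) = g ^+ i.
Proof.
move=> lt; rewrite (set_nth_default (one_list (size f))) ?size_traject // nth_traject // /ev.
elim: i {lt} => [|i IH] /=; first by rewrite evalL_nseq0 mulr0 addr0 expr0.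
by rewrite (evalL_mul charp hf) IH -gE exprS.
Qed.

Lemma not_primitiveP x : not_primitive powers x -> ~~ primitive_elt (ev x).
Proof.
rewrite /primitive_elt; case/orP => [/eqLP ->|/hasP[S]].
  rewrite /ev evalL_nseq0; apply/negP => h0; have := gen_neq0 h0.
  by rewrite eqxx.
rewrite mem_iota => /= lt /andP[/eqLP -> nc]; rewrite ev_power // Fq prim_root_exp_coprime //.
Qed.

Lemma ev_combination U A V B : ev (combination powers U A V B) = g ^+ U * g ^+ A + g ^+ V * g ^+ B.
Proof.
by rewrite /ev (evalL_add _ charp) -!/(ev _) !ev_power ?ltn_mod // !(prim_expr_mod gP) !exprD.
Qed.

Lemma primitive_log a : primitive_elt a -> exists A, [/\ A \in units, a = g ^+ A & a^-1 = g ^+ (n - A)].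
Proof.
rewrite /primitive_elt Fq => aP; have [A eA] := prim_rootP gP (prim_expr_order aP).
exists (nat_of_ord A); rewrite mem_filter mem_iota /= add0n ltn_ord andbT -(prim_root_exp_coprime _ gP) -eA; split=> //.
have g0 := gen_neq0 gP'; apply: (mulfI (expf_neq0 A g0)).
by rewrite eA mulfV ?expf_neq0 // -exprD subnKC ?prim_expr_order // ltnW.
Qed.

Lemma no_T_correct U V : no_T powers units U V -> ~ T_prop F.
Proof.
move=> h T; have g0 := gen_neq0 gP'.
have [a [/primitive_log[A [Ain aE aVE]]]] := T (g ^+ U) (g ^+ V) (expf_neq0 _ g0) (expf_neq0 _ g0).
have := not_primitiveP (allP h A Ain).
by rewrite ev_combination aE -aVE -aE => /negbTE ->.
Qed.

Lemma no_S_correct U V : no_S powers units U V -> ~ S_prop F.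
Proof.
move=> h T; have g0 := gen_neq0 gP'.
have [a [b []]] := T (g ^+ U) (g ^+ V) (expf_neq0 _ g0) (expf_neq0 _ g0).
move=> /primitive_log[A [Ain aE aVE]] /primitive_log[B [Bin bE bVE]] h1 h2.
have := allP (allP h A Ain) B Bin.
by case/orP => /not_primitiveP; rewrite ev_combination -?aVE -?bVE -?aE -?bE ?h1 ?h2.
Qed.

Lemma has_S_correct R : has_S R -> S_prop F.
Proof.
rewrite /has_S; set us := [seq S <- _ | _]; set RN := N.of_nat R; set tbl := foldr _ _ _.
case/and4P => R0 Rn /allP nR hall; have RN0 : (0 < RN)%num by rewrite /RN; lia.
have RNE : nat_of RN = R by rewrite Nat2N.id.
have coprime_n X : coprime X R -> coprime X n.
  move=> cX; apply: coprime_prime_divisors => // l lp ln; apply/negP => lX.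
  have lR : (l %| R)%N by rewrite nR // mem_primes lp n0.
  have : (l %| gcdn X R)%N by rewrite dvdn_gcd lX.
  by move: cX; rewrite /coprime => /eqP ->; rewrite dvdn1 => /eqP l1; rewrite l1 in lp.
have tblP k y : tget k tbl = Some y -> exists2 S, S \in us & y = N.of_nat S.
  rewrite /tbl; elim: (us) => //= S ss IH h; case: (tget_put h) => [->|/IH[S' S'in ->]].
    by exists S; rewrite ?mem_head.
  by exists S'; rewrite ?inE ?S'in ?orbT.
have unit_coprime z x X : residue RN z x ->
    (if tget (N.succ_pos x) tbl is Some y then N.eqb x y else false) ->
    (X%:Z = z %[mod R])%Z -> coprime X n.
  move=> rx; case E: (tget _ _) => [y|//] /N.eqb_eq xy eX; have [S Sin yE] := tblP _ _ E.
  have cS : coprime S R by move: Sin; rewrite mem_filter => /andP[].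
  have xX : nat_of x = (X %% R)%N.
    by apply/eqP; rewrite -eqz_nat rx RNE -eX modz_nat.
  by apply: coprime_n; rewrite -coprime_modl -xX xy yE Nat2N.id.
apply: (S_prop_units gP') => U V; rewrite Fq -/n.
have resP W : N.of_nat (W %% R) \in [seq N.of_nat x | x <- iota 0 R].
  by rewrite map_f // mem_iota /= add0n ltn_mod.
have := allP (allP hall _ (resP U)) _ (resP V) => /hasP[w /mapP[[i j] ijin ew]]; rewrite {w}ew /=.
move: ijin; rewrite /zech_pairs => /allpairsPdep[i' [j' [i'in j'in [-> ->]]]] {i j}.
move: j'in; rewrite mem_filter => /andP[/eqLP zech j'in].
move: i'in j'in; rewrite !mem_iota /= !add0n => i'n j'n.
case: ifP => // _ /hasP[_ /mapP[S Sin ->] /and3P[uA uB uC]].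
have res W : residue RN W%:Z (N.of_nat (W %% R)) by rewrite /residue Nat2N.id RNE modz_nat.
have resS : residue RN S%:Z (N.of_nat S).
  rewrite /residue Nat2N.id RNE modz_nat modn_small //.
  by move: Sin; rewrite mem_filter mem_iota => /andP[_].
have rx := residue_add RN0 (res i') (residue_opp RN0 (res U)).
have ry := residue_add RN0 (res j') (residue_opp RN0 (res V)).
have n1 : n%:Z = n.-1%:Z + 1 by rewrite -[in LHS](prednK n0) -addn1.
have shift (X : nat) (z w : int) : X%:Z = z + n%:Z * w -> (X%:Z = z %[mod R])%Z.
  by move=> ->; have [k ->] := dvdnP Rn; rewrite PoszM mulrAC addrC modzMDl.
have neg (X : nat) : (n.-1 * X)%:Z = n%:Z * X%:Z - X%:Z by rewrite PoszM n1 mulrDl mul1r addrK.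
pose A := (S + i' + n.-1 * U)%N; pose B := (S + j' + n.-1 * V)%N.
(* [D] represents [- C]: once [n] divides [C + D], coprimality to [n] passes from [D] to [C]. *)
pose D := (S + i' + j' + n.-1 * (U + V))%N.
have eA : A%:Z = S%:Z + i'%:Z - U%:Z + n%:Z * U%:Z by rewrite /A !PoszD neg; move: (S%:Z) (i'%:Z) (U%:Z) (n%:Z) => z0 z1 z2 z3; ring.
have eB : B%:Z = S%:Z + j'%:Z - V%:Z + n%:Z * V%:Z by rewrite /B !PoszD neg; move: (S%:Z) (j'%:Z) (V%:Z) (n%:Z) => z0 z1 z2 z3; ring.
have eD : D%:Z = S%:Z + i'%:Z + j'%:Z - U%:Z - V%:Z + n%:Z * (U%:Z + V%:Z).
  by rewrite /D !PoszD neg PoszD; move: (S%:Z) (i'%:Z) (j'%:Z) (U%:Z) (V%:Z) (n%:Z) => z0 z1 z2 z3 z4 z5; ring.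
clearbody A B D; pose C := (S + n.-1 * A + n.-1 * B)%N.
have eC : C%:Z = S%:Z - A%:Z - B%:Z + n%:Z * (A%:Z + B%:Z).
  by rewrite /C !PoszD !neg; move: (A%:Z) (B%:Z) (S%:Z) (n%:Z) => z0 z1 z2 z3; ring.
clearbody C; have rA := residue_add RN0 resS rx.
have cA : coprime A n by apply: unit_coprime rA uA _; apply: shift; rewrite eA addrA.
have cB : coprime B n by apply: unit_coprime (residue_add RN0 resS ry) uB _; apply: shift; rewrite eB addrA.
have cD : coprime D n.
  by apply: unit_coprime (residue_add RN0 rA ry) uC _; apply: (shift _ _ (U%:Z + V%:Z)); rewrite eD; move: (S%:Z) (i'%:Z) (j'%:Z) (U%:Z) (V%:Z) (n%:Z) => z0 z1 z2 z3 z4 z5; ring.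
have cS : coprime S n.
  by apply: coprime_n; move: Sin; rewrite mem_filter => /andP[].
have nCD : (n %| C + D)%N.
  apply/dvdnP; exists (A + B)%N; apply/eqP; rewrite -eqz_nat PoszM !PoszD eC eD eA eB.
  by apply/eqP; move: (S%:Z) (i'%:Z) (j'%:Z) (U%:Z) (V%:Z) (n%:Z) => z0 z1 z2 z3 z4 z5; ring.
exists i', j', S, A, B, C; split; first by rewrite -!ev_power // -(evalL_add _ charp) zech /= evalL_nseq0 mulr0 addr0.
  split=> //; apply: coprime_prime_divisors => // l lp ln; apply/negP => lC.
  have lD : (l %| D)%N by rewrite -(dvdn_addr _ lC) (dvdn_trans ln).
  have : (l %| gcdn D n)%N by rewrite dvdn_gcd lD.
  by move: cD; rewrite /coprime => /eqP ->; rewrite dvdn1 => /eqP l1; rewrite l1 in lp.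
by exists U%:Z, V%:Z, (A%:Z + B%:Z).
Qed.
End Generator.
End SmallFields.

(** * Certificates for the exceptional values *)

(* Characteristic, degree and search parameters for the fields that are not prime. *)
Definition ext_parameters : seq (N * (N * nat * option nat * nat * nat)) :=
  [:: (8%num, (2%num, 3, Some 0, 30, 60));
      (16%num, (2%num, 4, Some 0, 30, 60));
      (27%num, (3%num, 3, Some 0, 30, 60));
      (32%num, (2%num, 5, Some 0, 30, 60));
      (64%num, (2%num, 6, Some 0, 30, 60));
      (125%num, (5%num, 3, Some 0, 30, 60));
      (256%num, (2%num, 8, Some 0, 60, 120));
      (289%num, (17%num, 2, Some 0, 30, 60));
      (343%num, (7%num, 3, Some 0, 30, 60));
      (361%num, (19%num, 2, Some 0, 30, 60));
      (529%num, (23%num, 2, Some 0, 30, 60));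
      (625%num, (5%num, 4, Some 0, 30, 60));
      (729%num, (3%num, 6, Some 0, 60, 120));
      (841%num, (29%num, 2, Some 0, 30, 60));
      (961%num, (31%num, 2, Some 0, 30, 60));
      (1024%num, (2%num, 10, Some 0, 60, 120));
      (1331%num, (11%num, 3, Some 0, 30, 60));
      (1369%num, (37%num, 2, Some 0, 30, 60));
      (1681%num, (41%num, 2, Some 0, 30, 60));
      (1849%num, (43%num, 2, Some 0, 30, 60));
      (2197%num, (13%num, 3, Some 0, 30, 60));
      (2209%num, (47%num, 2, Some 0, 30, 60));
      (2401%num, (7%num, 4, Some 0, 60, 120));
      (2809%num, (53%num, 2, Some 0, 30, 60));
      (3481%num, (59%num, 2, Some 0, 30, 60));
      (3721%num, (61%num, 2, Some 0, 30, 60));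
      (4096%num, (2%num, 12, Some 1, 1, 1500));
      (4489%num, (67%num, 2, Some 0, 30, 60));
      (5041%num, (71%num, 2, Some 1, 60, 60));
      (6241%num, (79%num, 2, Some 0, 30, 60));
      (6889%num, (83%num, 2, Some 0, 30, 60));
      (7921%num, (89%num, 2, Some 0, 30, 60));
      (10201%num, (101%num, 2, Some 0, 30, 60));
      (10609%num, (103%num, 2, Some 0, 30, 60));
      (11881%num, (109%num, 2, Some 1, 60, 60));
      (12769%num, (113%num, 2, Some 0, 30, 60));
      (14641%num, (11%num, 4, Some 0, 100, 300));
      (15625%num, (5%num, 6, None, 250, 1000));
      (17161%num, (131%num, 2, Some 1, 60, 60));
      (19321%num, (139%num, 2, Some 1, 60, 60));
      (22201%num, (149%num, 2, Some 0, 30, 60));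
      (22801%num, (151%num, 2, Some 0, 30, 60));
      (28561%num, (13%num, 4, Some 2, 300, 1200));
      (32041%num, (179%num, 2, Some 0, 30, 60));
      (32761%num, (181%num, 2, Some 1, 60, 60));
      (36481%num, (191%num, 2, Some 0, 30, 60));
      (38809%num, (197%num, 2, Some 0, 30, 60));
      (39601%num, (199%num, 2, Some 0, 30, 60));
      (44521%num, (211%num, 2, Some 1, 60, 60));
      (52441%num, (229%num, 2, Some 1, 60, 60));
      (57121%num, (239%num, 2, Some 1, 60, 60));
      (58081%num, (241%num, 2, Some 0, 30, 60));
      (63001%num, (251%num, 2, Some 0, 30, 60));
      (78961%num, (281%num, 2, Some 1, 60, 60));
      (94249%num, (307%num, 2, Some 1, 60, 60));
      (96721%num, (311%num, 2, Some 1, 60, 60));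
      (109561%num, (331%num, 2, Some 1, 60, 60));
      (121801%num, (349%num, 2, Some 1, 60, 60));
      (143641%num, (379%num, 2, Some 1, 60, 60));
      (175561%num, (419%num, 2, Some 2, 100, 200));
      (177241%num, (421%num, 2, None, 60, 120));
      (212521%num, (461%num, 2, Some 2, 100, 200));
      (241081%num, (491%num, 2, None, 100, 200));
      (326041%num, (571%num, 2, None, 100, 200));
      (434281%num, (659%num, 2, None, 100, 400));
      (491401%num, (701%num, 2, None, 100, 200));
      (591361%num, (769%num, 2, None, 100, 200));
      (737881%num, (859%num, 2, None, 200, 600));
      (829921%num, (911%num, 2, Some 2, 100, 200));
      (1042441%num, (1021%num, 2, Some 2, 100, 200));
      (1190281%num, (1091%num, 2, None, 200, 600));
      (1515361%num, (1231%num, 2, None, 200, 600));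
      (2042041%num, (1429%num, 2, None, 300, 1200));
      (7447441%num, (2729%num, 2, None, 300, 1200))]%N.

Definition ext_cert_of (n : N) (ls : seq N) : option cert :=
  if [seq x <- ext_parameters | N.eqb x.1 (N.succ n)] is (_, (p, k, exact, D, m)) :: _ then ext_cert n ls exact p k D m
  else None.

(** A hint below 1000, other than 0 and 1, gives the range of integers from which points are taken.
    A hint [1000 k + M] with [1 <= k <= 8] asks for range [M] and the selection by [cover] at depth
    [k - 1]; 9000 refers to [ext_parameters]. *)
Definition resolutions (k : nat) (hints : seq N) : seq resolution :=
  [seq find_resolution ext_cert_of eh.1 eh.2 | eh <- zip (exception_block k) hints].

Definition resolutions0 := Eval vm_compute in resolutions 0
  [:: 1; 1; 1; 1072; 2090; 0; 0; 0; 0; 0; 4900; 0; 0; 600; 600; 597; 0; 0; 598; 0; 0; 0; 595; 593; 498; 0; 499;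
   0; 0; 0; 493; 0; 499; 587; 0; 3200; 700; 600; 600; 0; 0; 0; 499; 0; 0; 0; 0; 449; 0; 0; 0; 0; 0; 0; 0; 0; 597;
   0; 0; 0; 499; 450; 330; 292; 0; 0; 0; 500; 0; 596; 299; 0; 499; 0; 0; 246; 0; 0; 245; 299; 0; 248; 0; 223; 0;
   0; 0; 300; 0; 0; 224; 0; 247; 225; 224; 269; 0; 0; 0; 248]%num.
Lemma resolutions0_ok : all2 resolve (exception_block 0) resolutions0.
Proof. vm_cast_no_check (erefl true). Qed.

Definition resolutions1 := Eval vm_compute in resolutions 1
  [:: 0; 0; 0; 0; 0; 0; 225; 224; 247; 250; 0; 0; 224; 249; 0; 244; 0; 200; 0; 225; 250; 0; 249; 223; 149; 355;
   0; 0; 0; 0; 0; 327; 0; 0; 522; 0; 699; 593; 0; 0; 449; 598; 0; 0; 357; 0; 0; 0; 0; 500; 599; 0; 0; 0; 0; 0; 0;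
   0; 271; 0; 299; 0; 271; 0; 241; 0; 0; 0; 0; 271; 0; 249; 224; 0; 223; 0; 0; 249; 0; 250; 0; 200; 225; 224; 0;
   220; 0; 0; 0; 0; 0; 247; 0; 250; 0; 0; 149; 0; 297; 0]%num.
Lemma resolutions1_ok : all2 resolve (exception_block 1) resolutions1.
Proof. vm_cast_no_check (erefl true). Qed.

Definition resolutions2 := Eval vm_compute in resolutions 2
  [:: 0; 250; 0; 0; 0; 0; 329; 0; 0; 0; 0; 0; 0; 0; 298; 0; 199; 0; 247; 223; 220; 249; 223; 198; 0; 0; 224; 0;
   0; 225; 225; 0; 0; 0; 0; 241; 0; 0; 200; 0; 0; 0; 224; 223; 0; 199; 0; 0; 200; 0; 0; 200; 0; 0; 179; 0; 2054;
   0; 0; 213; 200; 181; 221; 0; 0; 0; 0; 0; 199; 181; 0; 0; 0; 0; 199; 0; 0; 200; 223; 0; 196; 225; 0; 0; 0; 0;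
   220; 0; 0; 0; 0; 181; 130; 0; 200; 0; 199; 0; 197; 0]%num.
Lemma resolutions2_ok : all2 resolve (exception_block 2) resolutions2.
Proof. vm_cast_no_check (erefl true). Qed.

Definition resolutions3 := Eval vm_compute in resolutions 3
  [:: 121; 0; 0; 110; 90; 0; 0; 107; 89; 0; 0; 0; 0; 99; 0; 0; 0; 0; 90; 0; 0; 121; 95; 0; 0; 110; 99; 108; 0;
   90; 0; 0; 0; 0; 0; 0; 88; 90; 0; 109; 0; 100; 0; 0; 0; 119; 0; 89; 0; 99; 89; 0; 0; 81; 0; 0; 108; 0; 0; 0; 0;
   0; 90; 0; 81; 0; 0; 0; 0; 0; 0; 0; 0; 0; 0; 0; 0; 0; 0; 0; 86; 89; 0; 0; 0; 0; 0; 0; 99; 98; 0; 0; 0; 0; 0; 0;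
   0; 0; 150; 398]%num.
Lemma resolutions3_ok : all2 resolve (exception_block 3) resolutions3.
Proof. vm_cast_no_check (erefl true). Qed.

Definition resolutions4 := Eval vm_compute in resolutions 4
  [:: 0; 0; 700; 0; 0; 0; 0; 0; 0; 293; 249; 0; 0; 0; 0; 323; 299; 0; 0; 0; 0; 0; 242; 0; 0; 0; 0; 0; 121; 0; 0;
   106; 118; 97; 0; 0; 0; 0; 0; 0; 100; 0; 0; 163; 0; 148; 0; 135; 1072; 2054; 248; 499; 495; 223; 181; 243; 0;
   0; 0; 0; 200; 0; 0; 0; 0; 0; 221; 0; 0; 0; 0; 200; 271; 0; 199; 219; 0; 0; 0; 0; 0; 109; 0; 0; 0; 0; 0; 0; 0;
   134; 0; 181; 0; 0; 109; 0; 87; 97; 0; 0]%num.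
Lemma resolutions4_ok : all2 resolve (exception_block 4) resolutions4.
Proof. vm_cast_no_check (erefl true). Qed.

Definition resolutions5 := Eval vm_compute in resolutions 5
  [:: 89; 0; 0; 104; 89; 0; 0; 0; 76; 0; 0; 0; 89; 81; 0; 0; 79; 0; 0; 0; 80; 0; 80; 80; 0; 0; 0; 0; 0; 81; 0;
   0; 0; 0; 81; 0; 0; 0; 0; 131; 0; 0; 0; 223; 200; 0; 0; 0; 199; 0; 109; 0; 0; 181; 0; 0; 100; 110; 0; 89; 0; 0;
   79; 81; 80; 0; 90; 81; 0; 0; 0; 0; 90; 100; 0; 90; 0; 0; 81; 80; 89; 0; 0; 0; 0; 80; 0; 0; 52; 0; 0; 1072;
   106; 181; 0; 90; 0; 0; 0; 0]%num.
Lemma resolutions5_ok : all2 resolve (exception_block 5) resolutions5.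
Proof. vm_cast_no_check (erefl true). Qed.

Definition resolutions6 := Eval vm_compute in resolutions 6
  [:: 0; 0; 0; 0; 0; 66; 0; 0; 0; 0; 0; 0; 0; 81; 0; 0; 61; 0; 0; 0; 0; 80; 0; 0; 0; 0; 80; 0; 0; 0; 81; 0; 66;
   0; 81; 0; 0; 63; 2054; 0; 0; 81; 0; 65; 0; 79; 80; 81; 87; 0; 79; 0; 0; 53; 2054; 0; 78; 79; 81; 0; 66; 0; 0;
   43; 79; 77; 0; 80; 0; 110; 2054; 0; 77; 0; 0; 0; 0; 0; 52; 44; 0; 44; 53; 0; 0; 0; 0; 53; 0; 0; 38; 0; 53; 52;
   0; 49; 0; 41; 0; 53]%num.
Lemma resolutions6_ok : all2 resolve (exception_block 6) resolutions6.
Proof. vm_cast_no_check (erefl true). Qed.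

Definition resolutions7 := Eval vm_compute in resolutions 7
  [:: 43; 0; 0; 0; 44; 0; 0; 54; 53; 0; 53; 0; 0; 0; 53; 42; 54; 0; 0; 53; 0; 0; 0; 53; 47; 0; 44; 0; 0; 42; 0;
   0; 0; 0; 0; 0; 54; 44; 0; 0; 0; 54; 0; 0; 44; 0; 53; 0; 0; 0; 0; 0; 0; 0; 0; 52; 0; 0; 44; 0; 0; 0; 0; 0; 0;
   0; 54; 43; 0; 53; 0; 0; 52; 0; 44; 53; 0; 0; 0; 0; 358; 700; 0; 0; 0; 0; 0; 0; 299; 0; 0; 0; 0; 0; 0; 0; 248;
   0; 0; 0]%num.
Lemma resolutions7_ok : all2 resolve (exception_block 7) resolutions7.
Proof. vm_cast_no_check (erefl true). Qed.

Definition resolutions8 := Eval vm_compute in resolutions 8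
  [:: 0; 0; 297; 0; 0; 0; 0; 0; 0; 0; 0; 0; 241; 326; 0; 149; 0; 0; 0; 134; 110; 0; 0; 0; 0; 110; 0; 0; 0; 100;
   0; 109; 0; 0; 0; 0; 0; 0; 108; 90; 119; 0; 0; 0; 0; 0; 0; 0; 0; 0; 53; 135; 296; 0; 0; 119; 121; 0; 121; 133;
   0; 90; 0; 0; 81; 0; 0; 110; 110; 0; 0; 0; 0; 0; 0; 63; 0; 0; 0; 50; 99; 0; 0; 0; 0; 53; 0; 0; 53; 0; 53; 43;
   0; 0; 0; 0; 54; 43; 0; 0]%num.
Lemma resolutions8_ok : all2 resolve (exception_block 8) resolutions8.
Proof. vm_cast_no_check (erefl true). Qed.

Definition resolutions9 := Eval vm_compute in resolutions 9
  [:: 0; 0; 0; 0; 0; 81; 0; 359; 0; 330; 150; 149; 131; 0; 134; 0; 0; 0; 0; 54; 0; 0; 66; 0; 0; 80; 0; 0; 0; 0;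
   0; 0; 163; 0; 0; 99; 0; 0; 0; 0; 0; 0; 0; 0; 0; 79; 0; 86; 81; 0; 77; 0; 62; 65; 0; 66; 0; 0; 0; 65; 0; 0; 0;
   0; 1072; 0; 0; 100; 80; 0; 0; 0; 74; 81; 0; 0; 0; 0; 0; 0; 0; 81; 0; 0; 50; 2054; 0; 0; 75; 80; 66; 65; 0; 0;
   0; 0; 0; 0; 2054; 79]%num.
Lemma resolutions9_ok : all2 resolve (exception_block 9) resolutions9.
Proof. vm_cast_no_check (erefl true). Qed.

Definition resolutions10 := Eval vm_compute in resolutions 10
  [:: 0; 80; 66; 65; 0; 65; 66; 0; 43; 0; 0; 0; 0; 64; 44; 0; 0; 52; 0; 44; 0; 0; 41; 0; 0; 0; 44; 35; 0; 52; 0;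
   0; 0; 0; 44; 0; 0; 0; 0; 53; 44; 0; 0; 42; 48; 34; 0; 0; 0; 0; 0; 0; 0; 0; 43; 48; 0; 0; 0; 0; 66; 43; 0; 0;
   46; 0; 44; 0; 0; 53; 0; 0; 0; 0; 0; 0; 51; 0; 43; 43; 44; 53; 0; 0; 0; 0; 0; 81; 0; 0; 0; 65; 66; 0; 0; 0; 0;
   0; 65; 0]%num.
Lemma resolutions10_ok : all2 resolve (exception_block 10) resolutions10.
Proof. vm_cast_no_check (erefl true). Qed.

Definition resolutions11 := Eval vm_compute in resolutions 11
  [:: 0; 0; 0; 36; 0; 36; 0; 36; 0; 0; 35; 36; 35; 0; 0; 0; 36; 36; 0; 0; 0; 34; 0; 36; 0; 0; 24; 0; 0; 1072; 0;
   0; 0; 0; 0; 0; 0; 0; 31; 29; 35; 30; 0; 0; 39; 0; 0; 0; 0; 0; 0; 24; 0; 43; 0; 0; 0; 30; 0; 0; 0; 0; 30; 0;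
   30; 23; 1072; 0; 0; 35; 0; 33; 0; 0; 0; 0; 0; 1072; 0; 0; 0; 29; 0; 36; 19; 29; 0; 1072; 0; 0; 0; 0; 0; 23;
   18; 0; 20; 18; 0; 19]%num.
Lemma resolutions11_ok : all2 resolve (exception_block 11) resolutions11.
Proof. vm_cast_no_check (erefl true). Qed.

Definition resolutions12 := Eval vm_compute in resolutions 12
  [:: 19; 0; 19; 19; 0; 0; 0; 0; 0; 0; 19; 21; 0; 0; 0; 0; 0; 0; 0; 19; 0; 0; 17; 0; 19; 0; 21; 23; 0; 0; 0; 0;
   0; 20; 19; 0; 23; 0; 20; 0; 54; 0; 0; 1; 1072; 0; 0; 360; 0; 0; 0; 0; 0; 0; 0; 0; 359; 600; 0; 0; 0; 0; 293;
   0; 297; 271; 0; 293; 0; 0; 0; 0; 271; 0; 0; 0; 0; 0; 0; 297; 0; 181; 0; 330; 3200; 0; 0; 599; 0; 0; 0; 296; 0;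
   250; 0; 0; 0; 0; 299; 248]%num.
Lemma resolutions12_ok : all2 resolve (exception_block 12) resolutions12.
Proof. vm_cast_no_check (erefl true). Qed.

Definition resolutions13 := Eval vm_compute in resolutions 13
  [:: 271; 225; 0; 0; 299; 0; 0; 0; 0; 249; 0; 0; 149; 0; 249; 248; 0; 0; 0; 0; 0; 0; 0; 120; 0; 0; 0; 121; 109;
   0; 0; 0; 109; 0; 0; 0; 0; 0; 0; 100; 0; 0; 100; 89; 0; 0; 0; 90; 0; 98; 0; 0; 108; 90; 0; 100; 0; 0; 0; 89;
   66; 148; 398; 299; 0; 399; 149; 0; 0; 0; 0; 0; 0; 0; 0; 0; 133; 0; 199; 0; 0; 0; 0; 0; 0; 181; 0; 133; 0; 131;
   0; 96; 0; 0; 0; 0; 0; 85; 0; 79]%num.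
Lemma resolutions13_ok : all2 resolve (exception_block 13) resolutions13.
Proof. vm_cast_no_check (erefl true). Qed.

Definition resolutions14 := Eval vm_compute in resolutions 14
  [:: 79; 79; 0; 0; 52; 0; 0; 0; 0; 0; 0; 0; 0; 97; 0; 110; 0; 0; 0; 53; 0; 100; 99; 0; 0; 0; 81; 0; 0; 99; 0;
   79; 0; 0; 90; 0; 52; 53; 0; 44; 53; 0; 0; 0; 0; 53; 0; 54; 0; 0; 0; 51; 52; 0; 0; 43; 44; 52; 0; 0; 53; 0; 0;
   0; 0; 0; 0; 0; 43; 0; 53; 0; 0; 0; 79; 0; 0; 326; 0; 0; 165; 0; 0; 147; 133; 0; 121; 0; 0; 0; 0; 0; 66; 181;
   63; 0; 0; 0; 63; 121]%num.
Lemma resolutions14_ok : all2 resolve (exception_block 14) resolutions14.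
Proof. vm_cast_no_check (erefl true). Qed.

Definition resolutions15 := Eval vm_compute in resolutions 15
  [:: 0; 0; 0; 0; 44; 49; 63; 0; 0; 0; 165; 0; 0; 0; 0; 0; 110; 181; 0; 0; 0; 0; 79; 0; 0; 54; 0; 0; 0; 0; 0; 0;
   0; 0; 95; 42; 0; 46; 0; 0; 52; 43; 0; 0; 52; 43; 0; 0; 43; 0; 0; 0; 0; 43; 0; 0; 0; 0; 43; 0; 1072; 0; 81; 41;
   0; 54; 0; 34; 35; 0; 35; 23; 0; 0; 37; 0; 0; 0; 54; 20; 0; 0; 0; 33; 20; 0; 24; 0; 0; 29; 22; 0; 0; 9000; 0;
   20; 0; 0; 0; 0]%num.
Lemma resolutions15_ok : all2 resolve (exception_block 15) resolutions15.
Proof. vm_cast_no_check (erefl true). Qed.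

Definition resolutions16 := Eval vm_compute in resolutions 16
  [:: 0; 17; 20; 54; 0; 12; 1072; 0; 0; 448; 4600; 0; 0; 395; 329; 0; 295; 299; 0; 149; 0; 0; 0; 0; 0; 0; 0; 0;
   135; 0; 135; 0; 131; 133; 0; 0; 99; 0; 0; 0; 0; 100; 0; 0; 0; 134; 0; 0; 119; 0; 135; 0; 0; 0; 0; 0; 89; 62;
   0; 0; 65; 53; 53; 0; 0; 0; 0; 44; 0; 53; 0; 0; 0; 0; 0; 0; 400; 0; 135; 134; 0; 0; 0; 0; 22; 44; 98; 0; 54;
   55; 0; 43; 0; 0; 0; 0; 0; 0; 0; 43]%num.
Lemma resolutions16_ok : all2 resolve (exception_block 16) resolutions16.
Proof. vm_cast_no_check (erefl true). Qed.

Definition resolutions17 := Eval vm_compute in resolutions 17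
  [:: 0; 0; 23; 0; 0; 0; 0; 0; 29; 0; 0; 359; 0; 360; 0; 149; 135; 0; 0; 0; 0; 0; 132; 53; 65; 53; 0; 46; 81; 0;
   28; 0; 0; 0; 0; 28; 0; 0; 0; 0; 0; 150; 0; 0; 0; 148; 0; 0; 0; 0; 0; 0; 0; 92; 0; 0; 100; 0; 0; 0; 99; 0; 0;
   0; 0; 0; 0; 51; 0; 0; 0; 0; 46; 0; 0; 0; 35; 0; 36; 0; 0; 0; 0; 30; 0; 0; 32; 0; 0; 53; 0; 0; 53; 0; 0; 44; 0;
   0; 0; 0]%num.
Lemma resolutions17_ok : all2 resolve (exception_block 17) resolutions17.
Proof. vm_cast_no_check (erefl true). Qed.

Definition resolutions18 := Eval vm_compute in resolutions 18
  [:: 0; 0; 0; 0; 0; 44; 0; 36; 30; 0; 0; 0; 0; 15; 0; 0; 0; 16; 0; 19; 19; 13; 0; 0; 0; 0; 0; 0; 0; 10; 23; 0;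
   0; 0; 0; 0; 0; 0; 0; 0; 17; 0; 20; 0; 1; 0; 0; 27; 0; 0; 0; 0; 0; 0; 0; 0; 0; 0; 0; 0; 8; 0; 0; 0; 0; 13; 36;
   1072; 0; 0; 0; 0; 0; 0; 0; 9000; 8; 0; 8; 0; 0; 0; 0; 9; 0; 36; 36; 1; 1; 1; 9000; 2090; 373; 9000; 0; 697;
   599; 599; 600; 0]%num.
Lemma resolutions18_ok : all2 resolve (exception_block 18) resolutions18.
Proof. vm_cast_no_check (erefl true). Qed.

Definition resolutions19 := Eval vm_compute in resolutions 19
  [:: 0; 0; 0; 595; 599; 0; 327; 696; 0; 597; 0; 599; 0; 9000; 600; 599; 600; 9000; 300; 0; 0; 0; 0; 9000; 0;
   249; 0; 0; 0; 0; 0; 0; 225; 241; 299; 0; 269; 250; 0; 249; 245; 0; 0; 0; 162; 0; 329; 0; 0; 357; 0; 595; 0; 0;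
   299; 0; 0; 249; 0; 0; 0; 271; 0; 0; 0; 0; 0; 0; 225; 0; 0; 0; 0; 250; 0; 0; 9000; 135; 2090; 0; 0; 0; 0; 0; 0;
   246; 245; 0; 217; 0; 0; 0; 9000; 0; 0; 0; 224; 222; 0; 0]%num.
Lemma resolutions19_ok : all2 resolve (exception_block 19) resolutions19.
Proof. vm_cast_no_check (erefl true). Qed.

Definition resolutions20 := Eval vm_compute in resolutions 20
  [:: 0; 199; 225; 181; 199; 0; 9000; 220; 0; 224; 0; 0; 223; 0; 0; 0; 150; 120; 0; 0; 0; 9000; 0; 135; 0; 0; 0;
   99; 0; 100; 0; 0; 0; 0; 0; 0; 109; 0; 0; 0; 0; 0; 0; 0; 108; 0; 0; 89; 90; 0; 0; 0; 9000; 0; 0; 0; 0; 0; 90;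
   0; 0; 0; 99; 0; 97; 0; 0; 99; 0; 2054; 0; 450; 0; 0; 298; 0; 148; 0; 0; 0; 132; 146; 135; 0; 0; 121; 9000; 0;
   0; 0; 79; 0; 0; 1072; 9000; 248; 9000; 0; 0; 0]%num.
Lemma resolutions20_ok : all2 resolve (exception_block 20) resolutions20.
Proof. vm_cast_no_check (erefl true). Qed.

Definition resolutions21 := Eval vm_compute in resolutions 21
  [:: 0; 225; 9000; 200; 0; 133; 0; 0; 197; 181; 0; 0; 0; 0; 99; 0; 0; 86; 0; 0; 0; 0; 0; 0; 0; 0; 81; 9000; 0;
   0; 81; 0; 81; 81; 81; 0; 0; 0; 0; 0; 0; 0; 100; 0; 0; 0; 0; 0; 0; 0; 0; 0; 85; 0; 0; 0; 0; 0; 0; 79; 0; 0; 0;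
   0; 0; 89; 0; 96; 89; 89; 0; 0; 0; 0; 70; 9000; 0; 0; 0; 81; 65; 0; 0; 53; 0; 0; 0; 88; 87; 81; 9000; 80; 9000;
   54; 0; 0; 54; 53; 0; 65]%num.
Lemma resolutions21_ok : all2 resolve (exception_block 21) resolutions21.
Proof. vm_cast_no_check (erefl true). Qed.

Definition resolutions22 := Eval vm_compute in resolutions 22
  [:: 0; 54; 43; 0; 0; 0; 0; 0; 0; 53; 0; 0; 43; 0; 0; 0; 49; 43; 0; 0; 0; 0; 53; 0; 43; 0; 0; 0; 64; 0; 52; 54;
   49; 0; 44; 0; 47; 0; 0; 0; 0; 44; 44; 0; 0; 54; 81; 1072; 2054; 0; 399; 0; 0; 0; 330; 0; 0; 0; 0; 181; 0; 296;
   299; 0; 0; 0; 132; 162; 9000; 129; 0; 0; 0; 0; 109; 0; 0; 0; 75; 0; 0; 0; 0; 0; 0; 0; 0; 0; 0; 109; 0; 9000;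
   0; 0; 53; 0; 9000; 0; 43; 53]%num.
Lemma resolutions22_ok : all2 resolve (exception_block 22) resolutions22.
Proof. vm_cast_no_check (erefl true). Qed.

Definition resolutions23 := Eval vm_compute in resolutions 23
  [:: 0; 44; 0; 0; 28; 89; 181; 0; 165; 0; 0; 0; 0; 53; 1; 9000; 0; 0; 181; 0; 0; 0; 81; 0; 0; 0; 0; 79; 0; 0;
   0; 0; 0; 0; 0; 81; 0; 89; 0; 81; 0; 52; 44; 0; 0; 0; 0; 0; 89; 73; 0; 0; 44; 52; 9000; 0; 0; 0; 0; 0; 43; 0;
   0; 0; 0; 0; 0; 0; 0; 53; 51; 0; 0; 0; 43; 0; 81; 0; 0; 0; 59; 52; 0; 0; 81; 0; 43; 0; 0; 0; 9000; 0; 43; 0; 0;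
   39; 0; 36; 36; 0]%num.
Lemma resolutions23_ok : all2 resolve (exception_block 23) resolutions23.
Proof. vm_cast_no_check (erefl true). Qed.

Definition resolutions24 := Eval vm_compute in resolutions 24
  [:: 0; 0; 0; 1072; 0; 0; 34; 32; 0; 0; 0; 36; 0; 24; 20; 36; 0; 34; 0; 0; 20; 0; 0; 0; 0; 0; 0; 0; 0; 19; 18;
   0; 0; 0; 20; 0; 26; 0; 20; 20; 0; 0; 26; 0; 18; 19; 21; 0; 0; 0; 0; 0; 54; 1072; 9000; 2054; 0; 0; 0; 600; 0;
   395; 399; 0; 0; 295; 270; 0; 0; 299; 267; 0; 9000; 0; 0; 0; 328; 270; 249; 249; 0; 0; 134; 293; 0; 269; 149;
   0; 0; 0; 149; 135; 0; 0; 0; 0; 0; 0; 0; 109]%num.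
Lemma resolutions24_ok : all2 resolve (exception_block 24) resolutions24.
Proof. vm_cast_no_check (erefl true). Qed.

Definition resolutions25 := Eval vm_compute in resolutions 25
  [:: 0; 130; 0; 0; 0; 0; 0; 104; 0; 0; 0; 0; 146; 148; 150; 0; 0; 121; 0; 0; 0; 0; 107; 0; 110; 89; 0; 0; 0; 0;
   109; 0; 109; 99; 0; 54; 0; 88; 54; 150; 0; 0; 65; 0; 0; 0; 53; 54; 0; 54; 44; 54; 0; 0; 44; 9000; 0; 0; 0; 0;
   39; 79; 0; 0; 0; 0; 0; 0; 0; 0; 0; 81; 135; 0; 0; 0; 0; 31; 9000; 0; 0; 115; 9000; 77; 0; 54; 0; 87; 0; 0; 52;
   0; 9000; 0; 0; 42; 44; 43; 27; 9000]%num.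
Lemma resolutions25_ok : all2 resolve (exception_block 25) resolutions25.
Proof. vm_cast_no_check (erefl true). Qed.

Definition resolutions26 := Eval vm_compute in resolutions 26
  [:: 0; 0; 0; 0; 37; 29; 53; 0; 0; 9000; 27; 23; 0; 0; 24; 0; 0; 0; 0; 0; 65; 0; 0; 0; 330; 329; 0; 329; 271;
   162; 9000; 0; 0; 121; 0; 0; 119; 0; 0; 9000; 0; 120; 135; 0; 0; 65; 54; 50; 0; 0; 0; 0; 181; 9000; 0; 0; 54;
   0; 0; 44; 0; 29; 9000; 29; 0; 0; 0; 0; 0; 0; 0; 0; 164; 0; 0; 0; 43; 89; 1; 1072; 0; 0; 110; 0; 121; 0; 0; 0;
   0; 0; 0; 0; 0; 0; 43; 0; 0; 36; 0; 0]%num.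
Lemma resolutions26_ok : all2 resolve (exception_block 26) resolutions26.
Proof. vm_cast_no_check (erefl true). Qed.

Definition resolutions27 := Eval vm_compute in resolutions 27
  [:: 0; 0; 0; 0; 43; 0; 0; 17; 0; 0; 0; 19; 0; 0; 0; 15; 0; 15; 0; 0; 0; 52; 0; 0; 0; 0; 19; 54; 9000; 15; 0;
   20; 0; 9; 0; 0; 9; 0; 0; 9; 0; 0; 4; 1; 1072; 9000; 2090; 0; 695; 0; 0; 599; 9000; 0; 400; 0; 0; 358; 0; 0;
   297; 0; 0; 269; 245; 0; 0; 271; 0; 0; 0; 249; 0; 0; 150; 297; 0; 0; 300; 0; 300; 299; 0; 250; 326; 0; 0; 0;
   9000; 0; 0; 0; 0; 247; 0; 0; 0; 0; 0; 0]%num.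
Lemma resolutions27_ok : all2 resolve (exception_block 27) resolutions27.
Proof. vm_cast_no_check (erefl true). Qed.

Definition resolutions28 := Eval vm_compute in resolutions 28
  [:: 0; 0; 119; 0; 109; 0; 9000; 110; 0; 99; 0; 0; 0; 110; 0; 100; 0; 108; 0; 0; 0; 0; 98; 0; 0; 0; 0; 98; 99;
   0; 164; 0; 359; 0; 0; 135; 147; 0; 121; 0; 0; 0; 0; 0; 225; 0; 0; 0; 0; 0; 109; 0; 0; 0; 0; 0; 88; 0; 0; 0;
   2054; 0; 110; 109; 100; 9000; 0; 80; 81; 0; 0; 0; 90; 0; 0; 89; 53; 0; 89; 0; 43; 52; 0; 0; 0; 52; 0; 52; 0;
   9000; 0; 49; 0; 0; 0; 0; 0; 0; 0; 0]%num.
Lemma resolutions28_ok : all2 resolve (exception_block 28) resolutions28.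
Proof. vm_cast_no_check (erefl true). Qed.

Definition resolutions29 := Eval vm_compute in resolutions 29
  [:: 62; 0; 0; 0; 0; 0; 0; 53; 0; 34; 0; 149; 355; 0; 0; 0; 149; 0; 328; 0; 0; 149; 0; 0; 135; 0; 0; 0; 134; 0;
   51; 0; 9000; 0; 0; 65; 0; 0; 0; 164; 1072; 65; 121; 0; 0; 107; 0; 81; 0; 0; 81; 0; 0; 0; 89; 0; 0; 0; 0; 36;
   0; 54; 0; 0; 0; 0; 0; 41; 0; 0; 0; 66; 53; 9000; 0; 0; 0; 0; 36; 41; 0; 9000; 9000; 0; 0; 54; 0; 0; 0; 0; 0;
   24; 22; 0; 0; 0; 0; 29; 0; 18]%num.
Lemma resolutions29_ok : all2 resolve (exception_block 29) resolutions29.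
Proof. vm_cast_no_check (erefl true). Qed.

Definition resolutions30 := Eval vm_compute in resolutions 30
  [:: 0; 0; 19; 0; 0; 9000; 165; 0; 0; 300; 358; 0; 0; 0; 173; 0; 0; 0; 0; 0; 0; 0; 148; 133; 134; 120; 0; 110;
   0; 0; 79; 165; 0; 9000; 0; 0; 0; 0; 0; 0; 107; 53; 63; 53; 0; 0; 66; 0; 0; 0; 0; 0; 0; 0; 0; 163; 9000; 0; 25;
   0; 0; 0; 52; 0; 0; 0; 53; 29; 0; 42; 24; 0; 0; 19; 26; 14; 31; 81; 0; 0; 164; 0; 149; 0; 54; 0; 53; 53; 0; 0;
   0; 0; 44; 0; 35; 79; 149; 1; 0; 0]%num.
Lemma resolutions30_ok : all2 resolve (exception_block 30) resolutions30.
Proof. vm_cast_no_check (erefl true). Qed.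

Definition resolutions31 := Eval vm_compute in resolutions 31
  [:: 0; 0; 110; 0; 53; 0; 0; 0; 0; 0; 19; 0; 0; 19; 0; 0; 15; 25; 0; 9; 0; 0; 0; 0; 0; 0; 0; 1; 0; 2054; 0; 0;
   700; 0; 0; 0; 330; 299; 0; 299; 9000; 299; 165; 0; 0; 9000; 0; 0; 249; 9000; 0; 271; 133; 0; 134; 133; 0; 0;
   134; 0; 0; 100; 0; 0; 0; 0; 0; 146; 0; 181; 150; 0; 200; 53; 0; 0; 0; 0; 121; 0; 0; 9000; 9000; 0; 0; 0; 65;
   0; 0; 0; 53; 0; 64; 64; 53; 0; 0; 0; 0; 0]%num.
Lemma resolutions31_ok : all2 resolve (exception_block 31) resolutions31.
Proof. vm_cast_no_check (erefl true). Qed.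

Definition resolutions32 := Eval vm_compute in resolutions 32
  [:: 0; 0; 0; 9000; 0; 0; 357; 150; 0; 134; 149; 0; 0; 61; 0; 0; 25; 49; 109; 0; 100; 61; 0; 9000; 0; 43; 0; 0;
   0; 0; 0; 0; 44; 0; 0; 23; 0; 0; 0; 9000; 0; 0; 0; 0; 54; 9000; 0; 0; 165; 0; 0; 0; 181; 0; 0; 0; 135; 0; 0; 0;
   0; 0; 150; 0; 53; 66; 0; 54; 0; 0; 0; 24; 0; 50; 57; 24; 0; 0; 0; 79; 163; 164; 51; 0; 0; 0; 0; 0; 0; 0; 63;
   0; 0; 0; 18; 0; 36; 13; 9000; 0]%num.
Lemma resolutions32_ok : all2 resolve (exception_block 32) resolutions32.
Proof. vm_cast_no_check (erefl true). Qed.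

Definition resolutions33 := Eval vm_compute in resolutions 33
  [:: 0; 397; 0; 0; 359; 0; 0; 0; 0; 149; 0; 0; 0; 134; 135; 0; 0; 81; 0; 0; 0; 0; 0; 0; 121; 0; 0; 0; 0; 54;
   65; 0; 49; 48; 79; 0; 135; 0; 0; 0; 0; 0; 53; 0; 29; 49; 0; 0; 0; 0; 13; 0; 65; 0; 0; 0; 0; 149; 0; 61; 0;
   109; 0; 0; 27; 0; 0; 0; 0; 0; 0; 90; 0; 447; 359; 149; 0; 148; 181; 0; 79; 0; 0; 0; 9000; 0; 41; 0; 29; 61; 0;
   0; 24; 0; 0; 0; 0; 65; 0; 23]%num.
Lemma resolutions33_ok : all2 resolve (exception_block 33) resolutions33.
Proof. vm_cast_no_check (erefl true). Qed.

Definition resolutions34 := Eval vm_compute in resolutions 34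
  [:: 0; 89; 0; 0; 0; 0; 59; 0; 0; 37; 0; 9000; 1; 1; 1072; 2054; 0; 0; 0; 0; 0; 449; 449; 0; 450; 0; 445; 0; 0;
   250; 0; 0; 398; 449; 0; 359; 0; 217; 0; 399; 357; 0; 0; 0; 0; 0; 0; 191; 0; 0; 0; 0; 221; 180; 0; 0; 0; 149;
   0; 0; 0; 150; 161; 0; 0; 175; 164; 0; 109; 271; 0; 0; 2054; 239; 0; 0; 0; 0; 199; 398; 225; 0; 179; 0; 0; 0;
   149; 0; 165; 0; 0; 0; 0; 0; 0; 200; 180; 0; 165; 0]%num.
Lemma resolutions34_ok : all2 resolve (exception_block 34) resolutions34.
Proof. vm_cast_no_check (erefl true). Qed.

Definition resolutions35 := Eval vm_compute in resolutions 35
  [:: 0; 121; 2054; 0; 0; 0; 0; 0; 0; 172; 0; 0; 149; 141; 0; 0; 0; 0; 0; 143; 0; 0; 0; 0; 135; 135; 0; 0; 135;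
   0; 2054; 149; 164; 0; 134; 0; 165; 2054; 150; 0; 0; 0; 0; 0; 81; 81; 65; 0; 66; 0; 65; 0; 77; 63; 0; 65; 0; 0;
   0; 0; 0; 0; 65; 65; 0; 0; 62; 65; 0; 0; 51; 81; 63; 62; 0; 0; 0; 64; 0; 65; 0; 0; 0; 87; 0; 0; 0; 61; 66; 53;
   0; 0; 0; 2054; 0; 0; 0; 0; 0; 0]%num.
Lemma resolutions35_ok : all2 resolve (exception_block 35) resolutions35.
Proof. vm_cast_no_check (erefl true). Qed.

Definition resolutions36 := Eval vm_compute in resolutions 36
  [:: 0; 225; 0; 0; 0; 0; 89; 0; 0; 0; 80; 79; 0; 0; 0; 0; 0; 1072; 0; 150; 0; 0; 0; 0; 149; 134; 0; 0; 0; 0;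
   135; 0; 133; 0; 80; 0; 0; 80; 0; 0; 64; 0; 0; 53; 65; 53; 0; 63; 61; 53; 0; 0; 0; 0; 53; 0; 42; 0; 0; 43; 0;
   0; 0; 0; 0; 0; 65; 0; 63; 79; 0; 65; 49; 0; 0; 0; 54; 0; 0; 53; 0; 0; 66; 0; 0; 0; 0; 53; 0; 0; 0; 0; 0; 54;
   50; 53; 0; 0; 1072; 0]%num.
Lemma resolutions36_ok : all2 resolve (exception_block 36) resolutions36.
Proof. vm_cast_no_check (erefl true). Qed.

Definition resolutions37 := Eval vm_compute in resolutions 37
  [:: 0; 0; 0; 52; 0; 0; 54; 29; 1072; 66; 61; 0; 0; 52; 0; 0; 0; 0; 32; 36; 0; 0; 0; 36; 29; 35; 0; 35; 0; 36;
   0; 0; 0; 0; 29; 31; 0; 29; 30; 0; 0; 0; 0; 0; 35; 0; 0; 36; 0; 36; 0; 0; 0; 27; 0; 29; 29; 0; 0; 0; 0; 0; 0;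
   0; 27; 29; 0; 0; 0; 0; 81; 81; 1072; 2054; 107; 247; 0; 0; 217; 0; 0; 219; 199; 109; 0; 180; 0; 0; 181; 100;
   179; 0; 81; 0; 0; 81; 81; 0; 0; 0]%num.
Lemma resolutions37_ok : all2 resolve (exception_block 37) resolutions37.
Proof. vm_cast_no_check (erefl true). Qed.

Definition resolutions38 := Eval vm_compute in resolutions 38
  [:: 0; 0; 81; 43; 0; 0; 0; 0; 79; 0; 79; 0; 35; 97; 0; 83; 30; 53; 0; 0; 30; 0; 35; 29; 0; 29; 0; 35; 0; 20;
   0; 121; 0; 0; 0; 0; 0; 0; 0; 1; 1072; 65; 121; 0; 0; 66; 66; 52; 53; 0; 0; 53; 0; 0; 51; 110; 0; 1072; 54; 0;
   0; 0; 54; 0; 0; 0; 0; 0; 0; 52; 0; 54; 0; 0; 0; 43; 31; 0; 29; 0; 26; 0; 0; 0; 0; 0; 0; 0; 26; 29; 0; 23; 0;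
   35; 29; 0; 0; 0; 0; 29]%num.
Lemma resolutions38_ok : all2 resolve (exception_block 38) resolutions38.
Proof. vm_cast_no_check (erefl true). Qed.

Definition resolutions39 := Eval vm_compute in resolutions 39
  [:: 0; 24; 0; 81; 0; 0; 79; 30; 30; 0; 33; 81; 0; 1072; 27; 0; 0; 0; 25; 0; 0; 0; 0; 0; 30; 0; 0; 23; 0; 22;
   54; 19; 1072; 27; 31; 0; 0; 0; 23; 0; 0; 0; 0; 0; 1072; 0; 24; 0; 20; 0; 0; 0; 24; 0; 13; 0; 0; 14; 0; 0; 15;
   0; 0; 13; 0; 0; 15; 0; 15; 0; 0; 20; 14; 14; 0; 0; 0; 16; 13; 0; 0; 11; 0; 0; 0; 1; 0; 2054; 0; 0; 0; 0; 0;
   250; 223; 0; 181; 200; 0; 195]%num.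
Lemma resolutions39_ok : all2 resolve (exception_block 39) resolutions39.
Proof. vm_cast_no_check (erefl true). Qed.

Definition resolutions40 := Eval vm_compute in resolutions 40
  [:: 179; 0; 0; 110; 203; 0; 0; 0; 0; 0; 0; 0; 0; 0; 89; 0; 0; 177; 107; 0; 0; 0; 79; 96; 0; 81; 81; 79; 86;
   81; 0; 0; 0; 0; 64; 0; 0; 0; 64; 80; 0; 0; 0; 0; 109; 0; 99; 0; 2054; 0; 0; 0; 81; 0; 0; 79; 0; 0; 74; 79; 35;
   35; 81; 0; 0; 78; 0; 36; 0; 0; 0; 0; 0; 0; 36; 30; 29; 0; 32; 0; 0; 0; 0; 0; 30; 0; 0; 42; 29; 26; 0; 29; 81;
   0; 0; 108; 271; 0; 0; 100]%num.
Lemma resolutions40_ok : all2 resolve (exception_block 40) resolutions40.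
Proof. vm_cast_no_check (erefl true). Qed.

Definition resolutions41 := Eval vm_compute in resolutions 41
  [:: 0; 0; 0; 53; 44; 0; 33; 0; 0; 0; 21; 0; 1072; 0; 0; 65; 0; 0; 0; 54; 54; 28; 0; 0; 0; 33; 27; 28; 23; 30;
   34; 16; 0; 1072; 0; 0; 0; 0; 0; 0; 34; 15; 9000; 0; 9; 0; 0; 16; 0; 0; 0; 54; 0; 1072; 0; 0; 267; 0; 0; 224;
   107; 217; 0; 0; 97; 0; 0; 0; 81; 76; 0; 0; 110; 44; 99; 0; 97; 35; 35; 0; 41; 0; 0; 0; 0; 0; 119; 0; 43; 15;
   35; 0; 35; 0; 0; 0; 81; 0; 15; 0]%num.
Lemma resolutions41_ok : all2 resolve (exception_block 41) resolutions41.
Proof. vm_cast_no_check (erefl true). Qed.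

Definition resolutions42 := Eval vm_compute in resolutions 42
  [:: 54; 17; 0; 0; 0; 0; 0; 0; 0; 30; 0; 0; 53; 1; 1072; 0; 0; 0; 0; 0; 0; 29; 0; 63; 0; 0; 9000; 0; 0; 0; 23;
   0; 24; 0; 0; 15; 0; 0; 0; 0; 23; 0; 29; 9; 0; 0; 0; 11; 0; 0; 12; 0; 0; 15; 0; 0; 0; 36; 0; 0; 0; 0; 0; 23; 0;
   13; 0; 0; 0; 5; 0; 9000; 0; 0; 5; 6; 0; 0; 36; 0; 0; 1; 9000; 0; 0; 0; 0; 0; 0; 0; 0; 0; 0; 0; 0; 0; 0; 0; 0;
   0]%num.
Lemma resolutions42_ok : all2 resolve (exception_block 42) resolutions42.
Proof. vm_cast_no_check (erefl true). Qed.

Definition resolutions43 := Eval vm_compute in resolutions 43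
  [:: 0; 0; 0; 0; 0; 0; 0; 0; 0; 0; 0; 0; 0; 0; 0; 0; 0; 0; 0; 0; 0; 0; 0; 0; 0; 0; 0; 0; 0; 0; 0; 0; 0; 0; 0;
   0; 0; 0; 0; 0; 0; 0; 0; 0; 0; 0; 0; 0; 0; 0; 0; 0; 0; 0; 0; 0; 0; 0; 0; 0; 0; 0; 0; 0; 0; 0; 0; 0; 0; 0; 0; 0;
   0; 0; 0; 0; 0; 0; 0; 0; 0; 0; 0; 0; 0; 0; 0; 0; 0; 0; 0; 0; 0; 0; 0; 0; 0; 0; 0; 0]%num.
Lemma resolutions43_ok : all2 resolve (exception_block 43) resolutions43.
Proof. vm_cast_no_check (erefl true). Qed.

Definition resolutions44 := Eval vm_compute in resolutions 44
  [:: 0; 0; 0; 0; 0; 0; 0; 0; 0; 0; 9000; 0; 0; 0; 0; 0; 0; 0; 0; 0; 0; 0; 0; 0; 0; 0; 0; 0; 0; 0; 0; 0; 0; 0;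
   0; 0; 0; 0; 0; 0; 0; 0; 0; 0; 0; 0; 0; 0; 0; 0; 0; 0; 0; 0; 0; 0; 0; 0; 0; 0; 0; 0; 0; 0; 0; 0; 0; 0; 0; 0; 0;
   0; 0; 0; 0; 0; 0; 0; 0; 0; 0; 0; 0; 0; 0; 0; 0; 0; 0; 0; 0; 0; 0; 0; 0; 0; 0; 0; 0; 0]%num.
Lemma resolutions44_ok : all2 resolve (exception_block 44) resolutions44.
Proof. vm_cast_no_check (erefl true). Qed.

Definition resolutions45 := Eval vm_compute in resolutions 45
  [:: 0; 0; 0; 0; 0; 0; 0; 0; 0; 0; 0; 0; 0; 0; 0; 0; 0; 0; 0; 0; 0; 0; 9000; 0; 0; 0; 0; 0; 0; 0; 0; 0; 0; 0;
   0; 0; 0; 0; 0; 0; 0; 0; 0; 0; 0; 0; 0; 0; 0; 0; 0; 0; 0; 0; 0; 0; 0; 0; 0; 0; 0; 9000; 0; 0; 0; 0; 0; 0; 0; 0;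
   0; 0; 0; 0; 0; 0; 0; 0; 0; 0; 0; 0; 0; 0; 0; 0; 0; 0; 0; 0; 0; 0; 0; 0; 0; 0; 0; 0; 0; 0]%num.
Lemma resolutions45_ok : all2 resolve (exception_block 45) resolutions45.
Proof. vm_cast_no_check (erefl true). Qed.

Definition resolutions46 := Eval vm_compute in resolutions 46
  [:: 0; 0; 0; 0; 0; 0; 0; 9000; 0; 0; 0; 0; 0; 0; 0; 0; 0; 0; 0; 0; 0; 0; 0; 0; 0; 0; 0; 0; 0; 0; 0; 0; 0; 0;
   0; 0; 0; 0; 0; 0; 0; 0; 0; 0; 0; 0; 0; 0; 0; 0; 0; 0; 0; 0; 0; 0; 0; 0; 0; 0; 0; 0; 0; 0; 0; 0; 0; 0; 0; 0; 0;
   0; 9000; 0; 0; 0; 0; 0; 0; 0; 0; 0; 9000]%num.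
Lemma resolutions46_ok : all2 resolve (exception_block 46) resolutions46.
Proof. vm_cast_no_check (erefl true). Qed.

Definition all_resolutions : seq (seq resolution) :=
  [:: resolutions0; resolutions1; resolutions2; resolutions3; resolutions4; resolutions5; resolutions6; resolutions7; resolutions8; resolutions9; resolutions10; resolutions11; resolutions12; resolutions13; resolutions14; resolutions15; resolutions16; resolutions17; resolutions18; resolutions19; resolutions20; resolutions21; resolutions22; resolutions23; resolutions24; resolutions25; resolutions26; resolutions27; resolutions28; resolutions29; resolutions30; resolutions31; resolutions32; resolutions33; resolutions34; resolutions35; resolutions36; resolutions37; resolutions38; resolutions39; resolutions40; resolutions41; resolutions42; resolutions43; resolutions44; resolutions45; resolutions46].

Lemma all_resolutions_ok k : (k < 47)%N -> all2 resolve (exception_block k) (nth [::] all_resolutions k).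
Proof.
case: k => [_|k]; first exact: resolutions0_ok.
case: k => [_|k]; first exact: resolutions1_ok.
case: k => [_|k]; first exact: resolutions2_ok.
case: k => [_|k]; first exact: resolutions3_ok.
case: k => [_|k]; first exact: resolutions4_ok.
case: k => [_|k]; first exact: resolutions5_ok.
case: k => [_|k]; first exact: resolutions6_ok.
case: k => [_|k]; first exact: resolutions7_ok.
case: k => [_|k]; first exact: resolutions8_ok.
case: k => [_|k]; first exact: resolutions9_ok.
case: k => [_|k]; first exact: resolutions10_ok.
case: k => [_|k]; first exact: resolutions11_ok.
case: k => [_|k]; first exact: resolutions12_ok.
case: k => [_|k]; first exact: resolutions13_ok.
case: k => [_|k]; first exact: resolutions14_ok.
case: k => [_|k]; first exact: resolutions15_ok.
case: k => [_|k]; first exact: resolutions16_ok.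
case: k => [_|k]; first exact: resolutions17_ok.
case: k => [_|k]; first exact: resolutions18_ok.
case: k => [_|k]; first exact: resolutions19_ok.
case: k => [_|k]; first exact: resolutions20_ok.
case: k => [_|k]; first exact: resolutions21_ok.
case: k => [_|k]; first exact: resolutions22_ok.
case: k => [_|k]; first exact: resolutions23_ok.
case: k => [_|k]; first exact: resolutions24_ok.
case: k => [_|k]; first exact: resolutions25_ok.
case: k => [_|k]; first exact: resolutions26_ok.
case: k => [_|k]; first exact: resolutions27_ok.
case: k => [_|k]; first exact: resolutions28_ok.
case: k => [_|k]; first exact: resolutions29_ok.
case: k => [_|k]; first exact: resolutions30_ok.
case: k => [_|k]; first exact: resolutions31_ok.
case: k => [_|k]; first exact: resolutions32_ok.
case: k => [_|k]; first exact: resolutions33_ok.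
case: k => [_|k]; first exact: resolutions34_ok.
case: k => [_|k]; first exact: resolutions35_ok.
case: k => [_|k]; first exact: resolutions36_ok.
case: k => [_|k]; first exact: resolutions37_ok.
case: k => [_|k]; first exact: resolutions38_ok.
case: k => [_|k]; first exact: resolutions39_ok.
case: k => [_|k]; first exact: resolutions40_ok.
case: k => [_|k]; first exact: resolutions41_ok.
case: k => [_|k]; first exact: resolutions42_ok.
case: k => [_|k]; first exact: resolutions43_ok.
case: k => [_|k]; first exact: resolutions44_ok.
case: k => [_|k]; first exact: resolutions45_ok.
case: k => [_|k]; first exact: resolutions46_ok.
by [].
Qed.

(** * The two sets of exceptions *)

Lemma T_or_listed (F : finFieldType) : T_prop F \/ #|F| \in E_T.
Proof.
have [F3|F3] := ltnP 3 #|F|; last first.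
  by right; have := finNzRing_gt1 F; move: F3; case: #|F| => [|[|[|[|]]]].
case: (sieve_complete F3) => [|[e ein [nE lsP]]]; first by left.
have sz : (size exceptions <= block_size * 47)%N by vm_cast_no_check (erefl true).
have [r] := exceptions_resolved sz all_resolutions_ok ein; exact: resolve_correct.
Qed.

(** With [b] inverse to [a], the two sums in the definition of a pair become the same element. *)
Lemma T_prop_S_prop (F : finFieldType) : T_prop F -> S_prop F.
Proof.
move=> T u v u0 v0; have [a [pa pb]] := T u v u0 v0; exists a, a^-1.
have paV : primitive_elt a^-1.
  have n0 := card_finField_gt0 F; have aV : a^-1 = a ^+ #|F|.-1.-1.
    apply: (mulfI (gen_neq0 pa)); rewrite mulfV ?gen_neq0 // -exprS prednK //.
    by rewrite (prim_expr_order pa).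
  rewrite /primitive_elt aV prim_root_exp_coprime //; case: (#|F|.-1) n0 => // m _.
  exact: coprimenS.
by split; rewrite ?invrK // addrC.
Qed.

(** Steps and trees are empty: only the field and the generator are checked here. *)
Definition field_cert (p : N) (k : nat) : cert :=
  let n := N.pred (N.pow p (N.of_nat k)) in
  let ls := map N.of_nat [seq l <- primes (nat_of n) | odd l] in
  let f := if k == 1%N then [:: 0%num] else find_poly n ls p k 5000 1%num in
  let one := one_list k in let mul := mulL p f in
  let g := if k == 1%N then [:: find_gen n ls p 200 1%num] else X_list k in
  let inv y := powGN one mul y (n - 1)%num in
  Cert p f g (inv g :: [seq inv (addL p (powGN one mul g (N.div n l)) [:: N.pred p])
    | l <- if N.odd n then ls else 2%num :: ls]) [::] [::].

Definition find_pair (n : nat) (P : nat -> nat -> bool) : nat * nat :=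
  let s := [seq (U, V) | U <- iota 0 n, V <- iota 0 n] in
  nth (0, 0)%N s (find (fun uv => P uv.1 uv.2) s).

(* [sd_q] is [sd_p ^ sd_k]; [sd_T] and [sd_S] are logarithms of coefficients [(u, v)] for which no
   suitable elements exist. *)
Record small_field : Type := SmallField {
  sd_q : nat; sd_p : nat; sd_k : nat; sd_cert : cert; sd_T : nat * nat; sd_S : nat * nat }.

Definition small_field_of (pk : nat * nat) : small_field :=
  let q := (pk.1 ^ pk.2)%N in let c := field_cert (N.of_nat pk.1) pk.2 in
  let pws := powers q c in let us := units q in
  SmallField q pk.1 pk.2 c (find_pair q.-1 (no_T q c pws us))
    (if q \in E_S then find_pair q.-1 (no_S q c pws us) else (0, 0)%N).

Definition small_field_ok (d : small_field) : bool :=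
  let q := sd_q d in let c := sd_cert d in let pws := powers q c in let us := units q in
  [&& prime (sd_p d), (0 < sd_k d)%N, q == (sd_p d ^ sd_k d)%N, field_ok q c,
      no_T q c pws us (sd_T d).1 (sd_T d).2 &
      if q \in E_S then no_S q c pws us (sd_S d).1 (sd_S d).2 else has_S q c (foldr muln 1%N (primes q.-1))].

Definition small_fields : seq small_field := Eval vm_compute in
  [seq small_field_of pk | pk <- [:: (2, 1); (3, 1); (2, 2); (5, 1); (7, 1); (3, 2); (11, 1); (13, 1); (19, 1);
     (5, 2); (29, 1); (31, 1); (37, 1); (41, 1); (43, 1); (7, 2); (61, 1); (3, 4); (97, 1); (11, 2); (13, 2)]]%N.

Lemma small_fields_ok : all small_field_ok small_fields && (map sd_q small_fields == E_T).
Proof. vm_cast_no_check (erefl true). Qed.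

Lemma small_field_exists q : q \in E_T -> exists2 d, sd_q d = q & small_field_ok d.
Proof.
case/andP: small_fields_ok => + /eqP <-; elim: small_fields => //= d ds IH /andP[okd okds].
by rewrite inE => /orP[/eqP ->|/(IH okds)]; first exists d.
Qed.

(** [in_T] and [in_S] quantify over all fields of order [q], so refuting them takes an actual field,
    supplied by [PrimePowerField]. The positive claim holds in every field of that order because
    list identities transfer to each by evaluation. *)
Lemma small_field_spec q : q \in E_T ->
  [/\ prime_power q, exists2 F : finFieldType, #|F| = q & ~ T_prop F /\ (q \in E_S -> ~ S_prop F) &
      q \notin E_S -> in_S q].
Proof.
case/small_field_exists => d <- /and5P[pp k0 /eqP qE okf /andP[nT nS]].
split; first by exists (sd_p d), (sd_k d).
- have [F _ cF] := PrimePowerField pp k0; rewrite -qE in cF; exists F => //.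
  have [th [g [hp hf gE gP]]] := field_okP cF okf.
  split; first exact: no_T_correct cF _ _ hp hf gE gP _ _ nT.
  by move=> qS; rewrite qS in nS; exact: no_S_correct cF _ _ hp hf gE gP _ _ nS.
move=> /negbTE qS F cF; rewrite qS in nS.
have [th [g [hp hf gE gP]]] := field_okP cF okf.
by move: nS; apply: has_S_correct; eauto.
Qed.

Theorem theorem1p5 :
  (forall q : nat, q \in E_T <-> (prime_power q /\ ~ in_T q)) /\
  (forall q : nat, q \in E_S <-> (prime_power q /\ ~ in_S q)).
Proof.
have ST q : q \in E_S -> q \in E_T.
  by move: q; apply/allP.
split=> q; split.
- by case/small_field_spec => pq [F cF [nT _]] _; split=> // /(_ F cF).
- case=> _ nT; apply: contraT => qT; case: nT => F cF.
  by case: (T_or_listed F) => //; rewrite cF (negbTE qT).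
- move=> qS; have [pq [F cF [_ nS]] _] := small_field_spec (ST q qS).
  by split=> // /(_ F cF); exact: nS.
case=> _ nS; apply: contraT => qS; case: nS.
have [/small_field_spec[_ _] | qT] := boolP (q \in E_T); first exact.
move=> F cF; apply: T_prop_S_prop.
by case: (T_or_listed F) => //; rewrite cF (negbTE qT).
Qed.
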